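(* Let $n\ge 1$ and let $u$ be a convex Alexandrov solution of $\det D^2u\ge 1$ in the unit ball $B_1\subset\mathbb{R}^n$. Let $\Sigma\subset B_1$ be the set of points at which $u$ is not strictly convex. Then $\mathcal{H}^{n-1}(\Sigma)=0$.
   Context: For a convex function $v$ on an open set $\Omega\subset\mathbb{R}^n$, $p\in\mathbb{R}^n$ is a subgradient of $v$ at $x$ if $v(y)\ge v(x)+p\cdot(y-x)$ for all $y\in\Omega$; $\partial v(x)$ denotes the set of subgradients and $\partial v(A)=\bigcup_{x\in A}\partial v(x)$. The Monge–Ampère measure of $v$ is the Borel measure $Mv(A)=|\partial v(A)|$ (Lebesgue measure). $v$ is an Alexandrov solution of $\det D^2v\ge 1$ if $Mv(A)\ge |A|$ for all Borel $A\subset\Omega$. A convex function $u$ is strictly convex at $x_0$ if there is a supporting affine function $L_{x_0}$ at $x_0$ (i.e. $L_{x_0}(y)=u(x_0)+p\cdot(y-x_0)$ with $p\in\partial u(x_0)$) such that $\{u=L_{x_0}\}=\{x_0\}$. $\mathcal{H}^{n-1}$ is the $(n-1)$-dimensional Hausdorff measure. *)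

(* Defs.v *)
From Stdlib Require Import Reals.
From mathcomp Require Import ssreflect ssrfun ssrbool eqtype ssrnat seq fintype bigop.

Set Implicit Arguments.
Unset Strict Implicit.

Local Open Scope R_scope.

Definition Rn (n : nat) := 'I_n -> R.

Definition vsub {n} (x y : Rn n) : Rn n := fun i => x i - y i.
Definition dot {n} (x y : Rn n) : R := \big[Rplus/R0]_(i < n) (x i * y i).
Definition dist {n} (x y : Rn n) : R := sqrt (dot (vsub x y) (vsub x y)).

Definition unit_ball {n} (x : Rn n) : Prop := dot x x < 1.

Definition is_open {n} (A : Rn n -> Prop) : Prop :=
  forall x, A x -> exists r, 0 < r /\ forall y, dist x y < r -> A y.

Inductive borel {n} : (Rn n -> Prop) -> Prop :=
| borel_open A : is_open A -> borel A
| borel_compl A : borel A -> borel (fun x => ~ A x)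
| borel_union (F : nat -> Rn n -> Prop) :
    (forall k, borel (F k)) -> borel (fun x => exists k, F k x)
| borel_ext A B : borel A -> (forall x, A x <-> B x) -> borel B.

Definition convex_on {n} (Omega : Rn n -> Prop) (v : Rn n -> R) : Prop :=
  forall x y t, Omega x -> Omega y -> 0 <= t <= 1 ->
    v (fun i => t * x i + (1 - t) * y i) <= t * v x + (1 - t) * v y.

Definition subgrad {n} (Omega : Rn n -> Prop) (v : Rn n -> R) (x p : Rn n) : Prop :=
  forall y, Omega y -> v y >= v x + dot p (vsub y x).

Definition subdiff_img {n} (Omega : Rn n -> Prop) (v : Rn n -> R)
  (A : Rn n -> Prop) (p : Rn n) : Prop :=
  exists x, A x /\ subgrad Omega v x p.

Definition in_box {n} (b : Rn n * Rn n) (x : Rn n) : Prop :=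
  forall i, fst b i <= x i <= snd b i.
Definition box_vol {n} (b : Rn n * Rn n) : R :=
  \big[Rmult/R1]_(i < n) (snd b i - fst b i).
Definition box_cover {n} (B : nat -> Rn n * Rn n) (X : Rn n -> Prop) : Prop :=
  (forall k i, fst (B k) i <= snd (B k) i) /\
  (forall x, X x -> exists k, in_box (B k) x).

(** |A| <= |X| for Lebesgue (outer) measure, unfolded:
    every countable box cover of X of total volume S can be beaten, up to
    any eps > 0, by a box cover of A. *)
Definition leb_le {n} (A X : Rn n -> Prop) : Prop :=
  forall (B : nat -> Rn n * Rn n) S, box_cover B X ->
    infinite_sum (fun k => box_vol (B k)) S ->
    forall eps, 0 < eps ->
      exists (B' : nat -> Rn n * Rn n) S', box_cover B' A /\
        infinite_sum (fun k => box_vol (B' k)) S' /\ S' <= S + eps.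

Definition alexandrov_det_ge1 {n} (Omega : Rn n -> Prop) (v : Rn n -> R) : Prop :=
  forall A, borel A -> (forall x, A x -> Omega x) ->
    leb_le A (subdiff_img Omega v A).

Definition strictly_convex_at {n} (Omega : Rn n -> Prop) (u : Rn n -> R) (x0 : Rn n) : Prop :=
  exists p, subgrad Omega u x0 p /\
    forall y, Omega y -> u y = u x0 + dot p (vsub y x0) -> forall i, y i = x0 i.

(** H^s(E) = 0 (Hausdorff measure of dimension s, s a natural number),
    unfolded: for all eps, delta > 0 there is a countable cover by sets F k
    of diameter <= d k <= delta with sum over nonempty F k of (d k)^s < eps.
    (The normalising constant of H^s is irrelevant for nullity.) *)
Definition hausdorff_null {n} (s : nat) (E : Rn n -> Prop) : Prop :=
  forall eps delta, 0 < eps -> 0 < delta ->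
    exists (F : nat -> Rn n -> Prop) (d w : nat -> R) S,
      (forall x, E x -> exists k, F k x) /\
      (forall k, 0 <= d k <= delta) /\
      (forall k y z, F k y -> F k z -> dist y z <= d k) /\
      (forall k, 0 <= w k) /\
      (forall k, (exists x, F k x) -> d k ^ s <= w k) /\
      infinite_sum w S /\ S < eps.

(* Main.v *)
From Stdlib Require Import Reals Lra Lia Classical ClassicalEpsilon FunctionalExtensionality.
From HB Require Import structures.
From mathcomp Require Import ssreflect ssrfun ssrbool eqtype ssrnat seq fintype finfun bigop.
Require Import Defs.

(** At a singular point [x0] and for a subgradient [p], the function [f = u - L_p] vanishes on a
    segment [[0, len e]].  The inequality [det D^2 u >= 1] bounds by [C t^n] the volume of every
    simplex on which [f <= t^2], so the sections [{f <= t^2}] are thin across the segment, and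
    the gradient image of [v = u + |x|^2 / 2] over a ball of radius [rho] is correspondingly
    large.  Suppose its measure were at most [M rho^(n-1)] for all small [rho].  Choosing the
    directions of the section greedily, one finds inductively that all but the last one have
    width comparable to [t]; by the volume bound the last width is [O(t^2)].  Hence [u] is not
    differentiable at [x0]: there is another subgradient [q].  Let [p1] be the subgradient at [x0]
    extremal in the direction [w = q - p], and repeat the argument with the slope [(p + p1) / 2]:
    the simplex can be prolonged along [w] to a length that is not [O(t^2)] while [u - L_{p1}] stays
    [O(t^2)], against the volume bound.  So the ratio of the measure to [rho^(n-1)] is unbounded
    at singular points.  As the inverse of the gradient of [v] is 1-Lipschitz, disjoint balls have
    separated gradient images, and a Vitali covering shows that the singular set is
    [H^(n-1)]-null. *)

Set Implicit Arguments.
Unset Strict Implicit.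
Local Open Scope R_scope.

(** The obstacle is that the section may collapse in several directions across the segment, and the
    volume bound alone then says nothing about a single width. Two upper bounds are played off
    against each other: the volume bound limits the product of the widths [a l], and the mass limits
    a product of slopes of size [t * t / a l]. When they are multiplied, the unknown thin widths
    cancel, and what is left is a count of powers of [t]. It is decided by the segment: its edge may
    have the fixed length [len] at no cost in height, one factor [1 / t] better than the edges of
    length [t]. The term [|x|^2 / 2] makes positions, and mixtures of positions and slopes,
    Lipschitz functions of the gradient, so that the mass bounds the volume of boxes in such mixed
    coordinates. Lebesgue measure enters only through box covers and their behaviour under Lipschitz
    correspondences. In dimension one the claim is that there are no singular points at all; it
    follows from the volume bound directly. *)

HB.instance Definition _ := Monoid.isComLaw.Build R R0 Rplus
  (fun x y z => esym (Rplus_assoc x y z)) Rplus_comm Rplus_0_l.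
HB.instance Definition _ := Monoid.isComLaw.Build R R1 Rmult
  (fun x y z => esym (Rmult_assoc x y z)) Rmult_comm Rmult_1_l.
HB.instance Definition _ := Monoid.isMulLaw.Build R R0 Rmult Rmult_0_l Rmult_0_r.
HB.instance Definition _ := Monoid.isAddLaw.Build R Rmult Rplus
  Rmult_plus_distr_r Rmult_plus_distr_l.

Notation "\rsum_ ( i < n ) F" := (\big[Rplus/R0]_(i < n) F)
  (at level 41, F at level 41, i, n at level 50).
Notation "\rprod_ ( i < n ) F" := (\big[Rmult/R1]_(i < n) F)
  (at level 36, F at level 36, i, n at level 50).

Lemma choice_fun (A B : Type) (P : A -> B -> Prop) :
  (forall x, exists y, P x y) -> exists f, forall x, P x (f x).
Proof.
move=> H; exists (fun x => proj1_sig (constructive_indefinite_description _ (H x))) => x.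
exact: proj2_sig (constructive_indefinite_description _ (H x)).
Qed.

Lemma Rabs_bounds x a : Rabs x <= a -> - a <= x <= a.
Proof. by rewrite /Rabs; case: Rcase_abs => *; lra. Qed.

(** * Finite sums and products of real numbers *)

Section Sums.
Variables (I : Type) (r : seq I) (P : pred I).
Implicit Types F G : I -> R.

Lemma rsum_le F G : (forall i, P i -> F i <= G i) ->
  \big[Rplus/R0]_(i <- r | P i) F i <= \big[Rplus/R0]_(i <- r | P i) G i.
Proof. by move=> H; elim/big_ind2: _ => // *; lra. Qed.

Lemma rsum_ge0 F : (forall i, P i -> 0 <= F i) -> 0 <= \big[Rplus/R0]_(i <- r | P i) F i.
Proof. by move=> H; elim/big_ind: _ => // *; lra. Qed.

Lemma rsum_abs F :
  Rabs (\big[Rplus/R0]_(i <- r | P i) F i) <= \big[Rplus/R0]_(i <- r | P i) Rabs (F i).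
Proof.
elim/big_ind2: _ => [|x1 x2 y1 y2 H1 H2|i _]; [by rewrite Rabs_R0; lra| |lra].
apply: Rle_trans (Rabs_triang _ _) _; exact: Rplus_le_compat.
Qed.

Lemma rprod_ge0 F : (forall i, P i -> 0 <= F i) -> 0 <= \big[Rmult/R1]_(i <- r | P i) F i.
Proof. by move=> H; elim/big_ind: _ => // *; [lra|exact: Rmult_le_pos]. Qed.

Lemma rprod_gt0 F : (forall i, P i -> 0 < F i) -> 0 < \big[Rmult/R1]_(i <- r | P i) F i.
Proof. by move=> H; elim/big_ind: _ => // *; [lra|exact: Rmult_lt_0_compat]. Qed.

Lemma rprod_le F G : (forall i, P i -> 0 <= F i <= G i) ->
  \big[Rmult/R1]_(i <- r | P i) F i <= \big[Rmult/R1]_(i <- r | P i) G i.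
Proof.
move=> H; suff : 0 <= \big[Rmult/R1]_(i <- r | P i) F i <= \big[Rmult/R1]_(i <- r | P i) G i by lra.
elim/big_ind2: _ => [|x1 x2 y1 y2 H1 H2|i Pi]; [lra| |exact: H].
by split; [apply: Rmult_le_pos; lra|apply: Rmult_le_compat; lra].
Qed.
End Sums.

Lemma rsum_const n c : \rsum_(i < n) c = INR n * c.
Proof.
rewrite big_const_ord; elim: n => [|n IH]; first by rewrite /=; lra.
by rewrite iterS IH S_INR; lra.
Qed.

Lemma rprod_const n c : \rprod_(i < n) c = c ^ n.
Proof. by rewrite big_const_ord; elim: n => [//|n IH]; rewrite iterS IH. Qed.

Lemma rsum_ord_le n (F : 'I_n -> R) c : (forall i, F i <= c) -> \rsum_(i < n) F i <= INR n * c.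
Proof. by move=> H; rewrite -rsum_const; apply: rsum_le. Qed.

Lemma rsum_D1 n (F : 'I_n -> R) j :
  \rsum_(i < n) F i = F j + \big[Rplus/R0]_(i < n | i != j) F i.
Proof. exact: bigD1. Qed.

Lemma rprod_D1 n (F : 'I_n -> R) j :
  \rprod_(i < n) F i = F j * \big[Rmult/R1]_(i < n | i != j) F i.
Proof. exact: bigD1. Qed.

Lemma rsum_recr n (F : nat -> R) : \rsum_(i < n.+1) F i = \rsum_(i < n) F i + F n.
Proof. exact: big_ord_recr. Qed.

Lemma rprod_recr n (F : nat -> R) : \rprod_(i < n.+1) F i = \rprod_(i < n) F i * F n.
Proof. exact: big_ord_recr. Qed.

Lemma rprod_recl n (F : nat -> R) : \rprod_(i < n.+1) F i = F 0%N * \rprod_(i < n) F i.+1.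
Proof. exact: big_ord_recl. Qed.

Lemma rsum_add I (r : seq I) (P : pred I) (F G : I -> R) :
  \big[Rplus/R0]_(i <- r | P i) (F i + G i) =
  \big[Rplus/R0]_(i <- r | P i) F i + \big[Rplus/R0]_(i <- r | P i) G i.
Proof. exact: big_split. Qed.

Lemma rsum_mulr I (r : seq I) (P : pred I) (F : I -> R) c :
  c * \big[Rplus/R0]_(i <- r | P i) F i = \big[Rplus/R0]_(i <- r | P i) (c * F i).
Proof. exact: big_distrr. Qed.

Lemma rprod_mul I (r : seq I) (P : pred I) (F G : I -> R) :
  \big[Rmult/R1]_(i <- r | P i) (F i * G i) =
  \big[Rmult/R1]_(i <- r | P i) F i * \big[Rmult/R1]_(i <- r | P i) G i.
Proof. exact: big_split. Qed.

Lemma rsum_exchange I J (r : seq I) (s : seq J) (F : I -> J -> R) :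
  \big[Rplus/R0]_(i <- r) \big[Rplus/R0]_(j <- s) F i j =
  \big[Rplus/R0]_(j <- s) \big[Rplus/R0]_(i <- r) F i j.
Proof. exact: exchange_big. Qed.

Lemma rsum_ge_term n (F : 'I_n -> R) j : (forall i, 0 <= F i) -> F j <= \rsum_(i < n) F i.
Proof.
move=> H; rewrite (rsum_D1 _ j).
suff : 0 <= \big[Rplus/R0]_(i < n | i != j) F i by lra.
by apply: rsum_ge0.
Qed.

Lemma rsum_eq0 n (F : 'I_n -> R) : (forall i, 0 <= F i) -> \rsum_(i < n) F i <= 0 -> forall i, F i = 0.
Proof. by move=> H H1 i; have := rsum_ge_term i H; have := H i; lra. Qed.

Lemma rsum_delta n (j : 'I_n) (F : 'I_n -> R) :
  \rsum_(i < n) (if i == j then F i else 0) = F j.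
Proof.
rewrite (rsum_D1 _ j) eqxx big1 ?Rplus_0_r // => i /negbTE ->; reflexivity.
Qed.

(** * Euclidean vectors *)

Definition vadd {n} (x y : Rn n) : Rn n := fun i => x i + y i.
Definition vscale {n} (a : R) (x : Rn n) : Rn n := fun i => a * x i.
Definition vzero {n} : Rn n := fun _ => 0.
Definition norm {n} (x : Rn n) : R := sqrt (dot x x).
Definition basis {n} (j : 'I_n) : Rn n := fun i => if i == j then 1 else 0.
Definition lincomb {n} (m : nat) (c : nat -> R) (g : nat -> Rn n) : Rn n :=
  fun j => \rsum_(i < m) (c i * g i j).

Section Vectors.
Variable n : nat.
Implicit Types x y z : Rn n.

Lemma vecP x y : (forall i, x i = y i) -> x = y.
Proof. by move=> H; apply: functional_extensionality. Qed.

Lemma dotC x y : dot x y = dot y x.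
Proof. by apply: eq_bigr => i _; apply: Rmult_comm. Qed.

Lemma dotDl x y z : dot (vadd x y) z = dot x z + dot y z.
Proof. by rewrite /dot -rsum_add; apply: eq_bigr => i _; rewrite /vadd; ring. Qed.

Lemma dotDr x y z : dot z (vadd x y) = dot z x + dot z y.
Proof. by rewrite dotC dotDl !(dotC z). Qed.

Lemma dotZl a x y : dot (vscale a x) y = a * dot x y.
Proof. by rewrite /dot rsum_mulr; apply: eq_bigr => i _; rewrite /vscale; ring. Qed.

Lemma dotZr a x y : dot y (vscale a x) = a * dot y x.
Proof. by rewrite dotC dotZl dotC. Qed.

Lemma vsubE x y : vsub x y = vadd x (vscale (-1) y).
Proof. by apply: vecP => i; rewrite /vsub /vadd /vscale; ring. Qed.

Lemma dotBl x y z : dot (vsub x y) z = dot x z - dot y z.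
Proof. by rewrite vsubE dotDl dotZl; ring. Qed.

Lemma dotBr x y z : dot z (vsub x y) = dot z x - dot z y.
Proof. by rewrite vsubE dotDr dotZr; ring. Qed.

Lemma dot0l x : dot vzero x = 0.
Proof. by rewrite /dot big1 // => i _; rewrite /vzero; ring. Qed.

Lemma dot0r x : dot x vzero = 0.
Proof. by rewrite dotC dot0l. Qed.

Lemma dot_basis x j : dot x (basis j) = x j.
Proof.
rewrite -[RHS](rsum_delta j x); apply: eq_bigr => i _; rewrite /basis.
by case: eqP => _; ring.
Qed.

Lemma dot_ge0 x : 0 <= dot x x.
Proof. by apply: rsum_ge0 => i _; nra. Qed.

Lemma dot_eq0 x : dot x x = 0 -> x = vzero.
Proof.
move=> H; apply: vecP => i.
have := @rsum_eq0 n (fun i => x i * x i) (fun i => Rle_0_sqr (x i)).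
by move=> /(_ (Req_le _ _ H) i); rewrite /vzero; nra.
Qed.

Lemma coord_sqr x i : x i * x i <= dot x x.
Proof. by apply: (@rsum_ge_term n (fun i => x i * x i)) => j; nra. Qed.

Lemma norm_ge0 x : 0 <= norm x. Proof. exact: sqrt_pos. Qed.

Lemma norm_sqr x : norm x * norm x = dot x x.
Proof. by apply: sqrt_sqrt; apply: dot_ge0. Qed.

Lemma norm_gt0 x : x <> vzero -> 0 < norm x.
Proof.
move=> H; have [//|E] := Rle_lt_or_eq_dec _ _ (norm_ge0 x).
by case: H; apply: dot_eq0; rewrite -norm_sqr -E; ring.
Qed.

Lemma cauchy_schwarz x y : Rabs (dot x y) <= norm x * norm y.
Proof.
apply: Rsqr_incr_0_var; last by apply: Rmult_le_pos; apply: norm_ge0.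
rewrite -Rsqr_abs /Rsqr.
have -> : norm x * norm y * (norm x * norm y) = dot x x * dot y y.
  by rewrite -(norm_sqr x) -(norm_sqr y); ring.
have H := dot_ge0 (vsub (vscale (dot y y) x) (vscale (dot x y) y)).
rewrite !(dotBl, dotBr, dotZl, dotZr) (dotC y x) in H.
have [y0|/esym y0] := Rle_lt_or_eq_dec _ _ (dot_ge0 y).
  have : 0 <= dot y y * (dot x x * dot y y - dot x y * dot x y) by nra.
  by nra.
by rewrite (dot_eq0 y0) !dot0r; lra.
Qed.

Lemma normZ a x : norm (vscale a x) = Rabs a * norm x.
Proof.
rewrite /norm dotZl dotZr -Rmult_assoc sqrt_mult; [|nra|exact: dot_ge0].
by rewrite -/(Rsqr a) sqrt_Rsqr_abs.
Qed.

Lemma norm_triang x y : norm (vadd x y) <= norm x + norm y.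
Proof.
apply: Rsqr_incr_0_var; last by have := norm_ge0 x; have := norm_ge0 y; lra.
rewrite /Rsqr norm_sqr !(dotDl, dotDr) -!norm_sqr (dotC y x).
by have := cauchy_schwarz x y; have := Rle_abs (dot x y); lra.
Qed.

Lemma norm_coord x i : Rabs (x i) <= norm x.
Proof.
apply: Rsqr_incr_0_var; last exact: norm_ge0.
by rewrite -Rsqr_abs /Rsqr norm_sqr; apply: coord_sqr.
Qed.

Lemma norm_le_sqr x a : 0 <= a -> dot x x <= a * a -> norm x <= a.
Proof. by move=> a0 H; apply: Rsqr_incr_0_var => //; rewrite /Rsqr norm_sqr. Qed.

Lemma norm_le_coord x s : 0 <= s -> (forall i, Rabs (x i) <= s) -> norm x <= INR n * s.
Proof.
move=> s0 H; apply: norm_le_sqr; first by apply: Rmult_le_pos => //; apply: pos_INR.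
have H1 : dot x x <= INR n * (s * s).
  apply: rsum_ord_le => i; move: (H i); rewrite /Rabs; case: Rcase_abs => *; nra.
have : INR n = 0 \/ 1 <= INR n.
  by case: n => [|m]; [left|right; rewrite S_INR; have := pos_INR m; lra].
have : 0 <= s * s by nra.
by move: H1; set N := INR n; move=> H1 ? [N0|N1]; nra.
Qed.

Lemma distE x y : dist x y = norm (vsub x y). Proof. by []. Qed.

Lemma dist_sym x y : dist x y = dist y x.
Proof.
rewrite !distE (_ : vsub x y = vscale (-1) (vsub y x)); last first.
  by apply: vecP => i; rewrite /vsub /vscale; ring.
by rewrite normZ Rabs_Ropp Rabs_R1 Rmult_1_l.
Qed.

Lemma dist_triang x y z : dist x z <= dist x y + dist y z.
Proof.
rewrite !distE (_ : vsub x z = vadd (vsub x y) (vsub y z)); last first.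
  by apply: vecP => i; rewrite /vsub /vadd; ring.
exact: norm_triang.
Qed.

Lemma unit_ballE x : unit_ball x <-> norm x < 1.
Proof.
rewrite /unit_ball -norm_sqr; have := norm_ge0 x; split; nra.
Qed.

Lemma dot_lincomb x m c (g : nat -> Rn n) :
  dot x (lincomb m c g) = \rsum_(i < m) (c i * dot x (g i)).
Proof.
rewrite /dot /lincomb; under eq_bigr do rewrite rsum_mulr.
rewrite rsum_exchange; apply: eq_bigr => i _.
by rewrite rsum_mulr; apply: eq_bigr => j _; ring.
Qed.

Lemma lincombS m c (g : nat -> Rn n) :
  lincomb m.+1 c g = vadd (lincomb m c g) (vscale (c m) (g m)).
Proof. by apply: vecP => i; rewrite /lincomb (rsum_recr _ (fun j => c j * g j i)). Qed.

Lemma lincomb0 c (g : nat -> Rn n) : lincomb 0 c g = vzero.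
Proof. by apply: vecP => i; rewrite /lincomb big_ord0. Qed.

Lemma eq_lincomb m c c' (g g' : nat -> Rn n) :
  (forall i, (i < m)%N -> vscale (c i) (g i) = vscale (c' i) (g' i)) ->
  lincomb m c g = lincomb m c' g'.
Proof.
move=> H; apply: vecP => j; apply: eq_bigr => i _.
by have := H i (ltn_ord i) => /(congr1 (fun f => f j)).
Qed.

(** * Orthonormal families *)

Definition orthonormal m (g : nat -> Rn n) : Prop :=
  forall i j, (i < m)%N -> (j < m)%N -> dot (g i) (g j) = if i == j then 1 else 0.

Definition residual m (g : nat -> Rn n) x : Rn n :=
  vsub x (lincomb m (fun i => dot (g i) x) g).

Lemma orthonormal_norm m g i : orthonormal m g -> (i < m)%N -> norm (g i) = 1.
Proof. by move=> H im; rewrite /norm H // eqxx sqrt_1. Qed.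

Lemma orthonormal_dot_le m g i x : orthonormal m g -> (i < m)%N -> Rabs (dot (g i) x) <= norm x.
Proof.
by move=> H im; have := cauchy_schwarz (g i) x; rewrite (orthonormal_norm H im); lra.
Qed.

Lemma dot_orthonormal_lincomb m k g c j : orthonormal m g -> (k <= m)%N -> (j < m)%N ->
  dot (g j) (lincomb k c g) = if (j < k)%N then c j else 0.
Proof.
move=> H km jm; rewrite dot_lincomb.
transitivity (\rsum_(i < k) (if val i == j then c i else 0)).
  apply: eq_bigr => i _; rewrite H // ?(leq_trans (ltn_ord i)) // eq_sym.
  by case: eqP => _; ring.
case: ltnP => jk.
  by rewrite -[c j](@rsum_delta k (Ordinal jk) (fun i => c i)).
by rewrite big1 // => i _; case: eqP => // E; move: jk; rewrite -E leqNgt ltn_ord.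
Qed.

Lemma dot_residual m g x j : orthonormal m g -> (j < m)%N -> dot (g j) (residual m g x) = 0.
Proof.
by move=> H jm; rewrite /residual dotBr (dot_orthonormal_lincomb _ H) // jm; ring.
Qed.

Lemma residual_sqr m g x : orthonormal m g ->
  dot (residual m g x) (residual m g x) = dot x x - \rsum_(i < m) (dot (g i) x * dot (g i) x).
Proof.
move=> H.
have -> : dot (residual m g x) (residual m g x) = dot x (residual m g x).
  rewrite {1}/residual dotBl (dotC (lincomb _ _ _)) dot_lincomb big1 ?Rminus_0_r // => i _.
  by rewrite (dotC (residual _ _ _)) dot_residual //; ring.
by rewrite {1}/residual dotBr dot_lincomb; congr (_ - _); apply: eq_bigr => i _; rewrite (dotC x).
Qed.

(* Summed over the standard basis, the squared residuals count the codimension of the span. *)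
Lemma residual_trace m g : orthonormal m g ->
  \rsum_(l < n) dot (residual m g (basis l)) (residual m g (basis l)) = INR n - INR m.
Proof.
move=> H; under eq_bigr do rewrite residual_sqr //.
transitivity (\rsum_(l < n) (1 + (-1) * \rsum_(i < m) (g i l * g i l))).
  apply: eq_bigr => l _; rewrite dot_basis {1}/basis eqxx.
  rewrite (_ : \rsum_(i < m) _ = \rsum_(i < m) (g i l * g i l)); first by ring.
  by apply: eq_bigr => i _; rewrite dot_basis.
rewrite rsum_add -rsum_mulr rsum_const rsum_exchange.
rewrite (_ : \big[Rplus/R0]_(j <- _) _ = \rsum_(i < m) 1); last first.
  by apply: eq_bigr => i _; rewrite -/(dot (g i) (g i)) H // eqxx.
by rewrite rsum_const; ring.
Qed.

(** Otherwise the trace [n - m] of the residuals would vanish. This supplies the next direction in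
    the greedy construction of frames. *)
Lemma residual_nonzero m g : orthonormal m g -> (m < n)%N ->
  exists l, residual m g (basis l) <> vzero.
Proof.
move=> H mn; apply: NNPP => H1.
have := residual_trace H; rewrite big1; last first.
  move=> l _; have -> : residual m g (basis l) = vzero by apply: NNPP => ?; apply: H1; exists l.
  exact: dot0l.
by have /lt_INR : (m < n)%coq_nat by [apply/ltP]; lra.
Qed.

(** For [m = n] the trace of the residuals is 0, so every standard basis vector is reproduced by its
    expansion; pairing this with [x] gives the coordinates of [x]. *)
Lemma orthonormal_expand g x : orthonormal n g -> x = lincomb n (fun i => dot (g i) x) g.
Proof.
move=> H.
have R0 l : residual n g (basis l) = vzero.
  apply: dot_eq0; apply: (@rsum_eq0 n (fun l => dot (residual n g (basis l)) (residual n g (basis l)))).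
    by move=> i; apply: dot_ge0.
  by rewrite residual_trace //; lra.
apply: vecP => j; rewrite -(dot_basis x j).
have -> : basis j = lincomb n (fun i => dot (g i) (basis j)) g.
  apply: vecP => k; have := congr1 (fun f => f k) (R0 j).
  by rewrite /residual /vsub /vzero; lra.
rewrite dot_lincomb; apply: eq_bigr => i _; rewrite dot_basis (dotC x); ring.
Qed.

Lemma parseval g x : orthonormal n g -> dot x x = \rsum_(i < n) (dot (g i) x * dot (g i) x).
Proof.
move=> H; rewrite {2}(orthonormal_expand x H) dot_lincomb.
by apply: eq_bigr => i _; rewrite (dotC x).
Qed.

Lemma norm_le_orthonormal_coord g x s : orthonormal n g -> 0 <= s ->
  (forall i, (i < n)%N -> Rabs (dot (g i) x) <= s) -> norm x <= INR n * s.
Proof.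
move=> H s0 H1.
have -> : norm x = norm ((fun i : 'I_n => dot (g i) x) : Rn n) by rewrite /norm (parseval x H).
by apply: norm_le_coord => // i; apply: H1.
Qed.

End Vectors.

(** * Volumes of box covers *)

Lemma eventually_ord n (P : 'I_n -> nat -> Prop) :
  (forall i, exists m, forall k, (m <= k)%N -> P i k) ->
  exists m, forall i k, (m <= k)%N -> P i k.
Proof.
move=> /choice_fun[f H]; exists (\max_(i < n) f i) => i k Hk.
by apply: H; apply: leq_trans Hk; apply: leq_bigmax.
Qed.

Lemma pow_half_lt c eps : 0 < eps -> exists m, forall k, (m <= k)%N -> c / 2 ^ k < eps.
Proof.
move=> e0; have [c0|c0] := Rle_lt_dec c 0.
  exists 0%N => k _; have := pow_lt 2 k ltac:(lra) => H.
  by apply: Rle_lt_trans e0; rewrite /Rdiv; have := Rinv_0_lt_compat _ H; nra.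
have [m Hm] := Pow_x_infinity 2 ltac:(rewrite Rabs_pos_eq; lra) (c / eps + 1).
exists m => k mk; have := Hm k ltac:(by apply/leP).
rewrite Rabs_pos_eq; last by apply: pow_le; lra.
have := pow_lt 2 k ltac:(lra) => H1 H2.
apply: (Rmult_lt_reg_r (2 ^ k)) => //; rewrite /Rdiv Rmult_assoc Rinv_l; last lra.
have -> : c * 1 = c / eps * eps by field; lra.
have : 0 < c / eps by apply: Rdiv_lt_0_compat.
by nra.
Qed.

Section BoxCovers.
Variable n : nat.
Implicit Types b Q : Rn n * Rn n.

(** The volume of the intersection of two boxes; truncation at 0 takes care of disjoint ones. *)
Definition overlap b Q : R :=
  \rprod_(i < n) Rmax 0 (Rmin (snd b i) (snd Q i) - Rmax (fst b i) (fst Q i)).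

Definition lower_half Q j : Rn n * Rn n :=
  (fst Q, fun i => if i == j then (fst Q i + snd Q i) / 2 else snd Q i).
Definition upper_half Q j : Rn n * Rn n :=
  (fun i => if i == j then (fst Q i + snd Q i) / 2 else fst Q i, snd Q).

Lemma box_vol_halves Q j :
  box_vol Q = box_vol (lower_half Q j) + box_vol (upper_half Q j).
Proof.
rewrite /box_vol !(rprod_D1 _ j) /= eqxx.
set G := fun i => snd Q i - fst Q i.
rewrite (eq_bigr G) //.
rewrite [X in _ = _ * X + _](eq_bigr G); last by move=> i /negbTE ->.
rewrite [X in _ = _ + _ * X](eq_bigr G); last by move=> i /negbTE ->.
by field.
Qed.

Lemma overlap_halves b Q j : fst Q j <= snd Q j ->
  overlap b Q = overlap b (lower_half Q j) + overlap b (upper_half Q j).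
Proof.
move=> HQ; rewrite /overlap !(rprod_D1 _ j) /= eqxx.
set G := fun i => Rmax 0 (Rmin (snd b i) (snd Q i) - Rmax (fst b i) (fst Q i)).
rewrite (eq_bigr G) //.
rewrite [X in _ = _ * X + _](eq_bigr G); last by move=> i /negbTE; rewrite /G => ->.
rewrite [X in _ = _ + _ * X](eq_bigr G); last by move=> i /negbTE; rewrite /G => ->.
rewrite -Rmult_plus_distr_r; congr (_ * _).
by rewrite /Rmin /Rmax; repeat case: Rle_dec; intros; lra.
Qed.

Lemma overlap_ge0 b Q : 0 <= overlap b Q.
Proof. by apply: rprod_ge0 => i _; apply: Rmax_l. Qed.

Lemma overlap_le b Q : (forall i, fst b i <= snd b i) -> overlap b Q <= box_vol b.
Proof.
move=> Hb; apply: rprod_le => i _; have := Hb i.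
by rewrite /Rmin /Rmax; repeat case: Rle_dec; intros; lra.
Qed.

Lemma overlap_sub b Q : (forall i, fst b i <= fst Q i) -> (forall i, fst Q i <= snd Q i) ->
  (forall i, snd Q i <= snd b i) -> overlap b Q = box_vol Q.
Proof.
move=> H1 H2 H3; apply: eq_bigr => i _; move: (H1 i) (H2 i) (H3 i).
by rewrite /Rmin /Rmax; repeat case: Rle_dec; intros; lra.
Qed.

Variables (T : nat -> finType) (F : forall k, T k -> Rn n * Rn n).

Definition total_overlap N Q : R :=
  \rsum_(k < N) \big[Rplus/R0]_(f : T k) overlap (F f) Q.

(** Countable subadditivity for [Q], expressed through partial sums. The property passes from two
    halves to the whole, which is what bisection needs. *)
Definition full Q : Prop :=
  forall s, s < box_vol Q -> exists N, s < total_overlap N Q.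

Lemma total_overlap_mono N N' Q : (N <= N')%N -> total_overlap N Q <= total_overlap N' Q.
Proof.
move=> /subnK <-; elim: (N' - N)%N => [|k IH]; first by rewrite add0n; lra.
rewrite addSn /total_overlap.
rewrite (rsum_recr _ (fun k => \big[Rplus/R0]_(f : T k) overlap (F f) Q)).
have : 0 <= \big[Rplus/R0]_(f : T (k + N)) overlap (F f) Q.
  by apply: rsum_ge0 => f _; apply: overlap_ge0.
by move: IH; rewrite /total_overlap; lra.
Qed.

Lemma total_overlap_halves N Q j : fst Q j <= snd Q j ->
  total_overlap N Q = total_overlap N (lower_half Q j) + total_overlap N (upper_half Q j).
Proof.
move=> HQ; rewrite /total_overlap -rsum_add; apply: eq_bigr => k _.
by rewrite -rsum_add; apply: eq_bigr => f _; apply: overlap_halves.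
Qed.

Lemma full_halves Q j : fst Q j <= snd Q j ->
  full (lower_half Q j) -> full (upper_half Q j) -> full Q.
Proof.
move=> HQ Hl Hu s Hs; have E := box_vol_halves Q j.
set e := (box_vol Q - s) / 2.
have [|N1 H1] := Hl (box_vol (lower_half Q j) - e); first by rewrite /e; lra.
have [|N2 H2] := Hu (box_vol (upper_half Q j) - e); first by rewrite /e; lra.
exists (maxn N1 N2); rewrite (total_overlap_halves _ HQ).
have := total_overlap_mono (lower_half Q j) (leq_maxl N1 N2).
have := total_overlap_mono (upper_half Q j) (leq_maxr N1 N2).
by rewrite /e in H1 H2; lra.
Qed.

Definition halved Q Q' : Prop := forall i,
  [/\ fst Q i <= fst Q' i, snd Q' i <= snd Q i & snd Q' i - fst Q' i = (snd Q i - fst Q i) / 2].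

(** Volume and overlap are additive under bisection of one coordinate, so one of the two halves must
    fail as well. The auxiliary claim bisects the first [m] coordinates in turn. *)
Lemma not_full_halved Q : (forall i, fst Q i <= snd Q i) -> ~ full Q ->
  exists Q', ~ full Q' /\ halved Q Q'.
Proof.
move=> HQ nF.
suff H m : (m <= n)%N -> exists Q', ~ full Q' /\ forall i : 'I_n,
    [/\ fst Q i <= fst Q' i, snd Q' i <= snd Q i &
      snd Q' i - fst Q' i = (snd Q i - fst Q i) / (if (i < m)%N then 2 else 1)].
  have [Q' [H1 H2]] := H n (leqnn n).
  by exists Q'; split => // i; have := H2 i; rewrite ltn_ord.
elim: m => [_|m IH mn].
  by exists Q; split => // i; split; try lra; rewrite ltn0; field.
have [Q' [H1 H2]] := IH (ltnW mn); set j := Ordinal mn.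
have Hj : fst Q' j <= snd Q' j.
  by have [_ _] := H2 j; rewrite ltnn; have := HQ j; lra.
have E (i : 'I_n) : (i < m.+1)%N = (i == j) || (i < m)%N by rewrite ltnS leq_eqVlt.
have [H|H] : ~ full (lower_half Q' j) \/ ~ full (upper_half Q' j).
- by apply: NNPP => H; apply: H1; apply: (full_halves Hj); apply: NNPP; tauto.
- exists (lower_half Q' j); split => // i; have [A B C] := H2 i; have Hi := HQ i.
  rewrite /= E; case: (i =P j) => [Ei|_] /=; last by split.
  by move: C; rewrite Ei ltnn in A B Hi * => C; split; lra.
- exists (upper_half Q' j); split => // i; have [A B C] := H2 i; have Hi := HQ i.
  rewrite /= E; case: (i =P j) => [Ei|_] /=; last by split.
  by move: C; rewrite Ei ltnn in A B Hi * => C; split; lra.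
Qed.

(* Otherwise successive halving leads to nested boxes that are not filled; they shrink to a
   point, and the member of the family containing that point fills them eventually. *)
Lemma interior_cover_full Q : (forall i, fst Q i <= snd Q i) ->
  (forall x, in_box Q x -> exists k (f : T k), forall i, fst (F f) i < x i < snd (F f) i) ->
  full Q.
Proof.
move=> HQ Hcov; apply: NNPP => nF.
pose bad Q := (forall i, fst Q i <= snd Q i) /\ ~ full Q.
have step (q : {Q | bad Q}) : exists q' : {Q | bad Q}, halved (sval q) (sval q').
  case: q => q [q1 q2]; have [q' [H1 H2]] := not_full_halved q1 q2.
  have H3 : bad q' by split => // i; have [_ _] := H2 i; have := q1 i; lra.
  by exists (exist _ q' H3).
have [nx Hnx] := choice_fun step.
pose q m := iter m nx (exist bad Q (conj HQ nF)).
pose lo m i := fst (sval (q m)) i; pose hi m i := snd (sval (q m)) i.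
have Hle m i : lo m i <= hi m i by case: (svalP (q m)) => H _; apply: H.
have Hside m i : hi m i - lo m i = (snd Q i - fst Q i) / 2 ^ m.
  elim: m => [|m IH]; first by rewrite /hi /lo /=; field.
  have [_ _] := Hnx (q m) i; rewrite -/(hi m i) -/(lo m i) IH /hi /lo /= => ->.
  by field; apply: pow_nonzero; lra.
have Hlo m m' i : (m <= m')%N -> lo m i <= lo m' i.
  move=> /subnK <-; elim: (m' - m)%N => [|k IH]; first by rewrite add0n; lra.
  by have [A _ _] := Hnx (q (k + m)%N) i; rewrite addSn /lo /= -/(lo _ _); apply: Rle_trans IH A.
have Hhi m m' i : (m <= m')%N -> hi m' i <= hi m i.
  move=> /subnK <-; elim: (m' - m)%N => [|k IH]; first by rewrite add0n; lra.
  by have [_ A _] := Hnx (q (k + m)%N) i; rewrite addSn /hi /= -/(hi _ _); apply: Rle_trans A IH.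
have Hx (i : 'I_n) : exists x, forall m, lo m i <= x <= hi m i.
  have [||x [ub lub]] := completeness (fun y => exists m, y = lo m i).
  - exists (hi 0%N i) => _ [m ->]; apply: Rle_trans (Hle m i) _; exact: Hhi.
  - by exists (lo 0%N i), 0%N.
  exists x => m; split; first by apply: ub; exists m.
  apply: lub => _ [m' ->]; have [mm|/ltnW mm] := leqP m m'.
    by apply: Rle_trans (Hle m' i) _; apply: Hhi.
  by apply: Rle_trans (Hlo _ _ i mm) _; apply: Hle.
have [x {}Hx] := choice_fun Hx.
have [k [f Hf]] : exists k (f : T k), forall i, fst (F f) i < x i < snd (F f) i.
  by apply: Hcov => i; apply: (Hx i 0%N).
(* The strict inequalities at [x] leave room: once the sides are shorter than the distance from [x]
   to the faces of [F f], the whole nested box lies in [F f]. *)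
have [m Hm] : exists m, forall (i : 'I_n) k, (m <= k)%N -> fst (F f) i <= lo k i /\ hi k i <= snd (F f) i.
  apply: eventually_ord => i; have := Hf i => Hfi.
  have [m Hm] := @pow_half_lt (snd Q i - fst Q i)
    (Rmin (x i - fst (F f) i) (snd (F f) i - x i)) ltac:(apply: Rmin_glb_lt; lra).
  exists m => k' mk; have := Hm k' mk; rewrite -Hside; have := Hx i k'.
  by have := Rmin_l (x i - fst (F f) i) (snd (F f) i - x i);
     have := Rmin_r (x i - fst (F f) i) (snd (F f) i - x i); lra.
have [_ []] := svalP (q m).
move=> s Hs; exists k.+1; apply: Rlt_le_trans Hs _.
rewrite /total_overlap (rsum_recr _ (fun k => \big[Rplus/R0]_(f : T k) overlap (F f) _)).
rewrite -(@overlap_sub (F f)); try by move=> i; have := Hm i m (leqnn m); rewrite /lo /hi; lra.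
  have H1 : 0 <= \rsum_(i < k) \big[Rplus/R0]_(f : T i) overlap (F f) (sval (q m)).
    by apply: rsum_ge0 => i _; apply: rsum_ge0 => g _; apply: overlap_ge0.
  suff : overlap (F f) (sval (q m)) <= \big[Rplus/R0]_(f : T k) overlap (F f) (sval (q m)) by lra.
  rewrite (bigD1 f) //=; rewrite -[X in X <= _]Rplus_0_r; apply: Rplus_le_compat_l.
  by apply: rsum_ge0 => g _; apply: overlap_ge0.
by move=> i; apply: (Hle m i).
Qed.

Lemma interior_cover_volume Q S : (forall i, fst Q i <= snd Q i) ->
  (forall k (f : T k) i, fst (F f) i <= snd (F f) i) ->
  (forall x, in_box Q x -> exists k (f : T k), forall i, fst (F f) i < x i < snd (F f) i) ->
  (forall N, \rsum_(k < N) \big[Rplus/R0]_(f : T k) box_vol (F f) <= S) ->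
  box_vol Q <= S.
Proof.
move=> HQ HF Hcov HS; apply: Rnot_lt_le => Hlt.
have [N HN] := interior_cover_full HQ Hcov Hlt.
have := HS N; apply: Rlt_not_le; apply: Rlt_le_trans HN _.
by apply: rsum_le => k _; apply: rsum_le => f _; apply: overlap_le.
Qed.

End BoxCovers.

(** Lets all sides of a box grow at arbitrarily small cost in volume. Sides may have length 0, hence
    the additive error. *)
Lemma rprod_perturb I (r : seq I) (len : I -> R) eps : (forall i, 0 <= len i) -> 0 < eps ->
  exists s, 0 < s /\ forall s', 0 <= s' <= s ->
    \big[Rmult/R1]_(i <- r) (len i + s') <= \big[Rmult/R1]_(i <- r) len i + eps.
Proof.
move=> H; elim: r eps => [|i r IH] eps e0.
  by exists 1; split => [|s' _]; [lra|rewrite !big_nil; lra].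
set P := \big[Rmult/R1]_(i <- r) len i.
have P0 : 0 <= P by apply: rprod_ge0.
have l0 := H i.
pose e' := Rmin 1 (eps / (2 * (len i + 1))).
have e'0 : 0 < e' by apply: Rmin_glb_lt; [lra|apply: Rdiv_lt_0_compat; lra].
have [s [s0 Hs]] := IH e' e'0.
pose t := Rmin s (eps / (2 * (P + 1))).
have t0 : 0 < t by apply: Rmin_glb_lt; [lra|apply: Rdiv_lt_0_compat; lra].
exists t; split => // s' [s'0 s't].
have [ts tP] : t <= s /\ t <= eps / (2 * (P + 1)) by split; [apply: Rmin_l|apply: Rmin_r].
have [e1 e2] : e' <= 1 /\ e' <= eps / (2 * (len i + 1)) by split; [apply: Rmin_l|apply: Rmin_r].
have := Hs s' ltac:(lra); rewrite !big_cons -/P.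
set Q := \big[_/_]_(_ <- r) _ => HQ.
have Q0 : 0 <= Q by apply: rprod_ge0 => j _; have := H j; lra.
have E1 : s' * (P + 1) <= eps / 2.
  apply: Rle_trans (_ : eps / (2 * (P + 1)) * (P + 1) <= _); first by apply: Rmult_le_compat_r; lra.
  by apply: Req_le; field; lra.
have E2 : e' * (len i + 1) <= eps / 2.
  apply: Rle_trans (_ : eps / (2 * (len i + 1)) * (len i + 1) <= _); first by apply: Rmult_le_compat_r; lra.
  by apply: Req_le; field; lra.
have : (len i + s') * Q <= (len i + s') * (P + e') by apply: Rmult_le_compat_l; lra.
by nra.
Qed.

Lemma nat_floor x : 0 <= x -> exists m : nat, INR m <= x < INR m + 1.
Proof.
move=> x0; have [H1 H2] := archimed x.
have z0 : (0 < up x)%Z by apply: lt_IZR; lra.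
exists (Z.to_nat (up x - 1)); rewrite INR_IZR_INZ Znat.Z2Nat.id ?minus_IZR; last lia.
by lra.
Qed.

Lemma rsum_prefix N m c : (m <= N)%N ->
  \rsum_(j < N) (if (j < m)%N then c else 0) = INR m * c.
Proof.
move=> mN; rewrite -rsum_const (big_ord_widen _ (fun=> c) mN) [RHS]big_mkcond.
by apply: eq_bigr.
Qed.

Lemma rprod_rsum_distr n N (G : 'I_n -> 'I_N -> R) :
  \rprod_(i < n) (\rsum_(j < N) G i j) =
  \big[Rplus/R0]_(f : {ffun 'I_n -> 'I_N}) \rprod_(i < n) G i (f i).
Proof. exact: bigA_distr_bigA. Qed.

(** * Box covers under Lipschitz correspondences *)

Section Lipschitz.
Variable n : nat.
Hypothesis n1 : (1 <= n)%N.

Let n0R : 0 < INR n. Proof. by apply: lt_0_INR; apply/ltP. Qed.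

(* Lipschitz correspondence from the Euclidean distance to the sup distance; relations are
   used instead of functions because the maps below are only partially defined. *)
Definition lipschitz_rel (Rel : Rn n -> Rn n -> Prop) (L : R) : Prop :=
  forall q x q' x', Rel q x -> Rel q' x' -> forall i, Rabs (x i - x' i) <= L * dist q q'.

Variables (Rel : Rn n -> Rn n -> Prop) (L : R).
Hypotheses (L0 : 0 < L) (HL : lipschitz_rel Rel L).

(** The box is cut into cells of side [s]. The image of a cell has oscillation at most
    [L * INR n * s]; a box of four times this side catches it in its interior. *)
Lemma lipschitz_image_box (b : Rn n * Rn n) s : (forall i, fst b i <= snd b i) -> 0 < s ->
  exists N (F : {ffun 'I_n -> 'I_N} -> Rn n * Rn n),
  [/\ forall f i, fst (F f) i <= snd (F f) i,
      forall q x, in_box b q -> Rel q x -> exists f, forall i, fst (F f) i < x i < snd (F f) i &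
      \big[Rplus/R0]_f box_vol (F f) <= (4 * L * INR n) ^ n * \rprod_(i < n) (snd b i - fst b i + s)].
Proof.
move=> Hb s0.
(* Side [i] is covered by [k i + 1] cells, of total length at most the side plus [s]: the origin of
   [+ s] in the bound. *)
have /choice_fun[k Hk] : forall i, exists k : nat,
    INR k <= (snd b i - fst b i) / s < INR k + 1.
  move=> i; apply: nat_floor; apply: Rmult_le_pos; first by have := Hb i; lra.
  by left; apply: Rinv_0_lt_compat.
(* A common range [N] makes the cells functions, so that the sum over cells factors into a product.
   Cells with an index beyond [k i] are given width 0 in that direction. *)
pose N := \max_(i < n) (k i).+1.
have kN i : ((k i).+1 <= N)%N by apply: leq_bigmax.
pose cell (f : {ffun 'I_n -> 'I_N}) (q : Rn n) := forall i, (f i < (k i).+1)%N /\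
  fst b i + INR (f i) * s <= q i <= fst b i + (INR (f i) + 1) * s.
(* The centre is any image point of the cell, or [vzero] if the cell has no image. *)
have /choice_fun[z Hz] : forall f, exists z : Rn n, forall q x,
    cell f q -> Rel q x -> forall i, Rabs (x i - z i) <= L * INR n * s.
  move=> f.
  have [[q [x [Hq Hx]]]|H] := classic (exists q x, cell f q /\ Rel q x); last first.
    by exists vzero => q x Hq Hx; case: H; exists q, x.
  exists x => q' x' Hq' Hx' i; apply: Rle_trans (HL Hx' Hx i) _.
  rewrite Rmult_assoc; apply: Rmult_le_compat_l; first lra.
  rewrite distE; apply: norm_le_coord; first lra.
  move=> j; rewrite /vsub; have [_ A] := Hq j; have [_ B] := Hq' j.
  by apply: Rabs_le; lra.
pose h (f : {ffun 'I_n -> 'I_N}) i := if (f i < (k i).+1)%N then 2 * L * INR n * s else 0.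
have h0 f i : 0 <= h f i by rewrite /h; case: ifP => _; [have := Rmult_lt_0_compat _ _ L0 n0R; nra|lra].
exists N, (fun f => ((fun i => z f i - h f i), (fun i => z f i + h f i))).
split => /=.
- by move=> f i; have := h0 f i; lra.
- move=> q x Hq Hx.
  have /choice_fun[f Hf] : forall i, exists j : 'I_N, (j < (k i).+1)%N /\
      fst b i + INR j * s <= q i <= fst b i + (INR j + 1) * s.
    move=> i; have Hqi := Hq i.
    have [|m Hm] := @nat_floor ((q i - fst b i) / s).
      by apply: Rmult_le_pos; [lra|left; apply: Rinv_0_lt_compat].
    have E : (q i - fst b i) / s * s = q i - fst b i by field; lra.
    have E' : (snd b i - fst b i) / s * s = snd b i - fst b i by field; lra.
    have mk : (m < (k i).+1)%N.
      apply/ltP/INR_lt; rewrite S_INR; apply: Rle_lt_trans (_ : (q i - fst b i) / s < _); first lra.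
      apply: Rle_lt_trans (proj2 (Hk i)).
      by apply: Rmult_le_compat_r; [left; apply: Rinv_0_lt_compat|lra].
    exists (Ordinal (leq_trans mk (kN i))); split => //=.
    by move: Hm E; set y := _ / s; move=> Hm E; nra.
  exists (finfun f) => i; have [Hi _] := Hf i.
  have := Hz (finfun f) q x _ Hx i; rewrite /h ffunE Hi => H.
  have {H} := H ltac:(by move=> j; rewrite ffunE).
  have : 0 < L * INR n * s by apply: Rmult_lt_0_compat => //; apply: Rmult_lt_0_compat.
  set W := L * INR n * s => W0; have -> : 2 * L * INR n * s = 2 * W by rewrite /W; ring.
  by rewrite /Rabs; case: Rcase_abs => *; lra.
- have -> : \big[Rplus/R0]_(f : {ffun 'I_n -> 'I_N})
      box_vol ((fun i => z f i - h f i), (fun i => z f i + h f i))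
      = \rprod_(i < n) (INR (k i).+1 * (4 * L * INR n * s)).
    pose G (i : 'I_n) (j : 'I_N) := if (j < (k i).+1)%N then 4 * L * INR n * s else 0.
    transitivity (\big[Rplus/R0]_(f : {ffun 'I_n -> 'I_N}) \rprod_(i < n) G i (f i)).
      by apply: eq_bigr => f _; apply: eq_bigr => i _; rewrite /= /h /G; case: ifP => _; ring.
    by rewrite -rprod_rsum_distr; apply: eq_bigr => i _; rewrite rsum_prefix.
  rewrite -rprod_const -rprod_mul; apply: rprod_le => i _.
  have W0 : 0 < 4 * L * INR n by have := Rmult_lt_0_compat _ _ L0 n0R; lra.
  split; first by apply: Rmult_le_pos; [apply: pos_INR|nra].
  have [A _] := Hk i.
  have E' : (snd b i - fst b i) / s * s = snd b i - fst b i by field; lra.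
  have : INR (k i) * s <= snd b i - fst b i by rewrite -E'; apply: Rmult_le_compat_r; lra.
  by rewrite S_INR; nra.
Qed.

Lemma infinite_sum_partial (f : nat -> R) S N : (forall k, 0 <= f k) -> infinite_sum f S ->
  \rsum_(k < N) f k <= S.
Proof.
move=> f0 HS.
have E m : sum_f_R0 f m = \rsum_(k < m.+1) f k.
  by elim: m => [|m IH]; [rewrite big_ord1|rewrite /= IH [RHS]rsum_recr].
apply: Rle_trans (_ : sum_f_R0 f N <= _); last exact: sum_incr.
by rewrite E rsum_recr; have := f0 N; lra.
Qed.

Lemma rsum_geom_half N : \rsum_(k < N) (/ 2 ^ k.+1) <= 1.
Proof.
suff -> : \rsum_(k < N) (/ 2 ^ k.+1) = 1 - / 2 ^ N.
  by have := Rinv_0_lt_compat _ (pow_lt 2 N ltac:(lra)); lra.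
elim: N => [|N IH]; first by rewrite big_ord0 /=; lra.
rewrite (rsum_recr _ (fun k => / 2 ^ k.+1)) IH /=.
by field; apply: pow_nonzero; lra.
Qed.

Lemma box_vol_ge0 (b : Rn n * Rn n) : (forall i, fst b i <= snd b i) -> 0 <= box_vol b.
Proof. by move=> H; apply: rprod_ge0 => i _; have := H i; lra. Qed.

(** The source of lower bounds on the volume of covers: each box of the cover is replaced by
    finitely many image boxes with error [e1 / 2 ^ (k + 1)], and these contain [Q] in their
    interiors. *)
Lemma lipschitz_image_volume X B S (Q : Rn n * Rn n) :
  box_cover B X -> infinite_sum (fun k => box_vol (B k)) S ->
  (forall i, fst Q i <= snd Q i) ->
  (forall x, in_box Q x -> exists q, X q /\ Rel q x) ->
  box_vol Q <= (4 * L * INR n) ^ n * S.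
Proof.
move=> [HB1 HB2] HS HQ Himg.
have W0 : 0 < (4 * L * INR n) ^ n.
  by apply: pow_lt; have := Rmult_lt_0_compat _ _ L0 n0R; lra.
set W := (4 * L * INR n) ^ n in W0 *.
apply: le_epsilon => e e0; pose e1 := e / W.
have e10 : 0 < e1 by apply: Rdiv_lt_0_compat.
have Hfam k : exists c : {N : nat & {ffun 'I_n -> 'I_N} -> Rn n * Rn n},
  [/\ forall f i, fst (projT2 c f) i <= snd (projT2 c f) i,
      forall q x, in_box (B k) q -> Rel q x ->
        exists f, forall i, fst (projT2 c f) i < x i < snd (projT2 c f) i &
      \big[Rplus/R0]_f box_vol (projT2 c f) <= W * (box_vol (B k) + e1 * / 2 ^ k.+1)].
  have ek : 0 < e1 * / 2 ^ k.+1.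
    by apply: Rmult_lt_0_compat => //; apply: Rinv_0_lt_compat; apply: pow_lt; lra.
  have [|s [s0 Hs]] := @rprod_perturb _ (index_enum 'I_n)
    (fun i => snd (B k) i - fst (B k) i) _ _ ek; first by move=> i; have := HB1 k i; lra.
  have [N [F [F1 F2 F3]]] := lipschitz_image_box (HB1 k) s0.
  exists (existT _ N F); split => //; apply: Rle_trans F3 _.
  by apply: Rmult_le_compat_l; [by left|apply: Hs; lra].
have [c Hc] := choice_fun Hfam.
apply: (@interior_cover_volume n (fun k => {ffun 'I_n -> 'I_(projT1 (c k))}) (fun k => projT2 (c k))) => //.
- by move=> k f i; case: (Hc k) => H _ _.
- move=> x /Himg[q [/HB2[k qk] qx]]; exists k; case: (Hc k) => _ H _; exact: H qk qx.
- move=> N; apply: Rle_trans (_ : \rsum_(k < N) (W * (box_vol (B k) + e1 * / 2 ^ k.+1)) <= _).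
    by apply: rsum_le => k _; case: (Hc k).
  rewrite -rsum_mulr rsum_add -rsum_mulr.
  have A := @infinite_sum_partial (fun k => box_vol (B k)) S N (fun k => box_vol_ge0 (HB1 k)) HS.
  have B' := rsum_geom_half N.
  apply: Rle_trans (_ : W * (S + e1 * 1) <= _).
    by apply: Rmult_le_compat_l; [lra|]; apply: Rplus_le_compat; [|apply: Rmult_le_compat_l; [lra|]].
  by apply: Req_le; rewrite /e1; field; lra.
Qed.

(** The finite list is continued by a one-point box, whose volume is 0 because [n] is positive; an
    empty product would be 1. *)
Lemma finite_cover_sequence (T : finType) (F : T -> Rn n * Rn n) (X : Rn n -> Prop) :
  (forall f i, fst (F f) i <= snd (F f) i) ->
  (forall x, X x -> exists f, in_box (F f) x) ->
  exists B, box_cover B X /\ infinite_sum (fun k => box_vol (B k)) (\big[Rplus/R0]_f box_vol (F f)).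
Proof.
move=> F1 F2; pose d : Rn n * Rn n := (vzero, vzero).
have d0 : box_vol d = 0.
  rewrite /box_vol (rprod_D1 _ (Ordinal n1)) /= /vzero; ring.
pose s := [seq F f | f <- enum T].
have sumE (r : seq (Rn n * Rn n)) N : (size r <= N)%N ->
    \rsum_(k < N) box_vol (nth d r k) = \big[Rplus/R0]_(b <- r) box_vol b.
  elim: r N => [|b r IH] [|N] //= H.
  - by rewrite big_nil big_ord0.
  - by rewrite big_nil big1 // => i _; rewrite nth_nil.
  - by rewrite big_ord_recl /= big_cons IH.
exists (nth d s); split; first split.
- move=> k i; have [ks|ks] := ltnP k (size s); last by rewrite nth_default //; rewrite /d /=; lra.
  move: ks; rewrite size_map => ks.
  have [f _] : exists f : T, True by move: ks; rewrite -cardE => /(leq_ltn_trans (leq0n k))/card_gt0P[f _]; exists f.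
  by rewrite (nth_map f).
- move=> x /F2[f Hf]; exists (index f (enum T)).
  by rewrite /s (nth_map f) ?index_mem ?mem_enum // nth_index ?mem_enum.
- move=> e e0; exists (size s) => N HN.
  have -> : sum_f_R0 (fun k => box_vol (nth d s k)) N = \rsum_(k < N.+1) box_vol (nth d s k).
    elim: N {HN} => [|m IH]; first by rewrite big_ord1.
    by rewrite /= IH [RHS](rsum_recr _ (fun k => box_vol (nth d s k))).
  rewrite sumE; last by apply: ltnW; rewrite ltnS; apply/leP.
  by rewrite big_map big_enum /= /Rdist Rminus_diag Rabs_R0.
Qed.

Lemma lipschitz_image_cover (b : Rn n * Rn n) (Y : Rn n -> Prop) eps :
  (forall i, fst b i <= snd b i) -> 0 < eps ->
  (forall x, Y x -> exists q, in_box b q /\ Rel q x) ->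
  exists B S, [/\ box_cover B Y, infinite_sum (fun k => box_vol (B k)) S &
    S <= (4 * L * INR n) ^ n * (box_vol b + eps)].
Proof.
move=> Hb e0 HY.
have [|s [s0 Hs]] := @rprod_perturb _ (index_enum 'I_n) (fun i => snd b i - fst b i) _ _ e0.
  by move=> i; have := Hb i; lra.
have [N [F [F1 F2 F3]]] := lipschitz_image_box Hb s0.
have [B [B1 B2]] := @finite_cover_sequence _ F Y F1 ltac:(
  by move=> x /HY[q [bq qx]]; have [f Hf] := F2 q x bq qx; exists f => i; have := Hf i; lra).
exists B, (\big[Rplus/R0]_f box_vol (F f)); split => //; apply: Rle_trans F3 _.
apply: Rmult_le_compat_l; last by apply: Hs; lra.
by apply: pow_le; have := Rmult_lt_0_compat _ _ L0 n0R; lra.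
Qed.

End Lipschitz.

(** * Packing separated sets *)

(** A lower bound [m] for the Lebesgue outer measure of [X]. *)
Definition mass_ge {n} (X : Rn n -> Prop) (m : R) : Prop :=
  forall B S, box_cover B X -> infinite_sum (fun k => box_vol (B k)) S -> m <= S.

Definition indic (P : Prop) : R := if excluded_middle_informative P then 1 else 0.

(** Outer measure is superadditive on sets at positive mutual distance: in a grid of cubes of
    diameter less than [eta] each cube meets at most one [X i], so covering every [X i] by the cubes
    it meets uses no cube twice. *)
Lemma packing n N (X : 'I_N -> Rn n -> Prop) (m : 'I_N -> R) D eta :
  (1 <= n)%N -> 0 < D -> 0 < eta ->
  (forall i q, X i q -> forall l, Rabs (q l) <= D) ->
  (forall i j q q', X i q -> X j q' -> dist q q' < eta -> i = j) ->
  (forall i, mass_ge (X i) (m i)) ->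
  \rsum_(i < N) m i <= (2 * D) ^ n.
Proof.
move=> n1 D0 e0 HD Hsep Hm.
have n0R : 0 < INR n by apply: lt_0_INR; apply/ltP.
have [K0 [_ HK]] : exists K0 : nat, True /\ 2 * D * INR n / eta < INR K0 + 1.
  have [|K [_ H]] := @nat_floor (2 * D * INR n / eta); last by exists K.
  by apply: Rmult_le_pos; [nra|left; apply: Rinv_0_lt_compat].
pose K := K0.+1; pose s := 2 * D / INR K.
have KR : 0 < INR K by apply: lt_0_INR; apply/ltP.
have s0 : 0 < s by apply: Rdiv_lt_0_compat; lra.
have Ks : INR K * s = 2 * D by rewrite /s; field; lra.
have ns : INR n * s < eta.
  have : 2 * D * INR n < eta * INR K.
    have -> : 2 * D * INR n = 2 * D * INR n / eta * eta by field; lra.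
    by rewrite /K S_INR; nra.
  by rewrite -Ks => H; apply: (Rmult_lt_reg_l (INR K)) => //; lra.
pose lo (f : {ffun 'I_n -> 'I_K}) : Rn n := fun l => - D + INR (f l) * s.
pose hi (f : {ffun 'I_n -> 'I_K}) : Rn n := fun l => - D + (INR (f l) + 1) * s.
pose hit i f := exists q, X i q /\ in_box (lo f, hi f) q.
have mi i : m i <= \big[Rplus/R0]_(f : {ffun 'I_n -> 'I_K}) (indic (hit i f) * s ^ n).
  (* Cubes that miss [X i] are collapsed to a point, so they contribute volume 0. *)
  pose F f := if excluded_middle_informative (hit i f) then (lo f, hi f) else (lo f, lo f).
  have [||B [B1 B2]] := @finite_cover_sequence n n1 _ F (X i).
  - by move=> f l; rewrite /F; case: excluded_middle_informative => _ /=; rewrite /lo /hi; nra.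
  - move=> q Xq.
    have /choice_fun[f Hf] : forall l, exists j : 'I_K,
        - D + INR j * s <= q l <= - D + (INR j + 1) * s.
      move=> l; have := HD i q Xq l => /Rabs_bounds[q1 q2].
      have [|j Hj] := @nat_floor ((q l + D) / s).
        by apply: Rmult_le_pos; [lra|left; apply: Rinv_0_lt_compat].
      have E : (q l + D) / s * s = q l + D by field; lra.
      have [jK|Kj] := ltnP j K.
        exists (Ordinal jK) => /=; move: Hj E; set y := _ / s => Hj E; nra.
      (* Only the end point [q l = D] has index [K]; it belongs to the last closed cell. *)
      exists ord_max => /=.
      have /le_INR H : (K <= j)%coq_nat by apply/leP.
      have H2 : INR K * s <= (q l + D) / s * s by apply: Rmult_le_compat_r; lra.
      by move: Ks H2; rewrite /K S_INR; nra.
    exists (finfun f); have Hin : in_box (lo (finfun f), hi (finfun f)) q.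
      by move=> l /=; rewrite /lo /hi ffunE; apply: Hf.
    by rewrite /F; case: excluded_middle_informative => // -[]; exists q.
  apply: Rle_trans (Hm i _ _ B1 B2) _; apply: rsum_le => f _.
  rewrite /F /indic /box_vol; case: excluded_middle_informative => _ /=.
    by rewrite Rmult_1_l -rprod_const; apply: Req_le; apply: eq_bigr => l _; rewrite /hi /lo; ring.
  by rewrite (rprod_D1 _ (Ordinal n1)); lra.
apply: Rle_trans (_ : \rsum_(i < N)
  \big[Rplus/R0]_(f : {ffun 'I_n -> 'I_K}) (indic (hit i f) * s ^ n) <= _).
  by apply: rsum_le => i _; apply: mi.
rewrite rsum_exchange.
apply: Rle_trans (_ : \big[Rplus/R0]_(f : {ffun 'I_n -> 'I_K}) (\rprod_(l < n) s) <= _); last first.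
  rewrite -(rprod_rsum_distr (fun (_ : 'I_n) (_ : 'I_K) => s)).
  by apply: Req_le; rewrite -rprod_const; apply: eq_bigr => l _; rewrite rsum_const.
apply: rsum_le => f _; rewrite rprod_const.
have sn : 0 < s ^ n by apply: pow_lt.
have [[i0 Hi0]|H] := classic (exists i, hit i f); last first.
  rewrite big1; first lra.
  by move=> i _; rewrite /indic; case: excluded_middle_informative => [?|?] /=; [case: H; exists i|ring].
rewrite (rsum_D1 _ i0) big1.
  by rewrite /indic; case: excluded_middle_informative => ? /=; lra.
move=> i /eqP ii0; rewrite /indic; case: excluded_middle_informative => [[q [Xq Hq]]|?] /=; last by ring.
case: ii0; case: Hi0 => q' [Xq' Hq']; apply: Hsep Xq Xq' _.
apply: Rle_lt_trans ns; rewrite distE; apply: norm_le_coord; first lra.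
move=> l; rewrite /vsub; have := Hq l; have := Hq' l; rewrite /= /lo /hi => A B.
by apply: Rabs_le; lra.
Qed.

(** * Compactness *)

Definition near {n} (e : R) (x y : Rn n) : Prop := forall i, Rabs (x i - y i) <= e.

Lemma near_sym n e (x y : Rn n) : near e x y -> near e y x.
Proof. by move=> H i; rewrite Rabs_minus_sym. Qed.

Lemma near_dot n e (x y z : Rn n) : 0 <= e -> near e x y ->
  Rabs (dot x z - dot y z) <= INR n * e * norm z.
Proof.
move=> e0 H; rewrite -dotBl; apply: Rle_trans (cauchy_schwarz _ _) _.
apply: Rmult_le_compat_r; first exact: norm_ge0.
by apply: norm_le_coord.
Qed.

Lemma inv_succ_lt eps : 0 < eps -> exists N, forall k, (N <= k)%N -> / (INR k + 1) < eps.
Proof.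
move=> e0; have [|m [_ Hm]] := @nat_floor (/ eps); first by left; apply: Rinv_0_lt_compat.
exists m => k /leP/le_INR mk; rewrite -[eps]Rinv_inv.
apply: Rinv_lt_contravar; last lra.
by apply: Rmult_lt_0_compat; [apply: Rinv_0_lt_compat|have := pos_INR k; lra].
Qed.

Definition cluster {n} (x : nat -> Rn n) (y : Rn n) : Prop :=
  forall e, 0 < e -> forall N, exists k, (N <= k)%N /\ near e (x k) y.

(** Coordinates are treated one after another. The selection only satisfies [k <= phi k] and has the
    explicit rate [1 / (k + 1)]; both survive composition with the next selection. *)
Lemma bolzano_weierstrass n (x : nat -> Rn n) C : (forall k i, Rabs (x k i) <= C) ->
  exists y, cluster x y.
Proof.
move=> HC.
suff H m : (m <= n)%N -> exists (phi : nat -> nat) (y : Rn n), (forall k, (k <= phi k)%N) /\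
    forall i : 'I_n, (i < m)%N -> forall k, Rabs (x (phi k) i - y i) <= / (INR k + 1).
  have [phi [y [H1 H2]]] := H n (leqnn n); exists y => e e0 N.
  have [N' HN'] := inv_succ_lt e0.
  exists (phi (maxn N N')); split; first exact: leq_trans (leq_maxl N N') (H1 _).
  move=> i; apply: Rle_trans (H2 i (ltn_ord i) _) _; left; apply: HN'; exact: leq_maxr.
elim: m => [_|m IH mn].
  by exists id, vzero; split.
have [phi [y [H1 H2]]] := IH (ltnW mn); set j := Ordinal mn.
have [l Hl] := @Bolzano_Weierstrass (fun k => x (phi k) j) (fun c => - C <= c <= C)
  (compact_P3 _ _) (fun k => Rabs_bounds (HC (phi k) j)).
have /choice_fun[psi Hpsi] : forall k, exists p, (k <= p)%N /\ Rabs (x (phi p) j - l) <= / (INR k + 1).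
  move=> k; have k0 : 0 < / (INR k + 1) by apply: Rinv_0_lt_compat; have := pos_INR k; lra.
  have [p [kp Hp]] := Hl (disc l (mkposreal _ k0)) k (ex_intro _ (mkposreal _ k0) (fun _ H => H)).
  by exists p; split; [apply/leP|left].
exists (phi \o psi), (fun i => if i == j then l else y i); split.
  by move=> k; apply: leq_trans (H1 _); case: (Hpsi k).
move=> i im k /=; case: eqP => [->|ij]; first by case: (Hpsi k).
have {im} im : (i < m)%N.
  by move: im; rewrite ltnS leq_eqVlt => /orP[/eqP im|//]; case: ij; apply: val_inj.
apply: Rle_trans (H2 i im _) _; apply: Rinv_le_contravar; first by have := pos_INR k; lra.
by case: (Hpsi k) => /leP/le_INR; lra.
Qed.

Lemma minimum_attained n (D : Rn n -> Prop) (F : Rn n -> R) C :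
  (exists x, D x) -> (forall x, D x -> forall i, Rabs (x i) <= C) ->
  (forall y, (forall e, 0 < e -> exists x, D x /\ near e x y) -> D y) ->
  (forall y, D y -> forall e, 0 < e -> exists d, 0 < d /\
    forall x, D x -> near d x y -> F y <= F x + e) ->
  exists y, D y /\ forall x, D x -> F y <= F x.
Proof.
move=> [x0 Dx0] HC Hcl Hlsc.
have [m Hm] : exists m, forall x, D x -> m <= F x.
  apply: NNPP => H.
  have /choice_fun[x Hx] : forall k : nat, exists x, D x /\ F x < - INR k.
    move=> k; apply: NNPP => H'; apply: H; exists (- INR k) => x Dx.
    by apply: Rnot_lt_le => ?; apply: H'; exists x.
  have [|y Hy] := @bolzano_weierstrass n x C; first by move=> k; apply: HC; case: (Hx k).
  have Dy : D y.
    by apply: Hcl => e e0; have [k [_ Hk]] := Hy e e0 0%N; exists (x k); split => //; case: (Hx k).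
  have [d [d0 Hd]] := Hlsc y Dy 1 Rlt_0_1.
  have [N [_ HN]] := nat_floor (Rabs_pos (F y)).
  have [k [Nk Hk]] := Hy d d0 N.+2; have [Dk Fk] := Hx k.
  have := Hd _ Dk Hk; have /le_INR := elimT leP Nk; rewrite !S_INR.
  by have := Rle_abs (- F y); rewrite Rabs_Ropp; lra.
have [||v [ub lub]] := completeness (fun c => exists x, D x /\ c = - F x).
- by exists (- m) => _ [x [Dx ->]]; have := Hm x Dx; lra.
- by exists (- F x0), x0.
have Hv x : D x -> - v <= F x by move=> Dx; have := ub (- F x) ltac:(by exists x); lra.
have /choice_fun[x Hx] : forall k : nat, exists x, D x /\ F x <= - v + / (INR k + 1).
  move=> k; apply: NNPP => H.
  have k0 : 0 < / (INR k + 1) by apply: Rinv_0_lt_compat; have := pos_INR k; lra.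
  suff : v <= v - / (INR k + 1) by lra.
  apply: lub => _ [x [Dx ->]].
  by have : ~ F x <= - v + / (INR k + 1) by [move=> ?; apply: H; exists x]; lra.
have [|y Hy] := @bolzano_weierstrass n x C; first by move=> k; apply: HC; case: (Hx k).
have Dy : D y.
  by apply: Hcl => e e0; have [k [_ H]] := Hy e e0 0%N; exists (x k); split => //; case: (Hx k).
exists y; split => // z Dz; apply: le_epsilon => e e0.
have [d [d0 Hd]] := Hlsc y Dy (e / 2) ltac:(lra).
have [N HN] := @inv_succ_lt (e / 2) ltac:(lra).
have [k [Nk Hk]] := Hy d d0 N; have [Dk Fk] := Hx k.
by have := Hd _ Dk Hk; have := HN k Nk; have := Hv z Dz; lra.
Qed.

(** * Convex functions on the unit ball *)

(** The weights may add up to less than 1, the deficit being carried by [vzero]. Induction splits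
    off the first point and rescales the other weights by [1 / (1 - c i)]. *)
Lemma convex_pred_comb n (P : Rn n -> Prop) I (r : seq I) (c : I -> R) (y : I -> Rn n) :
  (forall x z t, P x -> P z -> 0 <= t <= 1 -> P (vadd (vscale t x) (vscale (1 - t) z))) ->
  P vzero -> (forall i, P (y i)) -> (forall i, 0 <= c i) ->
  \big[Rplus/R0]_(i <- r) c i <= 1 ->
  P (fun j => \big[Rplus/R0]_(i <- r) (c i * y i j)).
Proof.
move=> Hconv P0 Py; elim: r c => [|i r IH] c c0.
  by move=> _; rewrite (_ : (fun _ => _) = vzero) //; apply: vecP => j; rewrite big_nil.
rewrite big_cons; set T := \big[Rplus/R0]_(j <- r) c j => HT.
have T0 : 0 <= T by apply: rsum_ge0.
have ci := c0 i.
rewrite (_ : (fun j => _) = vadd (vscale (c i) (y i)) (fun j => \big[Rplus/R0]_(k <- r) (c k * y k j))); last first.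
  by apply: vecP => j; rewrite big_cons.
have [c1|c1] := Rle_lt_or_eq_dec (c i) 1 ltac:(lra).
  pose c' k := / (1 - c i) * c k.
  have mu : 0 < / (1 - c i) by apply: Rinv_0_lt_compat; lra.
  rewrite (_ : (fun j => _) = vscale (1 - c i) (fun j => \big[Rplus/R0]_(k <- r) (c' k * y k j))); last first.
    apply: vecP => j; rewrite /vscale rsum_mulr; apply: eq_bigr => k _; rewrite /c'; field; lra.
  apply: Hconv => //; last lra; apply: IH => [k|]; first by apply: Rmult_le_pos; [lra|].
  rewrite -rsum_mulr -/T; apply: (Rmult_le_reg_l (1 - c i)); first lra.
  by rewrite -Rmult_assoc Rinv_r; lra.
(* When the first weight is 1 no rescaling is possible, but then all other weights vanish. *)
have TE : T = 0 by lra.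
rewrite (_ : (fun j => _) = vscale (1 - c i) vzero); first by apply: Hconv => //; lra.
apply: vecP => j; rewrite /vscale /vzero c1 Rmult_0_r.
have H : Rabs (\big[Rplus/R0]_(k <- r) (c k * y k j)) <= 0; last first.
  by have := Rabs_bounds H; lra.
have {T0 HT} := TE; rewrite /T {IH}; elim: r {T TE} => [|k r IH]; first by rewrite !big_nil Rabs_R0; lra.
rewrite !big_cons => E; have ck := c0 k; have S0 : 0 <= \big[Rplus/R0]_(j <- r) c j by apply: rsum_ge0.
have -> : c k = 0 by lra.
by rewrite Rmult_0_l Rplus_0_l; apply: IH; lra.
Qed.

Lemma unit_ball_convex n (x y : Rn n) t : unit_ball x -> unit_ball y -> 0 <= t <= 1 ->
  unit_ball (vadd (vscale t x) (vscale (1 - t) y)).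
Proof.
move=> /unit_ballE Hx /unit_ballE Hy Ht; apply/unit_ballE.
apply: Rle_lt_trans (norm_triang _ _) _; rewrite !normZ !Rabs_pos_eq; try lra.
by have [t0|t0] := Rle_lt_or_eq_dec 0 t ltac:(lra); [|rewrite -t0; lra]; nra.
Qed.

Lemma unit_ball_shift n (x y : Rn n) : norm y < 1 - norm x -> unit_ball (vadd x y).
Proof. by move=> H; apply/unit_ballE; have := norm_triang x y; lra. Qed.

Lemma vaddBK n (x y : Rn n) : vadd x (vsub y x) = y.
Proof. by apply: vecP => i; rewrite /vadd /vsub; ring. Qed.

Section Convex.
Variables (n : nat) (u : Rn n -> R).
Hypothesis Hu : convex_on unit_ball u.

Lemma convex_ub x y t : unit_ball x -> unit_ball y -> 0 <= t <= 1 ->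
  u (vadd (vscale t x) (vscale (1 - t) y)) <= t * u x + (1 - t) * u y.
Proof. by move=> Hx Hy Ht; apply: Hu. Qed.

(** Above, [u] is bounded on the cross-polytope with vertices [x0 + rho e_i] and [x0 - rho e_i] by
    its values there; below, by reflection in [x0] and convexity at the midpoint. *)
Lemma locally_bounded x0 : unit_ball x0 ->
  exists rho C, 0 < rho /\ forall y, near rho y x0 -> unit_ball y /\ Rabs (u y) <= C.
Proof.
move=> Hx0; have /unit_ballE nx0 := Hx0; pose rho := (1 - norm x0) / 2.
have rho0 : 0 < rho by rewrite /rho; lra.
pose C1 := Rabs (u x0) + \rsum_(i < n) (Rabs (u (vadd x0 (vscale rho (basis i)))) +
                                        Rabs (u (vadd x0 (vscale (- rho) (basis i))))).
have Hsum (i : 'I_n) : Rabs (u (vadd x0 (vscale rho (basis i)))) +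
    Rabs (u (vadd x0 (vscale (- rho) (basis i)))) <= C1.
  have := @rsum_ge_term n (fun i => Rabs (u (vadd x0 (vscale rho (basis i)))) +
    Rabs (u (vadd x0 (vscale (- rho) (basis i))))) i.
  move=> /(_ ltac:(by move=> j; have := Rabs_pos (u (vadd x0 (vscale rho (basis j))));
     have := Rabs_pos (u (vadd x0 (vscale (- rho) (basis j)))); lra)).
  by rewrite /C1; have := Rabs_pos (u x0); lra.
have Hx0C : u x0 <= C1.
  rewrite /C1; set S := \rsum_(_ < n) _.
  have : 0 <= S.
    by apply: rsum_ge0 => i _; have := Rabs_pos (u (vadd x0 (vscale rho (basis i))));
     have := Rabs_pos (u (vadd x0 (vscale (- rho) (basis i)))); lra.
  by have := Rle_abs (u x0); lra.
pose P (z : Rn n) := unit_ball (vadd x0 z) /\ u (vadd x0 z) <= C1.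
have Pconv x z t : P x -> P z -> 0 <= t <= 1 -> P (vadd (vscale t x) (vscale (1 - t) z)).
  move=> [x1 x2] [z1 z2] Ht.
  have E : vadd x0 (vadd (vscale t x) (vscale (1 - t) z)) =
    vadd (vscale t (vadd x0 x)) (vscale (1 - t) (vadd x0 z)).
    by apply: vecP => i; rewrite /vadd /vscale; ring.
  rewrite /P E; split; first exact: unit_ball_convex.
  by apply: Rle_trans (convex_ub x1 z1 Ht) _; nra.
have P0 : P vzero.
  by rewrite /P (_ : vadd x0 vzero = x0) //; apply: vecP => i; rewrite /vadd /vzero; ring.
have bnorm (i : 'I_n) : norm (basis i) = 1.
  by rewrite /norm dot_basis /basis eqxx sqrt_1.
have Pv s (i : 'I_n) : s = rho \/ s = - rho -> P (vscale s (basis i)).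
  move=> Hs; split.
    apply: unit_ball_shift; rewrite normZ bnorm.
    have -> : Rabs s = rho by case: Hs => ->; rewrite ?Rabs_Ropp Rabs_pos_eq; lra.
    by rewrite /rho; lra.
  have := Hsum i; have := Rle_abs (u (vadd x0 (vscale rho (basis i)))).
  have := Rle_abs (u (vadd x0 (vscale (- rho) (basis i)))).
  have := Rabs_pos (u (vadd x0 (vscale rho (basis i)))).
  have := Rabs_pos (u (vadd x0 (vscale (- rho) (basis i)))).
  by case: Hs => -> *; lra.
(* With this radius the weights [|z i| / rho] on the vertices add up to at most [n / (n + 1)]. *)
pose r1 := rho / (INR n + 1).
have nn := pos_INR n.
have r10 : 0 < r1 by apply: Rdiv_lt_0_compat; lra.
have ub y : near r1 y x0 -> P (vsub y x0).
  move=> Hy; pose z := vsub y x0; pose s (i : 'I_n) := if Rle_dec 0 (z i) then rho else - rho.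
  pose c (i : 'I_n) := Rabs (z i) / rho.
  have -> : vsub y x0 = (fun j => \rsum_(i < n) (c i * vscale (s i) (basis i) j)).
    apply: vecP => j; rewrite -/(z j) -[LHS](rsum_delta j z); apply: eq_bigr => i _.
    rewrite /vscale /basis /c /s eq_sym; case: eqP => _; last by ring.
    rewrite /Rabs; case: Rcase_abs => ?; case: Rle_dec => ?; try (exfalso; lra); rewrite /=; field; lra.
  apply: convex_pred_comb => //.
  - by move=> i; apply: Pv; rewrite /s; case: Rle_dec; [left|right].
  - by move=> i; apply: Rmult_le_pos; [apply: Rabs_pos|left; apply: Rinv_0_lt_compat].
  - apply: Rle_trans (_ : INR n * (r1 / rho) <= _).
      apply: rsum_ord_le => i; apply: Rmult_le_compat_r; last exact: Hy.
      by left; apply: Rinv_0_lt_compat.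
    rewrite /r1 (_ : INR n * _ = INR n / (INR n + 1)); last by field; lra.
    by apply: (Rmult_le_reg_r (INR n + 1)); [lra|rewrite /Rdiv Rmult_assoc Rinv_l; lra].
exists r1, (Rabs C1 + 2 * Rabs (u x0)); split => // y Hy.
have [B1 U1] := ub y Hy; rewrite vaddBK in B1 U1; split => //.
pose y' : Rn n := vsub (vscale 2 x0) y.
have [|B2 U2] := ub y'.
  by move=> i; have := Hy i; rewrite Rabs_minus_sym /y' /vsub /vscale (_ : _ - _ = 2 * x0 i - y i - x0 i) //; ring.
rewrite vaddBK in B2 U2.
have := @convex_ub y y' (1 / 2) B1 B2 ltac:(lra).
rewrite (_ : vadd _ _ = x0); last by apply: vecP => i; rewrite /vadd /vscale /y' /vsub /vscale; field.
have := Rle_abs C1; have := Rle_abs (- u x0); rewrite Rabs_Ropp; have := Rabs_pos (u x0) => *.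
by apply: Rabs_le; lra.
Qed.

(** The point [y] divides the segment from [x] to the distant point [w = y + N (y - x)], with weight
    only [1 / (N + 1)] at [w]; the local bound on [u w] makes its influence smaller than [eps]. *)
Lemma lower_semicontinuous y eps : unit_ball y -> 0 < eps ->
  exists d, 0 < d /\ forall x, near d x y -> unit_ball x /\ u y <= u x + eps.
Proof.
move=> By e0; have [rho [C [r0 HC]]] := locally_bounded By.
have C0 : 0 <= C.
  have [_ H] := HC y ltac:(by move=> i; rewrite Rminus_diag Rabs_R0; lra).
  by have := Rabs_pos (u y); lra.
have [|N [_ HN]] := @nat_floor (2 * C / eps).
  by apply: Rmult_le_pos; [lra|left; apply: Rinv_0_lt_compat].
have N0 := pos_INR N.
exists (rho / (INR N + 1)); split; first by apply: Rdiv_lt_0_compat; lra.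
have dE : (INR N + 1) * (rho / (INR N + 1)) = rho by field; lra.
move=> x; set d := rho / _ in dE *; move=> Hx.
have d0 : 0 < d by apply: Rdiv_lt_0_compat; lra.
have [Bx Ux] := HC x ltac:(by move=> i; apply: Rle_trans (Hx i) _; nra).
pose w : Rn n := fun i => y i + INR N * (y i - x i).
have [Bw Uw] : unit_ball w /\ Rabs (u w) <= C.
  apply: HC => i; rewrite /w (_ : _ - _ = INR N * (y i - x i)); last by ring.
  rewrite Rabs_mult (Rabs_pos_eq (INR N)) // Rabs_minus_sym.
  by have := Hx i; have := Rabs_pos (x i - y i); nra.
split => //.
have t1 : 0 <= INR N / (INR N + 1) <= 1.
  split; first by apply: Rmult_le_pos => //; left; apply: Rinv_0_lt_compat; lra.
  by apply: (Rmult_le_reg_r (INR N + 1)); [lra|rewrite /Rdiv Rmult_assoc Rinv_l; lra].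
have := @convex_ub x w (INR N / (INR N + 1)) Bx Bw t1.
rewrite (_ : vadd _ _ = y); last by apply: vecP => i; rewrite /vadd /vscale /w; field; lra.
have -> : INR N / (INR N + 1) * u x + (1 - INR N / (INR N + 1)) * u w =
  u x + (u w - u x) / (INR N + 1) by field; lra.
suff : (u w - u x) / (INR N + 1) <= eps by lra.
apply: (Rmult_le_reg_r (INR N + 1)); first lra.
rewrite /Rdiv Rmult_assoc Rinv_l; last lra.
have : 2 * C <= eps * (INR N + 1).
  by rewrite (_ : 2 * C = 2 * C / eps * eps); [nra|field; lra].
by have [? ?] := Rabs_bounds Uw; have [? ?] := Rabs_bounds Ux; lra.
Qed.

(* First-order condition: the quadratic error term disappears after dividing by the step. *)
Lemma subgrad_of_minimum x (d : Rn n) K eta : unit_ball x -> 0 < eta ->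
  (forall z, norm z <= eta -> unit_ball (vadd x z) -> u x <= u (vadd x z) + dot d z + K * dot z z) ->
  subgrad unit_ball u x (vscale (-1) d).
Proof.
move=> Bx e0 H y By; set w := vsub y x; rewrite dotZl; apply: Rle_ge.
apply: le_epsilon => e epos.
have K0 : 0 <= Rabs K * dot w w by apply: Rmult_le_pos; [apply: Rabs_pos|apply: dot_ge0].
have w0 := norm_ge0 w.
pose t := Rmin 1 (Rmin (eta / (norm w + 1)) (e / (Rabs K * dot w w + 1))).
have t0 : 0 < t by repeat apply: Rmin_glb_lt; try lra; apply: Rdiv_lt_0_compat; lra.
have [t1 [t2 t3]] : t <= 1 /\ t <= eta / (norm w + 1) /\ t <= e / (Rabs K * dot w w + 1).
  split; first exact: Rmin_l.
  split; (apply: Rle_trans; first exact: Rmin_r); [exact: Rmin_l|exact: Rmin_r].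
have E : vadd x (vscale t w) = vadd (vscale t y) (vscale (1 - t) x).
  by apply: vecP => i; rewrite /vadd /vscale /w /vsub; ring.
have t4 : t * (norm w + 1) <= eta.
  apply: Rle_trans (_ : eta / (norm w + 1) * (norm w + 1) <= _); first by apply: Rmult_le_compat_r; lra.
  by apply: Req_le; field; lra.
have t5 : t * (Rabs K * dot w w + 1) <= e.
  apply: Rle_trans (_ : e / (Rabs K * dot w w + 1) * (Rabs K * dot w w + 1) <= _); first by apply: Rmult_le_compat_r; lra.
  by apply: Req_le; field; lra.
have := H (vscale t w); rewrite normZ Rabs_pos_eq; last lra.
move=> /(_ ltac:(nra)); rewrite E => /(_ (@unit_ball_convex _ _ _ t By Bx ltac:(lra))).
have := @convex_ub y x t By Bx ltac:(lra); rewrite !dotZr dotZl => H1 H2.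
have : K * (t * (t * dot w w)) <= t * e.
  have : K * dot w w <= Rabs K * dot w w by apply: Rmult_le_compat_r; [apply: dot_ge0|apply: Rle_abs].
  move=> H3; have H4 : t * (K * dot w w) <= t * (Rabs K * dot w w) by apply: Rmult_le_compat_l; lra.
  have -> : K * (t * (t * dot w w)) = t * (t * (K * dot w w)) by ring.
  by apply: Rmult_le_compat_l; lra.
move=> H3; apply: (Rmult_le_reg_l t) => //; lra.
Qed.

(** Testing the subgradient inequality at distance [rho / 2] along each axis, where [u] oscillates
    by at most [2 * C]. *)
Lemma subgrad_locally_bounded x0 : unit_ball x0 ->
  exists rho C, 0 < rho /\ forall x p, near rho x x0 -> subgrad unit_ball u x p ->
    forall i, Rabs (p i) <= C.
Proof.
move=> Bx0; have [rho [C [r0 HC]]] := locally_bounded Bx0.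
exists (rho / 2), (4 * C / rho); split; first lra.
move=> x p Hx Hp i.
have key s : Rabs s = rho / 2 -> s * p i <= 2 * C.
  move=> Hs; have [By Uy] : unit_ball (vadd x (vscale s (basis i))) /\ Rabs (u (vadd x (vscale s (basis i)))) <= C.
    apply: HC => j; rewrite /vadd /vscale /basis.
    have := Hx j; case: eqP => _ H; last by rewrite Rmult_0_r Rplus_0_r; lra.
    by have := Rabs_triang (x j - x0 j) s; rewrite (_ : x j + s * 1 - x0 j = x j - x0 j + s); [lra|ring].
  have [_ Ux] := HC x ltac:(by move=> j; have := Hx j; lra).
  have := Hp _ By; rewrite (_ : vsub _ x = vscale s (basis i)); last first.
    by apply: vecP => j; rewrite /vsub /vadd; ring.
  rewrite dotZr dot_basis; have := Rabs_bounds Uy; have := Rabs_bounds Ux; lra.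
have H1 := key (rho / 2) ltac:(rewrite Rabs_pos_eq; lra).
have H2 := key (- (rho / 2)) ltac:(rewrite Rabs_Ropp Rabs_pos_eq; lra).
have E : rho / 2 * (4 * C / rho) = 2 * C by field; lra.
by apply: Rabs_le; split; apply: (Rmult_le_reg_l (rho / 2)); lra.
Qed.

Lemma subgrad_closed x0 p : unit_ball x0 ->
  (forall e, 0 < e -> exists x q, [/\ near e x x0, near e q p & subgrad unit_ball u x q]) ->
  subgrad unit_ball u x0 p.
Proof.
move=> Bx0 H y By; apply: Rle_ge; apply: le_epsilon => e e0.
have [d [d0 Hd]] := @lower_semicontinuous x0 (e / 3) Bx0 ltac:(lra).
have nn := pos_INR n.
set A := INR n * norm (vsub y x0) + INR n * (norm p + INR n).
have A0 : 0 <= A.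
  by have := norm_ge0 (vsub y x0); have := norm_ge0 p => *; rewrite /A; nra.
pose e' := Rmin 1 (Rmin d (e / (3 * (A + 1)))).
have e'0 : 0 < e' by repeat apply: Rmin_glb_lt; try lra; apply: Rdiv_lt_0_compat; lra.
have [x [q [Hx Hq Hs]]] := H e' e'0.
have [e1 [e2 e3]] : e' <= 1 /\ e' <= d /\ e' <= e / (3 * (A + 1)).
  split; first exact: Rmin_l.
  split; (apply: Rle_trans; first exact: Rmin_r); [exact: Rmin_l|exact: Rmin_r].
have [Bx Ux] := Hd x ltac:(by move=> i; apply: Rle_trans (Hx i) _).
have Hy := Rge_le _ _ (Hs y By).
have e4 : e' * A <= e / 3.
  have : e' * (A + 1) <= e / 3.
    apply: Rle_trans (_ : e / (3 * (A + 1)) * (A + 1) <= _); first by apply: Rmult_le_compat_r; lra.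
    by apply: Req_le; field; lra.
  by nra.
have D1 : Rabs (dot q (vsub y x0) - dot p (vsub y x0)) <= INR n * e' * norm (vsub y x0).
  by apply: near_dot => //; lra.
have D2 : Rabs (dot x q - dot x0 q) <= INR n * e' * norm q by apply: near_dot => //; lra.
have Nq : norm q <= norm p + INR n.
  rewrite -(vaddBK p q); apply: Rle_trans (norm_triang _ _) _.
  have : norm (vsub q p) <= INR n * 1 by apply: norm_le_coord => [|i]; [lra|have := Hq i; rewrite /vsub; lra].
  by lra.
have D3 : INR n * e' * norm q <= INR n * e' * (norm p + INR n).
  by apply: Rmult_le_compat_l => //; apply: Rmult_le_pos; lra.
have [? ?] := Rabs_bounds D1; have [? ?] := Rabs_bounds D2.
have E : dot q (vsub y x) = dot q (vsub y x0) - (dot x q - dot x0 q).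
  by rewrite !dotBr (dotC x q) (dotC x0 q); ring.
rewrite E in Hy; move: e4; rewrite /A; lra.
Qed.

Lemma subgrad_limit x0 (x p : nat -> Rn n) : unit_ball x0 ->
  (forall k, subgrad unit_ball u (x k) (p k)) ->
  (forall e, 0 < e -> exists M, forall k, (M <= k)%N -> near e (x k) x0) ->
  exists q, subgrad unit_ball u x0 q /\
    forall e, 0 < e -> forall N, exists k, (N <= k)%N /\ near e (p k) q.
Proof.
move=> Bx0 Hp Hx.
have [rho [C [r0 HC]]] := subgrad_locally_bounded Bx0.
have [M HM] := Hx rho r0.
have [|q Hq] := @bolzano_weierstrass n (fun k => p (M + k)%N) C.
  by move=> k; apply: HC (Hp _); apply: HM; apply: leq_addr.
exists q; split.
  apply: subgrad_closed => // e e0; have [M' HM'] := Hx e e0; have [k [Mk Hk]] := Hq e e0 M'.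
  exists (x (M + k)%N), (p (M + k)%N); split => //; apply: HM'.
  by apply: leq_trans Mk _; apply: leq_addl.
move=> e e0 N; have [k [Nk Hk]] := Hq e e0 N; exists (M + k)%N; split => //.
by apply: leq_trans Nk _; apply: leq_addl.
Qed.

(** Minimising [u(x0 + z) + K |z|^2] over a small cube touches [u] by a steep paraboloid at a point
    near [x0], where a subgradient can be read off. The cubes shrink to [x0], and the graph of the
    subdifferential is closed. *)
Lemma subgrad_exists x0 : unit_ball x0 -> exists p, subgrad unit_ball u x0 p.
Proof.
move=> Bx0; have [rho [C [r0 HC]]] := locally_bounded Bx0.
have [_ U0] := HC x0 ltac:(by move=> i; rewrite Rminus_diag Rabs_R0; lra).
have C0 : 0 <= C by have := Rabs_pos (u x0); lra.
(* As [c] exceeds the oscillation [2 * C] of [u] and [K * (s * s) = c], the minimiser lies in the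
   interior of the cube of half side [s]. *)
pose c := 2 * C + 1.
have step (k : nat) : exists xp : Rn n * Rn n, near (rho / (INR k + 1)) (fst xp) x0 /\
    subgrad unit_ball u (fst xp) (snd xp).
  have kk := pos_INR k.
  pose s := rho / (INR k + 1).
  have s0 : 0 < s by apply: Rdiv_lt_0_compat; lra.
  have srho : s <= rho.
    by apply: (Rmult_le_reg_r (INR k + 1)); [lra|rewrite /s /Rdiv Rmult_assoc Rinv_l; nra].
  pose K := c / (s * s).
  have K0 : 0 < K by apply: Rdiv_lt_0_compat; rewrite /c; nra.
  have Ks : K * (s * s) = c by rewrite /K; field; lra.
  pose D (z : Rn n) := forall i, Rabs (z i) <= s.
  have HD z : D z -> unit_ball (vadd x0 z) /\ Rabs (u (vadd x0 z)) <= C.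
    move=> Dz; apply: HC => i; rewrite /vadd (_ : _ - _ = z i); last by ring.
    by apply: Rle_trans (Dz i) _.
  pose F z := u (vadd x0 z) + K * dot z z.
  have D0 : D vzero by move=> i; rewrite /vzero Rabs_R0; lra.
  have x0E : vadd x0 vzero = x0 by apply: vecP => i; rewrite /vadd /vzero; ring.
  have [||||z [Dz Hz]] := @minimum_attained n D F s.
  - by exists vzero.
  - by [].
  - move=> y Hy i; apply: le_epsilon => e e0; have [z [Dz zy]] := Hy e e0.
    have := Dz i; have := zy i; rewrite Rabs_minus_sym => H1 H2.
    by have := Rabs_triang (y i - z i) (z i); rewrite (_ : y i - z i + z i = y i); [lra|ring].
  - move=> y Dy e e0; have [By _] := HD y Dy.
    have [d [d0 Hd]] := @lower_semicontinuous _ (e / 2) By ltac:(lra).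
    pose W := 2 * K * INR n * (INR n * s) + 1.
    have W1 : 1 <= W.
      suff : 0 <= 2 * K * INR n * (INR n * s) by rewrite /W; lra.
      by have := pos_INR n => ?; apply: Rmult_le_pos; apply: Rmult_le_pos; lra.
    pose d' := Rmin d (e / (2 * W)).
    have d'0 : 0 < d' by apply: Rmin_glb_lt => //; apply: Rdiv_lt_0_compat; lra.
    exists d'; split => // x Dx xy.
    have [_ H1] := Hd (vadd x0 x) ltac:(move=> i; rewrite /vadd (_ : _ - _ = x i - y i); [apply: Rle_trans (xy i) (Rmin_l _ _)|ring]).
    have H2 : dot y y - dot x x <= 2 * (INR n * d' * (INR n * s)).
      have -> : dot y y - dot x x = (dot y y - dot x y) + (dot y x - dot x x).
        by rewrite (dotC y x); ring.
      have A1 := @near_dot n d' y x y ltac:(lra) (near_sym xy).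
      have A2 := @near_dot n d' y x x ltac:(lra) (near_sym xy).
      have N1 : norm y <= INR n * s by apply: norm_le_coord => //; lra.
      have N2 : norm x <= INR n * s by apply: norm_le_coord => //; lra.
      have nd : 0 <= INR n * d' by apply: Rmult_le_pos; [apply: pos_INR|lra].
      have := Rmult_le_compat_l _ _ _ nd N1; have := Rmult_le_compat_l _ _ _ nd N2.
      by have := Rabs_bounds A1; have := Rabs_bounds A2; lra.
    have H3 : d' * W <= e / 2.
      apply: Rle_trans (_ : e / (2 * W) * W <= _); first by apply: Rmult_le_compat_r; [lra|apply: Rmin_r].
      by apply: Req_le; field; lra.
    have H4 : K * (dot y y - dot x x) <= d' * W.
      apply: Rle_trans (_ : K * (2 * (INR n * d' * (INR n * s))) <= _).
        by apply: Rmult_le_compat_l; lra.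
      by rewrite /W; lra.
    by rewrite /F; lra.
  have HzK : K * dot z z < c.
    have := Hz vzero D0; rewrite /F x0E dot0l; have [_ /Rabs_bounds] := HD z Dz.
    by have := Rabs_bounds U0; rewrite /c; lra.
  have zin i : Rabs (z i) < s.
    apply: Rsqr_incrst_0; [|exact: Rabs_pos|lra].
    rewrite -Rsqr_abs /Rsqr; apply: Rle_lt_trans (coord_sqr z i) _.
    by apply: (Rmult_lt_reg_l K) => //; lra.
  have [Bz _] := HD z Dz.
  have [eta [eta0 Heta]] : exists eta, 0 < eta /\ forall i, Rabs (z i) + eta <= s.
    have [|m Hm] := @eventually_ord n (fun i k => Rabs (z i) + / (INR k + 1) <= s).
      move=> i; have [N HN] := @inv_succ_lt (s - Rabs (z i)) ltac:(have := zin i; lra).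
      by exists N => j /HN; lra.
    exists (/ (INR m + 1)); split; first by apply: Rinv_0_lt_compat; have := pos_INR m; lra.
    by move=> i; apply: Hm.
  exists (vadd x0 z, vscale (-1) (vscale (2 * K) z)); split => /=.
    by move=> i; rewrite /vadd (_ : _ - _ = z i); [exact: Dz|ring].
  apply: (@subgrad_of_minimum _ _ K eta) => // w Hw _.
  have := Hz (vadd z w) ltac:(by move=> i; have := Rabs_triang (z i) (w i); have := Heta i;
    have := norm_coord w i; rewrite /vadd; lra).
  rewrite /F (_ : vadd x0 (vadd z w) = vadd (vadd x0 z) w); last first.
    by apply: vecP => i; rewrite /vadd; ring.
  by rewrite !(dotDl, dotDr, dotZl) (dotC w z); lra.
have [xp Hxp] := choice_fun step.
have [||q [Hq _]] := @subgrad_limit x0 (fun k => fst (xp k)) (fun k => snd (xp k)) Bx0.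
- by move=> k; case: (Hxp k).
- move=> e e0; have [M HM] := @inv_succ_lt (e / rho) ltac:(apply: Rdiv_lt_0_compat; lra).
  exists M => k /HM H i; apply: Rle_trans (proj1 (Hxp k) i) _.
  rewrite (_ : e = rho * (e / rho)); last by field; lra.
  by apply: Rmult_le_compat_l; lra.
by exists q.
Qed.

(** The slope [dot p w] equals the one-sided derivative of [u] along [w]. Such a [p] is a limit of
    subgradients at [x0 + s w] as [s] decreases to 0: testing those at [x0] bounds [u (x0 + s w)]
    from above, and convexity extends the bound to smaller steps. *)
Lemma subgrad_exposed x0 w : unit_ball x0 -> exists p, subgrad unit_ball u x0 p /\
  forall om, 0 < om -> exists s0, 0 < s0 /\ forall s, 0 <= s <= s0 ->
    unit_ball (vadd x0 (vscale s w)) /\ u (vadd x0 (vscale s w)) <= u x0 + s * (dot p w + om).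
Proof.
move=> Bx0; have /unit_ballE nx0 := Bx0.
have w0 := norm_ge0 w.
pose b := (1 - norm x0) / (norm w + 1).
have b0 : 0 < b by apply: Rdiv_lt_0_compat; lra.
have bw : b * (norm w + 1) = 1 - norm x0 by rewrite /b; field; lra.
pose s (k : nat) := b * / (INR k + 1).
have ik k : 0 < / (INR k + 1) <= 1.
  have := pos_INR k => k0; split; first by apply: Rinv_0_lt_compat; lra.
  by rewrite -[X in _ <= X]Rinv_1; apply: Rinv_le_contravar; lra.
have s0 k : 0 < s k <= b by rewrite /s; have := ik k; nra.
have Bs t : 0 <= t <= b -> unit_ball (vadd x0 (vscale t w)).
  by move=> Ht; apply: unit_ball_shift; rewrite normZ Rabs_pos_eq; nra.
have /choice_fun[p Hp] : forall k, exists p, subgrad unit_ball u (vadd x0 (vscale (s k) w)) p.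
  by move=> k; apply: subgrad_exists; apply: Bs; have := s0 k; lra.
have [|q [Hq Hcl]] := subgrad_limit Bx0 Hp.
  move=> e e0; have [M HM] := @inv_succ_lt (e / (b * (norm w + 1))) ltac:(apply: Rdiv_lt_0_compat; nra).
  exists M => k /HM H i; rewrite /vadd /vscale (_ : _ - _ = s k * w i); last by ring.
  rewrite Rabs_mult Rabs_pos_eq; last by have := s0 k; lra.
  apply: Rle_trans (_ : s k * (norm w + 1) <= _).
    by apply: Rmult_le_compat_l; [have := s0 k; lra|have := norm_coord w i; lra].
  rewrite /s (_ : e = b * (e / (b * (norm w + 1))) * (norm w + 1)); last by field; lra.
  by apply: Rmult_le_compat_r; [lra|apply: Rmult_le_compat_l; lra].
exists q; split => // om om0.
have nn := pos_INR n.
have [|k [_ Hk]] := Hcl (om / (INR n * norm w + 1)) _ 0%N.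
  by apply: Rdiv_lt_0_compat => //; nra.
have H1 : dot (p k) w <= dot q w + om.
  set e := om / _ in Hk.
  have e0 : 0 < e by apply: Rdiv_lt_0_compat => //; nra.
  have := @near_dot n e (p k) q w ltac:(lra) Hk => /Rabs_bounds[_ H].
  have : e * (INR n * norm w + 1) = om by rewrite /e; field; nra.
  by lra.
exists (s k); split; first by have := s0 k; lra.
move=> t Ht; have [sk1 sk2] := s0 k; split; first by apply: Bs; lra.
have H2 : u (vadd x0 (vscale (s k) w)) <= u x0 + s k * (dot q w + om).
  have := Rge_le _ _ (Hp k x0 Bx0); rewrite (_ : vsub x0 _ = vscale (- s k) w); last first.
    by apply: vecP => i; rewrite /vsub /vadd /vscale; ring.
  by rewrite dotZr; nra.
have tk : 0 <= t / s k <= 1.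
  split; first by apply: Rmult_le_pos; [lra|left; apply: Rinv_0_lt_compat].
  by apply: (Rmult_le_reg_r (s k)) => //; rewrite /Rdiv Rmult_assoc Rinv_l; lra.
have := @convex_ub _ x0 (t / s k) (Bs (s k) ltac:(lra)) Bx0 tk.
rewrite (_ : vadd (vscale _ (vadd _ _)) _ = vadd x0 (vscale t w)); last first.
  by apply: vecP => i; rewrite /vadd /vscale; field; lra.
have : t / s k * u (vadd x0 (vscale (s k) w)) <= t / s k * (u x0 + s k * (dot q w + om)).
  by apply: Rmult_le_compat_l; lra.
rewrite (_ : t / s k * (u x0 + s k * (dot q w + om)) = t / s k * u x0 + t * (dot q w + om)); first lra.
by field; lra.
Qed.

End Convex.

(** * Volume of flat simplices *)

(** In the frame [g] the vectors [y i] form a triangular matrix with diagonal [d] up to sign, so for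
    [m = n] the simplex they span with the origin has volume [prod d / n!]. The bound on the other
    entries makes it comparable to a box with sides [d] in that frame. *)
Record triangular {n} m (g y : nat -> Rn n) (d : nat -> R) (K : R) : Prop := Triangular {
  tri_pos : forall i, (i < m)%N -> 0 < d i;
  tri_diag : forall i, (i < m)%N -> Rabs (dot (g i) (y i)) = d i;
  tri_zero : forall i l, (i < m)%N -> (i < l < n)%N -> dot (g l) (y i) = 0;
  tri_le : forall i l, (i < m)%N -> (l < i)%N -> Rabs (dot (g l) (y i)) <= K * d l }.

(** Back substitution from the last coordinate; eliminating one unknown enlarges the bound on the
    remaining coordinates by a factor [1 + K]. *)
Lemma triangular_solve n m (g y : nat -> Rn n) d K c z : orthonormal n g -> (m <= n)%N ->
  triangular m g y d K -> 0 <= K -> 0 <= c ->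
  (forall l, (m <= l < n)%N -> dot (g l) z = 0) ->
  (forall l, (l < m)%N -> Rabs (dot (g l) z) <= c * d l) ->
  exists mu, z = lincomb m mu y /\ forall i, (i < m)%N -> Rabs (mu i) <= c * (1 + K) ^ m.
Proof.
move=> Hg + + K0; elim: m c z => [|m IH] c z mn T c0 z0 zc.
  exists (fun=> 0); split => //; rewrite lincomb0 (orthonormal_expand z Hg).
  apply: vecP => j; rewrite /lincomb /vzero big1 // => i _.
  by rewrite z0 ?ltn_ord //; ring.
have [Td Tg T0 TK] := T.
have dm := Td m (ltnSn m); have gm := Tg m (ltnSn m).
have gm0 : dot (g m) (y m) <> 0 by move=> E; move: gm; rewrite E Rabs_R0; lra.
pose mm := dot (g m) z / dot (g m) (y m).
have mmd : mm * dot (g m) (y m) = dot (g m) z by rewrite /mm; field.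
have mmc : Rabs mm <= c.
  apply: (Rmult_le_reg_r (d m)) => //; have := zc m (ltnSn m).
  by rewrite -mmd Rabs_mult gm.
have [||||mu [Hmu1 Hmu2]] := IH (c * (1 + K)) (vsub z (vscale mm (y m))) (ltnW mn).
- split => [i im|i im|i l im|i l im]; [exact/Td/ltnW|exact/Tg/ltnW|exact/T0/ltnW|exact/TK/ltnW].
- by apply: Rmult_le_pos; lra.
- move=> l /andP[ml ln]; rewrite dotBr dotZr; move: ml; rewrite leq_eqVlt => /orP[/eqP <-|ml].
    by rewrite mmd; ring.
  by rewrite z0 ?ml // T0 ?ml //; ring.
- move=> l lm; rewrite dotBr dotZr.
  have A := zc l (ltnW lm); have B := TK m l (ltnSn m) lm.
  have D : Rabs (mm * dot (g l) (y m)) <= c * (K * d l).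
    by rewrite Rabs_mult; apply: Rmult_le_compat => //; apply: Rabs_pos.
  have := Rabs_triang (dot (g l) z) (- (mm * dot (g l) (y m))); rewrite Rabs_Ropp => H.
  by rewrite /Rminus; lra.
have P1 : 1 <= (1 + K) ^ m by apply: pow_R1_Rle; lra.
exists (fun i => if (i < m)%N then mu i else mm); split.
  rewrite lincombS ltnn (_ : lincomb m _ y = lincomb m mu y); last first.
    by apply: eq_lincomb => i ->.
  by rewrite -Hmu1; apply: vecP => j; rewrite /vadd /vsub /vscale; ring.
move=> i _; case: ifP => im; first by have := Hmu2 i im; rewrite /=; lra.
apply: Rle_trans mmc _; rewrite -[X in X <= _]Rmult_1_r; apply: Rmult_le_compat_l => //.
by apply: pow_R1_Rle; lra.
Qed.

Lemma open_slab_box n (g : nat -> Rn n) (c : Rn n) (d : nat -> R) : orthonormal n g ->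
  is_open (fun x => forall l, (l < n)%N -> Rabs (dot (g l) (vsub x c)) < d l).
Proof.
move=> Hg x Hx.
have [m Hm] := @eventually_ord n (fun l k => Rabs (dot (g l) (vsub x c)) + / (INR k + 1) <= d l) ltac:(
  by move=> l; have [N HN] := @inv_succ_lt (d l - Rabs (dot (g l) (vsub x c)))
    ltac:(have := Hx l (ltn_ord l); lra); exists N => k /HN; lra).
exists (/ (INR m + 1)); split; first by apply: Rinv_0_lt_compat; have := pos_INR m; lra.
move=> y xy l ln; have := Hm (Ordinal ln) m (leqnn m); rewrite /=.
have := orthonormal_dot_le (vsub y x) Hg ln; rewrite -distE dist_sym.
rewrite (_ : vsub y c = vadd (vsub y x) (vsub x c)); last first.
  by apply: vecP => i; rewrite /vadd /vsub; ring.
by rewrite dotDr; have := Rabs_triang (dot (g l) (vsub y x)) (dot (g l) (vsub x c)); lra.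
Qed.

(* The gradient image of the middle part of the simplex lies in a box of volume
   [tau ^ (2 n) / prod d], while the middle part has volume [prod d]; the Monge-Ampere
   inequality compares the two. *)
Lemma simplex_volume n (u : Rn n -> R) K : (1 <= n)%N ->
  convex_on unit_ball u -> alexandrov_det_ge1 unit_ball u -> 0 <= K ->
  exists C, 0 < C /\ forall x0 p g y d tau, unit_ball x0 -> subgrad unit_ball u x0 p ->
    orthonormal n g -> triangular n g y d K -> 0 < tau ->
    (forall i, (i < n)%N -> unit_ball (vadd x0 (y i)) /\
       u (vadd x0 (y i)) <= u x0 + dot p (y i) + tau * tau) ->
    \rprod_(i < n) d i <= C * tau ^ n.
Proof.
move=> n1 Hu Halex K0.
have N1 : 1 <= INR n by have /le_INR := elimT leP n1.
have Kn : 1 <= (1 + K) ^ n by apply: pow_R1_Rle; lra.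
(* Back substitution turns a displacement by [2 * c * d l] into coefficients of size at most
   [1 / (2 n)]. Around the point [xc], whose coefficients are all [1 / (2 n)], they thus stay
   between 0 and [1 / n]. *)
pose c := / (4 * INR n * (1 + K) ^ n).
have cden : 0 < 4 * INR n * (1 + K) ^ n by nra.
have c0 : 0 < c by apply: Rinv_0_lt_compat.
have cE : 2 * c * (1 + K) ^ n = / (2 * INR n) by rewrite /c; field; lra.
pose W1 := (4 * INR n * INR n) ^ n.
have W10 : 0 < W1 by apply: pow_lt; nra.
pose W2 := (4 * 1 * INR n) ^ n.
have W20 : 0 < W2 by apply: pow_lt; nra.
pose W3 := W2 * (2 * W1 + 1) * (2 / c) ^ n / c ^ n.
have cn : 0 < c ^ n by apply: pow_lt.
have c2n : 0 < (2 / c) ^ n by apply: pow_lt; apply: Rdiv_lt_0_compat; lra.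
have W30 : 0 < W3.
  by apply: Rdiv_lt_0_compat => //; apply: Rmult_lt_0_compat => //; apply: Rmult_lt_0_compat => //; lra.
exists (1 + W3); split; first lra.
move=> x0 p g y d tau Bx0 Hp Hg T tau0 Hy.
have [Td _ _ _] := T.
have tt0 : 0 < tau * tau by nra.
pose P z := unit_ball (vadd x0 z) /\ u (vadd x0 z) <= u x0 + dot p z + tau * tau.
have Pconv x z t : P x -> P z -> 0 <= t <= 1 -> P (vadd (vscale t x) (vscale (1 - t) z)).
  move=> [x1 x2] [z1 z2] Ht.
  have E : vadd x0 (vadd (vscale t x) (vscale (1 - t) z)) =
    vadd (vscale t (vadd x0 x)) (vscale (1 - t) (vadd x0 z)).
    by apply: vecP => i; rewrite /vadd /vscale; ring.
  rewrite /P E; split; first exact: unit_ball_convex.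
  apply: Rle_trans (convex_ub Hu x1 z1 Ht) _; rewrite dotDr !dotZr.
  have := Rmult_le_compat_l t _ _ ltac:(lra) x2.
  by have := Rmult_le_compat_l (1 - t) _ _ ltac:(lra) z2; lra.
have P0 : P vzero.
  rewrite /P (_ : vadd x0 vzero = x0); last by apply: vecP => i; rewrite /vadd /vzero; ring.
  by rewrite dot0r; split => //; lra.
pose xc := lincomb n (fun=> / (2 * INR n)) y.
have Pc z : (forall l, (l < n)%N -> Rabs (dot (g l) z) <= 2 * c * d l) -> P (vadd xc z).
  move=> Hz.
  have [||mu [-> Hmu]] := triangular_solve Hg (leqnn n) T K0 (_ : 0 <= 2 * c) _ Hz; first lra.
    by move=> l /andP[nl]; rewrite ltnNge nl.
  have -> : vadd xc (lincomb n mu y) =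
      (fun j => \rsum_(i < n) ((fun i : 'I_n => / (2 * INR n) + mu i) i * y i j)).
    by apply: vecP => j; rewrite /vadd /xc /lincomb -rsum_add; apply: eq_bigr => i _; ring.
  have Hmu' (i : 'I_n) : - / (2 * INR n) <= mu i <= / (2 * INR n).
    by apply: Rabs_bounds; rewrite -cE; apply: Hmu.
  apply: convex_pred_comb => //.
  - by move=> i; apply: Hy.
  - by move=> i; have := Hmu' i; lra.
  - apply: Rle_trans (_ : INR n * (/ INR n) <= _); last by rewrite Rinv_r; lra.
    apply: rsum_ord_le => i; have := Hmu' i.
    by rewrite (_ : / (2 * INR n) = / INR n / 2); [lra|field; lra].
pose o := vadd x0 xc.
(* Half of the admissible size is used, so that a step of length [c * d l] along [g l] from any
   point of [A] is still in the simplex. *)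
pose A x := forall l, (l < n)%N -> Rabs (dot (g l) (vsub x o)) < c * d l.
have PA x z : A x -> (forall l, (l < n)%N -> Rabs (dot (g l) z) <= c * d l) ->
    P (vadd (vsub x x0) z).
  move=> Ax Hz; rewrite (_ : vadd _ _ = vadd xc (vadd (vsub x o) z)); last first.
    by apply: vecP => i; rewrite /vadd /vsub /o /vadd; ring.
  apply: Pc => l ln; rewrite dotDr.
  by have := Rabs_triang (dot (g l) (vsub x o)) (dot (g l) z); have := Ax l ln; have := Hz l ln; lra.
have A1 x : A x -> unit_ball x.
  move=> Ax; have [] := PA x vzero Ax.
    by move=> l ln; rewrite dot0r Rabs_R0; have := Td l ln; nra.
  rewrite (_ : vadd x0 _ = x) //; by apply: vecP => i; rewrite /vadd /vsub /vzero; ring.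
have Hleb := Halex A (borel_open (open_slab_box (d := fun l => c * d l) (c := o) Hg)) A1.
(* On the simplex [u - L_p] lies between 0 and [tau * tau]; steps of length [c * d l] in both
   directions bound the slopes of its subgradients on [A] by [e l]. *)
pose e (l : nat) := tau * tau / (c * d l).
have e0 l : (l < n)%N -> 0 < e l.
  by move=> ln; apply: Rdiv_lt_0_compat => //; have := Td l ln; nra.
pose Vol := \rprod_(l < n) (2 * e l).
have Vol0 : 0 < Vol by apply: rprod_gt0 => l _; have := e0 l (ltn_ord l); lra.
(* Boxes are parallel to the axes, whereas the bounds are in the frame [g]. The change of
   coordinates is treated as a Lipschitz map, both here and in [Rel2]. *)
pose Rel1 (b q : Rn n) := forall i, q i = p i + \rsum_(l < n) (b l * g l i).
have L1 : lipschitz_rel Rel1 (INR n).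
  move=> b q b' q' H H' i; rewrite H H'.
  rewrite (_ : _ - _ = \rsum_(l < n) ((b l - b' l) * g l i)); last first.
    rewrite (_ : \rsum_(l < n) ((b l - b' l) * g l i) =
      \rsum_(l < n) (b l * g l i) + (-1) * \rsum_(l < n) (b' l * g l i)); first by ring.
    by rewrite rsum_mulr -rsum_add; apply: eq_bigr => l _; ring.
  apply: Rle_trans (rsum_abs _ _ _) _; apply: rsum_ord_le => l; rewrite Rabs_mult.
  have := norm_coord (g l) i; rewrite (orthonormal_norm Hg (ltn_ord l)).
  have := norm_coord (vsub b b') l; rewrite -distE /vsub.
  have := Rabs_pos (b l - b' l); have := Rabs_pos (g l i); nra.
have [|||B [S [HB HS HSle]]] := @lipschitz_image_cover n n1 Rel1 (INR n) ltac:(lra) L1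
  ((fun l : 'I_n => - e l), (fun l : 'I_n => e l)) (subdiff_img unit_ball u A) Vol.
- by move=> l /=; have := e0 l (ltn_ord l); lra.
- exact: Vol0.
- move=> q [x [Ax Hq]]; exists (fun l : 'I_n => dot (g l) (vsub q p)); split.
    move=> l /=; have ln := ltn_ord l.
    have dl := Td l ln.
    have key s : Rabs s = c * d l -> s * dot (g l) (vsub q p) <= tau * tau.
      move=> Hs; have Hz k : (k < n)%N -> Rabs (dot (g k) (vscale s (g l))) <= c * d k.
        move=> kn; rewrite dotZr Hg //; have := Td k kn.
        by case: eqP => [->|_] ?; [rewrite Rmult_1_r; lra|rewrite Rmult_0_r Rabs_R0; nra].
      have [Bz Uz] := PA x _ Ax Hz.
      have Hpx := Rge_le _ _ (Hp x (A1 x Ax)).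
      have := Rge_le _ _ (Hq _ Bz).
      rewrite (_ : vsub (vadd x0 _) x = vscale s (g l)); last first.
        by apply: vecP => i; rewrite /vadd /vsub; ring.
      move: Uz; rewrite dotDr !dotZr (dotBr q p) (dotC q) (dotC p (g l)); lra.
    have ce : 0 < c * d l by nra.
    have Ee : e l * (c * d l) = tau * tau by rewrite /e; field; lra.
    have Hk1 := key (c * d l) ltac:(rewrite Rabs_pos_eq; lra).
    have Hk2 := key (- (c * d l)) ltac:(rewrite Rabs_Ropp Rabs_pos_eq; lra).
    by split; apply: (Rmult_le_reg_r (c * d l)) => //; lra.
  move=> i; have := orthonormal_expand (vsub q p) Hg => /(congr1 (fun f => f i)).
  by rewrite {1}/vsub /lincomb => <-; ring.
have [B' [S' [HB' [HS' HSle']]]] := Hleb B S HB HS Vol Vol0.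
pose Rel2 (x b : Rn n) := forall l : 'I_n, b l = dot (g l) x.
have L2 : lipschitz_rel Rel2 1.
  move=> x b x' b' H H' l; rewrite H H' -dotBr Rmult_1_l.
  exact: orthonormal_dot_le Hg (ltn_ord l).
have := @lipschitz_image_volume n n1 Rel2 1 ltac:(lra) L2 A B' S'
  ((fun l : 'I_n => dot (g l) o - c * d l / 2), (fun l : 'I_n => dot (g l) o + c * d l / 2)) HB' HS'.
move=> H; have {H} : \rprod_(l < n) (c * d l) <= W2 * S'.
  rewrite (_ : \rprod_(l < n) (c * d l) = box_vol ((fun l : 'I_n => dot (g l) o - c * d l / 2),
    (fun l : 'I_n => dot (g l) o + c * d l / 2))); last first.
    by apply: eq_bigr => l _ /=; field.
  apply: H => [l /=|b Hb]; first by have := Td l (ltn_ord l); nra.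
  pose b' k := if insub k is Some l then b l else 0.
  have b'E (l : 'I_n) : b' l = b l by rewrite /b' valK.
  exists (lincomb n b' g); split; last first.
    by move=> l; rewrite (dot_orthonormal_lincomb _ Hg) // ltn_ord b'E.
  move=> l ln; rewrite dotBr (dot_orthonormal_lincomb _ Hg) // ln.
  have /= := Hb (Ordinal ln); rewrite -b'E /= => ?.
  have : 0 < c * d l by have := Td l ln; nra.
  by move=> ?; apply: Rabs_def1; lra.
rewrite rprod_mul rprod_const; set Dd := \rprod_(i < n) d i.
have D0 : 0 < Dd by apply: rprod_gt0 => l _; apply: Td.
have VD : Vol * Dd = (2 / c) ^ n * (tau ^ n * tau ^ n).
  rewrite /Vol /Dd -rprod_mul -!rprod_const -!rprod_mul; apply: eq_bigr => l _.
  by have := Td l (ltn_ord l) => ?; rewrite /e; field; split; lra.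
move=> H1.
have Hbox : box_vol ((fun l : 'I_n => - e l), (fun l : 'I_n => e l)) = Vol.
  by apply: eq_bigr => l _ /=; ring.
rewrite Hbox -/W1 in HSle.
have H2 : c ^ n * Dd <= W2 * ((2 * W1 + 1) * Vol).
  by apply: Rle_trans H1 _; apply: Rmult_le_compat_l; lra.
have tn : 0 < tau ^ n by apply: pow_lt.
have H3 : Dd * Dd <= W3 * (tau ^ n * tau ^ n).
  apply: (Rmult_le_reg_l (c ^ n)) => //.
  have -> : c ^ n * (W3 * (tau ^ n * tau ^ n)) = W2 * (2 * W1 + 1) * ((2 / c) ^ n * (tau ^ n * tau ^ n)).
    by rewrite /W3; field; lra.
  rewrite -VD; have := Rmult_le_compat_r Dd _ _ ltac:(lra) H2; lra.
(* The factor [1 + W3] replaces the square root of [W3]. *)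
apply: Rnot_lt_le => H4.
have : (1 + W3) * tau ^ n * ((1 + W3) * tau ^ n) < Dd * Dd.
  have : 0 < (1 + W3) * tau ^ n by nra.
  by nra.
have : 0 < tau ^ n * tau ^ n by nra.
by nra.
Qed.

(** * Greedy flags *)

(** Maxima need not be attained; half of the supremum is enough. This is where the factors 2 in
    [flag] and in the Vitali selection come from. *)
Lemma nearly_maximal (A : Type) (S : A -> Prop) (phi : A -> R) C z0 : S z0 -> 0 < phi z0 ->
  (forall z, S z -> phi z <= C) -> exists y, [/\ S y, 0 < phi y & forall z, S z -> phi z <= 2 * phi y].
Proof.
move=> Sz0 p0 HC.
have [||v [ub lub]] := completeness (fun c => exists z, S z /\ c = phi z).
- by exists C => _ [z [Sz ->]]; apply: HC.
- by exists (phi z0), z0.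
have v0 : phi z0 <= v by apply: ub; exists z0.
have [y [Sy Hy]] : exists y, S y /\ v / 2 < phi y.
  apply: NNPP => H; suff : v <= v / 2 by lra.
  by apply: lub => _ [z [Sz ->]]; apply: Rnot_lt_le => ?; apply: H; exists z.
exists y; split => //; first lra.
by move=> z Sz; have : phi z <= v by [apply: ub; exists z]; lra.
Qed.

(** Here [a i] measures how far [S] reaches out of the span of the first [i] directions, up to a
    factor 2. Hence [S] has extent at most [2 * a l] along [g l], and its points [y i] span a
    triangular simplex of that size. *)
Record flag {n} (S : Rn n -> Prop) (t : R) (e : Rn n) (g y : nat -> Rn n) (a : nat -> R) : Prop := Flag {
  flag_orth : orthonormal n g;
  flag_dir : g 0%N = e;
  flag_start : a 0%N = t;
  flag_mem : forall i, (i < n)%N -> S (y i);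
  flag_tri : triangular n g y a 2;
  flag_le : forall z i l, S z -> (i <= l < n)%N -> Rabs (dot (g l) z) <= 2 * a i }.

Lemma residualZ n m g c (x : Rn n) : residual m g (vscale c x) = vscale c (residual m g x).
Proof.
apply: vecP => j; rewrite /residual /vsub /vscale /lincomb.
rewrite Rmult_minus_distr_l rsum_mulr; congr (_ - _); apply: eq_bigr => i _.
by rewrite (_ : (fun i => c * x i) = vscale c x) // dotZr; ring.
Qed.

Lemma residual_norm_le n m g (x : Rn n) : orthonormal m g -> norm (residual m g x) <= norm x.
Proof.
move=> H; apply: norm_le_sqr; first exact: norm_ge0.
rewrite residual_sqr // norm_sqr; suff : 0 <= \rsum_(i < m) (dot (g i) x * dot (g i) x) by lra.
by apply: rsum_ge0 => i _; nra.
Qed.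

Lemma eq_residual n m (g g' : nat -> Rn n) x : (forall i, (i < m)%N -> g i = g' i) ->
  residual m g x = residual m g' x.
Proof.
by move=> H; rewrite /residual; congr vsub; apply: eq_lincomb => i im; rewrite H.
Qed.

Lemma dot_residual_eq n m k g (x : Rn n) l : orthonormal m g -> (k <= l)%N -> (l < m)%N ->
  dot (g l) (residual k g x) = dot (g l) x.
Proof.
move=> H kl lm; rewrite /residual dotBr (dot_orthonormal_lincomb _ H) //; last exact: leq_trans kl (ltnW lm).
by rewrite ltnNge kl /=; ring.
Qed.

(** Gram-Schmidt in which the next vector is the residual of a point of [S] with nearly maximal
    residual. The start [vscale t e] is admissible because [S] lies in the ball of radius [t]. *)
Lemma greedy_flag n (S : Rn n -> Prop) t e rho : (1 <= n)%N -> 0 < t -> norm e = 1 ->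
  S (vscale t e) -> (forall z, S z -> norm z <= t) ->
  0 < rho -> (forall z, norm z <= rho -> S z) ->
  exists g y a, flag S t e g y a.
Proof.
move=> n1 t0 e1 Ste St r0 Sr.
pose inv m (g y : nat -> Rn n) (a : nat -> R) := [/\ orthonormal m g, g 0%N = e, a 0%N = t &
  forall i, (i < m)%N -> [/\ S (y i), 0 < a i, vscale (a i) (g i) = residual i g (y i) &
    forall z, S z -> norm (residual i g z) <= 2 * a i]].
have [g [y [a [Hg g0 a0 H]]]] : exists g y a, inv n g y a.
  suff Hm m : (m.+1 <= n)%N -> exists g y a, inv m.+1 g y a.
    by have := Hm n.-1; rewrite (prednK n1) => /(_ (leqnn n)).
  elim: m => [_|m IH mn].
    exists (fun=> e), (fun=> vscale t e), (fun=> t).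
    have r0E z : residual 0 (fun=> e) z = z.
      by rewrite /residual lincomb0; apply: vecP => i; rewrite /vsub /vzero; ring.
    split => //.
    - by move=> [|i] [|j] //= _ _; rewrite -norm_sqr e1; ring.
    - move=> [|i] // _; split => //.
      by move=> z Sz; rewrite r0E; have := St z Sz; lra.
  have [g [y [a [Hg g0 a0 H]]]] := IH (ltnW mn).
  have [l Hl] := residual_nonzero Hg mn.
  (* The small ball contained in [S] ensures that the next width is positive. *)
  pose z0 := vscale rho (basis l).
  have Sz0 : S z0.
    by apply: Sr; rewrite normZ /norm dot_basis /basis eqxx sqrt_1 Rabs_pos_eq; lra.
  have pz0 : 0 < norm (residual m.+1 g z0).
    by rewrite residualZ normZ Rabs_pos_eq; [apply: Rmult_lt_0_compat => //; apply: norm_gt0|lra].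
  have [|w [Sw pw Hw]] := @nearly_maximal _ S (fun z => norm (residual m.+1 g z)) t z0 Sz0 pz0.
    by move=> z /St; have := residual_norm_le z Hg; lra.
  set r := residual m.+1 g w in pw; pose nr := norm r.
  have rr : dot r r = nr * nr by rewrite norm_sqr.
  pose g' k := if k == m.+1 then vscale (/ nr) r else g k.
  pose y' k := if k == m.+1 then w else y k.
  pose a' k := if k == m.+1 then nr else a k.
  have gE k i : (k <= m.+1)%N -> (i < k)%N -> g' i = g i.
    by move=> km ik; rewrite /g' ltn_eqF //; apply: leq_trans ik km.
  have rE k z : (k <= m.+1)%N -> residual k g' z = residual k g z.
    by move=> km; apply: eq_residual => i ik; apply: (gE k).
  have gr i : (i < m.+1)%N -> dot (g i) (vscale (/ nr) r) = 0.
    by move=> im; rewrite dotZr dot_residual //; ring.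
  exists g', y', a'; split => //.
  - move=> i j; rewrite ltnS leq_eqVlt => /orP[/eqP ->|im]; rewrite ltnS leq_eqVlt => /orP[/eqP ->|jm];
      rewrite /g' ?eqxx.
    + by rewrite dotZl dotZr rr; field; rewrite -/nr in pw; lra.
    + by rewrite (ltn_eqF jm) (gtn_eqF jm) dotC gr.
    + by rewrite (ltn_eqF im) gr.
    + by rewrite (ltn_eqF im) (ltn_eqF jm) Hg.
  - move=> i; rewrite ltnS leq_eqVlt => /orP[/eqP ->|im].
      rewrite /y' /a' /g' eqxx; split => //.
        rewrite -/(g') rE // -/r; apply: vecP => j; rewrite /vscale.
        by field; rewrite -/nr in pw; lra.
      by move=> z Sz; rewrite -/(g') rE //; apply: Hw.
    have [A B C D] := H i im.
    rewrite /y' /a' (ltn_eqF im) (gE m.+1) // rE; last exact: ltnW.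
    split => // z Sz; rewrite rE; [exact: D|exact: ltnW].
exists g, y, a; split => //.
- by move=> i /H[].
- split.
  + by move=> i /H[].
  + move=> i im; have [_ ai E _] := H i im.
    rewrite -(@dot_residual_eq n n i g) // -E dotZr Hg // eqxx Rmult_1_r Rabs_pos_eq //; lra.
  + move=> i l im /andP[il ln]; have [_ _ E _] := H i im.
    rewrite -(@dot_residual_eq n n i g) ?(ltnW il) // -E dotZr Hg //.
    by rewrite (gtn_eqF il); ring.
  + move=> i l im li; have ln := ltn_trans li im; have [Sy _ _ _] := H i im.
    have [_ _ _ D] := H l ln; rewrite -(@dot_residual_eq n n l g) //.
    exact: Rle_trans (orthonormal_dot_le _ Hg ln) (D _ Sy).
- move=> z i l Sz /andP[il ln]; have [_ _ _ D] := H i (leq_ltn_trans il ln).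
  rewrite -(@dot_residual_eq n n i g) //.
  exact: Rle_trans (orthonormal_dot_le _ Hg ln) (D _ Sz).
Qed.

Lemma rprod_two_values n k A B : (k <= n)%N ->
  \rprod_(l < n) (if (l < k)%N then A else B) = A ^ k * B ^ (n - k).
Proof.
move=> /subnK <-; elim: (n - k)%N => [|j IH].
  rewrite add0n subnn /= Rmult_1_r -rprod_const; apply: eq_bigr => l _.
  by rewrite ltn_ord.
rewrite addSn (rprod_recr _ (fun l => if (l < k)%N then A else B)) IH.
by rewrite ltnNge leq_addl /= subSn ?leq_addl //=; ring.
Qed.

(** * Minima of [u] plus a quadratic function that is diagonal in a frame *)

Section QuadraticMinimum.
Variables (n : nat) (u : Rn n -> R) (x0 : Rn n) (g : nat -> Rn n) (A B ga : nat -> R) (r : R).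
Hypotheses (Hu : convex_on unit_ball u) (Hg : orthonormal n g) (r0 : 0 < r).

Definition frame_box z : Prop := forall l, (l < n)%N -> Rabs (dot (g l) z - ga l) <= r.
Definition perturbed z : R :=
  u (vadd x0 z) + \rsum_(l < n) (A l * (dot (g l) z * dot (g l) z) + B l * dot (g l) z).

Hypothesis HD : forall z, frame_box z -> unit_ball (vadd x0 z).

(** At an interior minimum the negative gradient of the quadratic part is a subgradient of [u]. That
    the minimum is interior depends on the coefficients and is left as a premise. *)
Lemma perturbed_minimum : exists z, [/\ frame_box z,
  forall z', frame_box z' -> perturbed z <= perturbed z' &
  (forall l, (l < n)%N -> Rabs (dot (g l) z - ga l) < r) ->
  subgrad unit_ball u (vadd x0 z)
    (vscale (-1) (lincomb n (fun l => 2 * A l * dot (g l) z + B l) g))].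
Proof.
have nn := pos_INR n.
have gn l : (l < n)%N -> norm (g l) = 1 by apply: orthonormal_norm.
have near_coord l d z z' : (l < n)%N -> 0 <= d -> near d z z' ->
    Rabs (dot (g l) z - dot (g l) z') <= INR n * d.
  by move=> ln d0 H; have := near_dot (g l) d0 H; rewrite gn // !(dotC (g l)); lra.
pose C := \rsum_(l < n) (Rabs (ga l) + r).
have HC l : (l < n)%N -> Rabs (ga l) + r <= C.
  move=> ln; apply: (@rsum_ge_term n (fun l => Rabs (ga l) + r) (Ordinal ln)) => i.
  by have := Rabs_pos (ga i); lra.
have Dc z l : frame_box z -> (l < n)%N -> Rabs (dot (g l) z) <= C.
  move=> Dz ln; have := HC l ln; have := Dz l ln.
  by have := Rabs_triang (dot (g l) z - ga l) (ga l); rewrite (_ : _ - _ + _ = dot (g l) z); [lra|ring].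
have C0 : 0 <= C by apply: rsum_ge0 => l _; have := Rabs_pos (ga l); lra.
have [||||z [Dz Hz]] := @minimum_attained n frame_box perturbed (INR n * C).
- exists (lincomb n ga g) => l ln; rewrite (dot_orthonormal_lincomb _ Hg) // ln.
  by rewrite Rminus_diag Rabs_R0; lra.
- move=> z Dz i; apply: Rle_trans (norm_coord z i) _.
  by apply: (norm_le_orthonormal_coord Hg) => // l ln; apply: Dc.
- move=> y Hy l ln; apply: le_epsilon => e e0.
  have [z [Dz zy]] := Hy (e / (INR n + 1)) ltac:(apply: Rdiv_lt_0_compat; lra).
  have := near_coord l (e / (INR n + 1)) y z ln _ (near_sym zy) => /(_ ltac:(left; apply: Rdiv_lt_0_compat; lra)).
  have : INR n * (e / (INR n + 1)) <= e.
    rewrite (_ : INR n * _ = e * (INR n / (INR n + 1))); last by field; lra.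
    rewrite -[X in _ <= X]Rmult_1_r; apply: Rmult_le_compat_l; first lra.
    by apply: (Rmult_le_reg_r (INR n + 1)); [lra|rewrite /Rdiv Rmult_assoc Rinv_l; lra].
  have := Dz l ln; have := Rabs_triang (dot (g l) y - dot (g l) z) (dot (g l) z - ga l).
  by rewrite (_ : _ - _ + (_ - _) = dot (g l) y - ga l); [lra|ring].
- move=> y Dy e e0.
  have [d [d0 Hd]] := @lower_semicontinuous _ _ Hu _ (e / 2) (HD Dy) ltac:(lra).
  pose W := \rsum_(l < n) ((Rabs (A l) * (2 * C) + Rabs (B l)) * INR n).
  have W0 : 0 <= W.
    apply: rsum_ge0 => l _; apply: Rmult_le_pos => //.
    by have := Rabs_pos (A l); have := Rabs_pos (B l); nra.
  pose d' := Rmin d (e / (2 * (W + 1))).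
  have d'0 : 0 < d' by apply: Rmin_glb_lt => //; apply: Rdiv_lt_0_compat; lra.
  exists d'; split => // x Dx xy.
  have [_ H1] := Hd (vadd x0 x) ltac:(move=> i; rewrite /vadd (_ : _ - _ = x i - y i); [apply: Rle_trans (xy i) (Rmin_l _ _)|ring]).
  have H3 : W * d' <= e / 2.
    apply: Rle_trans (_ : (W + 1) * (e / (2 * (W + 1))) <= _); last by apply: Req_le; field; lra.
    by apply: Rmult_le_compat; try lra; apply: Rmin_r.
  have H2 : \rsum_(l < n) (A l * (dot (g l) y * dot (g l) y) + B l * dot (g l) y) <=
      \rsum_(l < n) (A l * (dot (g l) x * dot (g l) x) + B l * dot (g l) x) + W * d'.
    rewrite (Rmult_comm W) /W rsum_mulr -rsum_add; apply: rsum_le => l _.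
    have ln := ltn_ord l.
    have E := near_coord l d' y x ln ltac:(lra) (near_sym xy).
    have Ey := Dc y l Dy ln; have Ex := Dc x l Dx ln.
    move: E Ey Ex; set cy := dot _ y; set cx := dot _ x => E Ey Ex.
    have -> : A l * (cy * cy) + B l * cy = A l * (cx * cx) + B l * cx + (A l * (cy + cx) + B l) * (cy - cx).
      by ring.
    apply: Rplus_le_compat_l; apply: Rle_trans (Rle_abs _) _; rewrite Rabs_mult Rmult_comm.
    rewrite (_ : d' * _ = INR n * d' * (Rabs (A l) * (2 * C) + Rabs (B l))); last by ring.
    apply: Rmult_le_compat => //; try exact: Rabs_pos.
    apply: Rle_trans (Rabs_triang _ _) _; apply: Rplus_le_compat_r; rewrite Rabs_mult.
    apply: Rmult_le_compat_l; first exact: Rabs_pos.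
    by have := Rabs_triang cy cx; lra.
  by rewrite /perturbed; lra.
exists z; split => // Hin.
have [eta [eta0 Heta]] : exists eta, 0 < eta /\ forall l, (l < n)%N -> Rabs (dot (g l) z - ga l) + eta <= r.
  have [|m Hm] := @eventually_ord n (fun l k => Rabs (dot (g l) z - ga l) + / (INR k + 1) <= r).
    move=> l; have [N HN] := @inv_succ_lt (r - Rabs (dot (g l) z - ga l)) ltac:(have := Hin l (ltn_ord l); lra).
    by exists N => j /HN; lra.
  exists (/ (INR m + 1)); split; first by apply: Rinv_0_lt_compat; have := pos_INR m; lra.
  by move=> l ln; apply: (Hm (Ordinal ln) m).
apply: (@subgrad_of_minimum n u Hu _ _ (\rsum_(l < n) Rabs (A l)) eta) => //; first exact: HD.
move=> w Hw _.
have := Hz (vadd z w) ltac:(by move=> l ln; rewrite dotDr; have := Heta l ln;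
  have := orthonormal_dot_le w Hg ln; have := Rabs_triang (dot (g l) z - ga l) (dot (g l) w);
  rewrite (_ : dot (g l) z + dot (g l) w - ga l = dot (g l) z - ga l + dot (g l) w); [lra|ring]).
rewrite /perturbed (_ : vadd x0 (vadd z w) = vadd (vadd x0 z) w); last first.
  by apply: vecP => i; rewrite /vadd; ring.
suff : \rsum_(l < n) (A l * (dot (g l) (vadd z w) * dot (g l) (vadd z w)) + B l * dot (g l) (vadd z w))
  <= \rsum_(l < n) (A l * (dot (g l) z * dot (g l) z) + B l * dot (g l) z) +
     dot (lincomb n (fun l => 2 * A l * dot (g l) z + B l) g) w + (\rsum_(l < n) Rabs (A l)) * dot w w by lra.
rewrite (dotC _ w) dot_lincomb (Rmult_comm (\rsum_(l < n) Rabs (A l))) rsum_mulr -!rsum_add.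
apply: rsum_le => l _; rewrite dotDr (dotC w).
have : dot (g l) w * dot (g l) w <= dot w w.
  have := orthonormal_dot_le w Hg (ltn_ord l) => /Rabs_bounds; have := norm_ge0 w; rewrite -norm_sqr; nra.
set cw := dot (g l) w; set cz := dot (g l) z => H.
have : A l * (cw * cw) <= dot w w * Rabs (A l).
  apply: Rle_trans (_ : Rabs (A l) * (cw * cw) <= _); first by apply: Rmult_le_compat_r; [nra|apply: Rle_abs].
  by rewrite Rmult_comm; apply: Rmult_le_compat_r => //; apply: Rabs_pos.
by lra.
Qed.

End QuadraticMinimum.

(** * Gradient images of [u + |x|^2 / 2] *)

Definition grad_image {n} (u : Rn n -> R) (x : Rn n) (rho : R) (q : Rn n) : Prop :=
  exists y, [/\ unit_ball y, dist x y <= rho & subgrad unit_ball u y (vsub q y)].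

(** Monotonicity of the subdifferential of [u] gives [|y - y'|^2 <= (q - q') . (y - y')]; then
    Cauchy-Schwarz. *)
Lemma grad_inverse_lipschitz n (u : Rn n -> R) y y' q q' : unit_ball y -> unit_ball y' ->
  subgrad unit_ball u y (vsub q y) -> subgrad unit_ball u y' (vsub q' y') ->
  dist y y' <= dist q q'.
Proof.
move=> By By' H H'; have := H y' By'; have := H' y By.
have -> : vsub y' y = vscale (-1) (vsub y y') by apply: vecP => i; rewrite /vsub /vscale; ring.
rewrite dotZr => H1 H2.
have : dist y y' * dist y y' <= dist q q' * dist y y'.
  rewrite distE norm_sqr.
  have := cauchy_schwarz (vsub q q') (vsub y y'); have := Rle_abs (dot (vsub q q') (vsub y y')).
  rewrite -!distE; move: H1 H2; set d := vsub y y'; rewrite !dotBl => *.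
  have : dot (vsub y y') d = dot y d - dot y' d by rewrite dotBl.
  by rewrite -/d; lra.
have := norm_ge0 (vsub y y'); have := norm_ge0 (vsub q q'); rewrite -!distE.
move=> q0 y0 H3; have [y1|y1] := Rle_lt_or_eq_dec _ _ y0; last by rewrite -y1.
by apply: (Rmult_le_reg_r (dist y y')).
Qed.

Lemma vadd0 n (x : Rn n) : vadd x vzero = x.
Proof. by apply: vecP => i; rewrite /vadd /vzero; ring. Qed.

Lemma triangularW n m m' (g y : nat -> Rn n) d K : (m' <= m)%N -> triangular m g y d K ->
  triangular m' g y d K.
Proof.
move=> mm [A B C D]; split => [i im|i im|i l im|i l im];
  [apply: A|apply: B|apply: C|apply: D]; exact: leq_trans im mm.
Qed.

(** * Sections at a contact point *)

Section Contact.
Variables (n : nat) (u : Rn n -> R) (x0 p : Rn n).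
Hypotheses (Hu : convex_on unit_ball u) (Bx0 : unit_ball x0) (Hp : subgrad unit_ball u x0 p).

Definition gap z : R := u (vadd x0 z) - u x0 - dot p z.
Definition section t z : Prop := norm z <= t /\ gap z <= t * t.

Lemma gap0 : gap vzero = 0.
Proof. by rewrite /gap vadd0 dot0r; ring. Qed.

Lemma gap_ge0 z : unit_ball (vadd x0 z) -> 0 <= gap z.
Proof.
move=> Bz; have := Hp Bz; rewrite (_ : vsub (vadd x0 z) x0 = z); first by rewrite /gap; lra.
by apply: vecP => i; rewrite /vsub /vadd; ring.
Qed.

Lemma gap_convex x z t : unit_ball (vadd x0 x) -> unit_ball (vadd x0 z) -> 0 <= t <= 1 ->
  unit_ball (vadd x0 (vadd (vscale t x) (vscale (1 - t) z))) /\
  gap (vadd (vscale t x) (vscale (1 - t) z)) <= t * gap x + (1 - t) * gap z.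
Proof.
move=> Bx Bz Ht.
have E : vadd x0 (vadd (vscale t x) (vscale (1 - t) z)) =
    vadd (vscale t (vadd x0 x)) (vscale (1 - t) (vadd x0 z)).
  by apply: vecP => i; rewrite /vadd /vscale; ring.
rewrite /gap E dotDr !dotZr; split; first exact: unit_ball_convex.
by have := convex_ub Hu Bx Bz Ht; lra.
Qed.

Lemma gap_scale z s : unit_ball (vadd x0 z) -> 0 <= s <= 1 ->
  unit_ball (vadd x0 (vscale s z)) /\ gap (vscale s z) <= s * gap z.
Proof.
move=> Bz Hs; have := @gap_convex z vzero s Bz; rewrite vadd0 gap0 => /(_ Bx0 Hs).
rewrite (_ : vadd (vscale s z) _ = vscale s z); first by move=> [? ?]; split => //; lra.
by apply: vecP => i; rewrite /vadd /vscale /vzero; ring.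
Qed.

Lemma section_convex t x z s : t < 1 - norm x0 -> section t x -> section t z -> 0 <= s <= 1 ->
  section t (vadd (vscale s x) (vscale (1 - s) z)).
Proof.
move=> t1 [x1 x2] [z1 z2] Hs; split.
  apply: Rle_trans (norm_triang _ _) _; rewrite !normZ !Rabs_pos_eq; try lra.
  by have := norm_ge0 x; have := norm_ge0 z; nra.
have Bx : unit_ball (vadd x0 x) by apply: unit_ball_shift; lra.
have Bz : unit_ball (vadd x0 z) by apply: unit_ball_shift; lra.
by have [_ H] := gap_convex Bx Bz Hs; nra.
Qed.

(** A crude bound for [gap] on a fixed ball suffices: contracting by [s] multiplies [gap] by at most
    [s], by convexity. *)
Lemma section_nbhd t : 0 < t < 1 - norm x0 -> exists rho, 0 < rho /\ forall z, norm z <= rho -> section t z.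
Proof.
move=> t0; have [rho [C [r0 HC]]] := locally_bounded Hu Bx0.
have HC' z : norm z <= rho -> unit_ball (vadd x0 z) /\ gap z <= 2 * C + norm p * rho.
  move=> Hz; have [Bz Uz] : unit_ball (vadd x0 z) /\ Rabs (u (vadd x0 z)) <= C.
    apply: HC => i; rewrite /vadd (_ : _ - _ = z i); last by ring.
    by apply: Rle_trans (norm_coord z i) _.
  have [_ U0] := HC x0 ltac:(by move=> i; rewrite Rminus_diag Rabs_R0; lra).
  split => //; rewrite /gap; have := Rabs_bounds Uz; have := Rabs_bounds U0.
  have := cauchy_schwarz p z => /Rabs_bounds.
  have : norm p * norm z <= norm p * rho by apply: Rmult_le_compat_l => //; apply: norm_ge0.
  by lra.
pose K := Rabs (2 * C + norm p * rho) + 1.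
have K1 : 1 <= K by rewrite /K; have := Rabs_pos (2 * C + norm p * rho); lra.
have KK : 2 * C + norm p * rho <= K by rewrite /K; have := Rle_abs (2 * C + norm p * rho); lra.
pose s := Rmin 1 (t * t / K).
have s0 : 0 < s by apply: Rmin_glb_lt; [lra|apply: Rdiv_lt_0_compat; nra].
have s1 : s <= 1 by apply: Rmin_l.
have sK : s * K <= t * t.
  apply: Rle_trans (_ : t * t / K * K <= _); last by apply: Req_le; field; lra.
  by apply: Rmult_le_compat_r; [lra|apply: Rmin_r].
exists (Rmin t (s * rho)); split; first by apply: Rmin_glb_lt; nra.
move=> z Hz; split; first exact: Rle_trans Hz (Rmin_l _ _).
have Hz' : norm z <= s * rho by apply: Rle_trans Hz (Rmin_r _ _).
have E : z = vscale s (vscale (/ s) z) by apply: vecP => i; rewrite /vscale; field; lra.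
have [|Bz gz] := HC' (vscale (/ s) z).
  rewrite normZ Rabs_pos_eq; last by left; apply: Rinv_0_lt_compat.
  by apply: (Rmult_le_reg_l s) => //; rewrite -Rmult_assoc Rinv_r; lra.
rewrite E; have [_ H] := gap_scale Bz (conj (Rlt_le _ _ s0) s1).
by apply: Rle_trans H _; nra.
Qed.

Variables (e : Rn n) (len : R).
Hypotheses (n1 : (1 <= n)%N) (He : norm e = 1) (len0 : 0 < len)
  (Be : unit_ball (vadd x0 (vscale len e))) (ge0 : gap (vscale len e) <= 0).

Lemma section_flag t : 0 < t < 1 - norm x0 -> t <= len -> exists g y a, flag (section t) t e g y a.
Proof.
move=> t0 tl; have [rho [r0 Hr]] := section_nbhd t0.
apply: (@greedy_flag n _ t e rho n1 _ He _ _ r0 Hr); try lra; last by move=> z [].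
split; first by rewrite normZ He Rabs_pos_eq; lra.
have tl' : 0 <= t / len <= 1.
  split; first by apply: Rmult_le_pos; [lra|left; apply: Rinv_0_lt_compat].
  by apply: (Rmult_le_reg_r len) => //; rewrite /Rdiv Rmult_assoc Rinv_l; lra.
have [_] := gap_scale Be tl'; rewrite (_ : vscale (t / len) _ = vscale t e); last first.
  by apply: vecP => i; rewrite /vscale; field; lra.
by nra.
Qed.

End Contact.

(** * Widths of sections when the mass is at most [M * rho ^ m] *)

Section FlagVolume.
Variables (m : nat) (u : Rn m.+1 -> R) (CV : R).
Hypotheses (Hu : convex_on unit_ball u) (CV0 : 0 < CV).
Hypothesis HV : forall x0 p g y d tau, unit_ball x0 -> subgrad unit_ball u x0 p ->
    orthonormal m.+1 g -> triangular m.+1 g y d 2 -> 0 < tau ->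
    (forall i, (i < m.+1)%N -> unit_ball (vadd x0 (y i)) /\
       u (vadd x0 (y i)) <= u x0 + dot p (y i) + tau * tau) ->
    \rprod_(i < m.+1) d i <= CV * tau ^ m.+1.

Variables (x0 p e : Rn m.+1) (len : R).
Hypotheses (Bx0 : unit_ball x0) (Hp : subgrad unit_ball u x0 p).
Hypotheses (He : norm e = 1) (len0 : 0 < len)
  (Be : unit_ball (vadd x0 (vscale len e))) (ge0 : gap u x0 p (vscale len e) <= 0).

Definition stretched (a : nat -> R) (i : nat) := if i == 0%N then len else a i.

(** The first edge [t e] is replaced by the whole contact segment, which has height 0; this gains a
    factor [len / t] over the volume bound for the section itself. *)
Lemma flag_volume t g y a : 0 < t < 1 - norm x0 -> t <= len ->
  flag (section u x0 p t) t e g y a -> \rprod_(i < m.+1) stretched a i <= CV * t ^ m.+1.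
Proof.
move=> t0 tl [Hg g0 a0 Sy [T1 T2 T3 T4] Hle].
pose y' i := if i == 0%N then vscale len e else y i.
apply: (@HV x0 p g y') => //; try lra.
- split.
  + by case=> [|i] im; rewrite /stretched //=; apply: T1.
  + case=> [|i] im; rewrite /stretched /y' /=; last exact: T2.
    by rewrite dotZr g0 -norm_sqr He !Rmult_1_r Rabs_pos_eq //; lra.
  + case=> [|i] l im /andP[il ln]; rewrite /y' /=; last by apply: T3 => //; rewrite il.
    by rewrite dotZr -g0 Hg // (gtn_eqF il); ring.
  + case=> [|i] // [|l] im li; rewrite /stretched /y' /=; last exact: T4.
    have [Hn _] := Sy i.+1 im; have := orthonormal_dot_le (y i.+1) Hg (ltn0Sn m); lra.
- case=> [|i] im; rewrite /y' /=.
    by split => //; move: ge0; rewrite /gap; nra.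
  have [Hn Hgap] := Sy i.+1 im; split; first by apply: unit_ball_shift; lra.
  by move: Hgap; rewrite /gap; lra.
Qed.

Variables (M rho0 : R).
Hypothesis (M0 : 0 < M).
Hypothesis Hmass : forall rho, 0 < rho < rho0 -> exists B S,
  [/\ box_cover B (grad_image u x0 rho), infinite_sum (fun k => box_vol (B k)) S & S <= M * rho ^ m].

Let N := INR m.+1.
Let N1 : 1 <= N. Proof. by rewrite /N S_INR; have := pos_INR m; lra. Qed.

(* The radius [r] controls the thin directions [k], ..., [m] of the section.  Every point of a
   box spanned by the flat directions at scale [r] and by all slopes of size [t^2 / a_l] in the
   thin directions is attained by the partial Legendre transform below, so the mass of the
   gradient image of the ball of radius [2 N r] is bounded below by the volume of this box. *)
Lemma thin_box_volume k c t g y a : (0 < k <= m)%N -> 0 < c ->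
  0 < t < 1 - norm x0 -> t <= len -> t < rho0 -> flag (section u x0 p t) t e g y a ->
  (forall i, (i < k)%N -> c * t <= a i) -> 2 * N * (3 * a k) <= t ->
  \rprod_(l < m.+1) (if (l < k)%N then 2 * (c / (4 * N * 3 ^ m.+1) * (3 * a k)) else t * t / (4 * N * a l))
    <= (4 * 1 * N) ^ m.+1 * (M * (2 * N * (3 * a k)) ^ m).
Proof.
move=> /andP[k0 km] c0 t0 tl trho Hflag Hc Hr.
have [Hg g0 a0 Sy T Hle] := Hflag; have [T1 T2 T3 T4] := T.
have kn : (k < m.+1)%N by rewrite ltnS.
have ak0 : 0 < a k by apply: T1.
(* In the directions [l >= k] the section extends at most [2 * a k]; a point with such a coordinate
   of size [r] is therefore outside it. *)
pose r := 3 * a k; rewrite -/r in Hr *.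
have r0 : 0 < r by rewrite /r; lra.
have P3 : 1 <= 3 ^ m.+1 by apply: pow_R1_Rle; lra.
(* Back substitution with [K = 2] loses at most [3 ^ k]. The constant is such that the flat box of
   half side [cs * r] around [ac] lies in the section contracted by [th] below. *)
pose cs := c / (4 * N * 3 ^ m.+1).
have cs0 : 0 < cs by apply: Rdiv_lt_0_compat => //; nra.
rewrite -/cs; pose sig := cs * r.
have sig0 : 0 < sig by rewrite /sig; nra.
(* The contraction by [th] brings the section into the ball of radius [r / 2] and its height down to
   [t * t / 8]. *)
pose th := r / (2 * t).
have th0 : 0 < th by apply: Rdiv_lt_0_compat; lra.
have thE : th * t = r / 2 by rewrite /th; field; lra.
have mR : 1 <= INR m by have /le_INR := elimT leP (leq_trans k0 km).
have N2 : 2 <= N by rewrite /N S_INR; lra.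
have th8 : th <= / 8.
  apply: (Rmult_le_reg_r t); first lra.
  by rewrite thE; nra.
pose ac := lincomb k (fun=> th / (2 * N)) y.
have gac l : (k <= l < m.+1)%N -> dot (g l) ac = 0.
  move=> /andP[kl ln]; rewrite dot_lincomb big1 // => i _.
  rewrite T3 ?ln ?andbT; [ring|exact: ltn_trans (ltn_ord i) kn|exact: leq_trans (ltn_ord i) kl].
have [B [S [HB HS HSle]]] := Hmass (rho := 2 * N * r) ltac:(nra).
(* The penalty [(c - b)^2 / (2 ep)] in the flat directions costs [t * t / 2] at distance [r], more
   than the minimiser can afford. As [ep <= 1], the mixture of slope and position in [Rel] is a
   convex combination of two functions that are 1-Lipschitz in [q]. *)
pose ep := r * r / (t * t).
have ep0 : 0 < ep by apply: Rdiv_lt_0_compat; nra.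
have ep1 : ep <= 1.
  apply: (Rmult_le_reg_r (t * t)); first nra.
  by rewrite /ep /Rdiv Rmult_assoc Rinv_l; nra.
have epE : r * r / (2 * ep) = t * t / 2 by rewrite /ep; field; lra.
(* This is the Euler equation of the minimisation below solved for its parameters [b]: thin
   parameters are slopes of [gap + |z|^2 / 2], flat ones are mixtures of slope and position. *)
pose Rel (q b : Rn m.+1) := exists z, [/\ unit_ball (vadd x0 z),
  subgrad unit_ball u (vadd x0 z) (vsub q (vadd x0 z)) &
  forall l : 'I_m.+1, b l = if (l < k)%N
    then ep * dot (g l) (vsub (vsub q p) x0) + (1 - ep) * dot (g l) z
    else dot (g l) (vsub (vsub q p) x0)].
have HRel : lipschitz_rel Rel 1.
  move=> q b q' b' [z [Bz Hz Hb]] [z' [Bz' Hz' Hb']] l; rewrite Hb Hb' Rmult_1_l.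
  have dz := grad_inverse_lipschitz Bz Bz' Hz Hz'.
  have Ez : vsub (vadd x0 z) (vadd x0 z') = vsub z z'.
    by apply: vecP => i; rewrite /vsub /vadd; ring.
  rewrite distE Ez in dz.
  have E1 : Rabs (dot (g l) (vsub (vsub q p) x0) - dot (g l) (vsub (vsub q' p) x0)) <= dist q q'.
    rewrite -dotBr (_ : vsub _ _ = vsub q q'); first exact: orthonormal_dot_le Hg (ltn_ord l).
    by apply: vecP => i; rewrite /vsub; ring.
  have E2 : Rabs (dot (g l) z - dot (g l) z') <= dist q q'.
    by rewrite -dotBr; apply: Rle_trans (orthonormal_dot_le _ Hg (ltn_ord l)) dz.
  case: ifP => _ //; have := Rabs_bounds E1; have := Rabs_bounds E2.
  set A1 := dot (g l) (vsub (vsub q p) x0); set A2 := dot (g l) (vsub (vsub q' p) x0).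
  by move=> *; apply: Rabs_le; nra.
(* On the section, where the coordinate along [g l] is at most [2 * a l], tilting by slopes up to
   [om l] changes the energy by at most [t * t / 4] in total. *)
pose om l := t * t / (8 * N * a l).
have om0 l : (l < m.+1)%N -> 0 < om l.
  by move=> ln; apply: Rdiv_lt_0_compat; [nra|have := T1 l ln; nra].
have omE l : (l < m.+1)%N -> om l * (2 * a l) = t * t / (4 * N).
  by move=> ln; rewrite /om; field; have := T1 l ln; lra.
pose lo (l : 'I_m.+1) := if (l < k)%N then dot (g l) ac - sig else - om l.
pose hi (l : 'I_m.+1) := if (l < k)%N then dot (g l) ac + sig else om l.
have Hvol : box_vol (lo, hi) <= (4 * 1 * N) ^ m.+1 * S.
  apply: (@lipschitz_image_volume m.+1 _ Rel 1 ltac:(lra) HRel _ B S (lo, hi) HB HS) => //.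
    by move=> l /=; rewrite /lo /hi; case: ifP => _; have := om0 l (ltn_ord l); lra.
  move=> b Hb; rewrite /in_box /= /lo /hi in Hb.
  pose b' j := if insub j is Some l then b l else 0.
  have b'E (l : 'I_m.+1) : b' l = b l by rewrite /b' valK.
  have Hb1 l : (l < k)%N -> Rabs (b' l - dot (g l) ac) <= sig.
    move=> lk; have := Hb (Ordinal (ltn_trans lk kn)); rewrite /= lk -b'E /= => ?.
    by apply: Rabs_le; lra.
  have Hb2 l : (k <= l < m.+1)%N -> Rabs (b' l) <= om l.
    move=> /andP[kl ln]; have := Hb (Ordinal ln); rewrite /= ltnNge kl /= -b'E /= => ?.
    by apply: Rabs_le; lra.
  (* The competitor has the prescribed flat coordinates and no thin ones, so penalty and tilt vanish
     and its energy is its [gap]. *)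
  pose av := lincomb k b' g.
  have gav l : (l < m.+1)%N -> dot (g l) av = if (l < k)%N then b' l else 0.
    by move=> ln; rewrite (dot_orthonormal_lincomb _ Hg) // ltnW.
  have [bb [Sbb avE]] : exists bb, section u x0 p t bb /\ av = vscale th bb.
    pose kap := th / (2 * N * 3 ^ m.+1).
    have kapE : kap * (c * t) = sig.
      by rewrite /kap /sig /cs /th; field; lra.
    have kap0 : 0 < kap by apply: Rdiv_lt_0_compat => //; nra.
    have [|||mu [Hmu1 Hmu2]] := @triangular_solve _ k g y a 2 kap (vsub av ac) Hg (ltnW kn)
      (triangularW (ltnW kn) T) ltac:(lra).
    - lra.
    - by move=> l kl; rewrite dotBr gac //; case/andP: kl => kl ln; rewrite gav // ltnNge kl /=; ring.
    - move=> l lk; rewrite dotBr gav ?(ltn_trans lk kn) // lk.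
      apply: Rle_trans (Hb1 l lk) _; rewrite -kapE.
      by apply: Rmult_le_compat_l; [lra|exact: Hc].
    have Hmu i : (i < k)%N -> Rabs (mu i / th) <= / (2 * N).
      move=> ik; rewrite /Rdiv Rabs_mult (Rabs_pos_eq (/ th)); last by left; apply: Rinv_0_lt_compat.
      apply: (Rmult_le_reg_r th) => //; rewrite Rmult_assoc Rinv_l; last lra.
      rewrite Rmult_1_r; apply: Rle_trans (Hmu2 i ik) _.
      have : (1 + 2) ^ k <= 3 ^ m.+1.
        by rewrite (_ : 1 + 2 = 3); [apply: Rle_pow; [lra|apply/leP; exact: ltnW]|lra].
      move=> H; apply: Rle_trans (_ : kap * 3 ^ m.+1 <= _); first by apply: Rmult_le_compat_l; lra.
      by apply: Req_le; rewrite /kap; field; lra.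
    exists (fun j => \rsum_(i < k) ((fun i : 'I_k => / (2 * N) + mu i / th) i * y i j)); split.
      apply: convex_pred_comb.
      - by move=> x z s Sx Sz Hs; apply: section_convex => //; lra.
      - by split; [rewrite /norm dot0l sqrt_0; lra|rewrite gap0; nra].
      - by move=> i; apply: Sy; apply: ltn_trans (ltn_ord i) kn.
      - by move=> i; have := Rabs_bounds (Hmu i (ltn_ord i)); lra.
      - apply: Rle_trans (_ : INR k * (/ N) <= _).
          apply: rsum_ord_le => i; have := Rabs_bounds (Hmu i (ltn_ord i)).
          by rewrite (_ : / (2 * N) = / N / 2); [lra|field; lra].
        have /le_INR kN : (k <= m.+1)%coq_nat by apply/leP; exact: ltnW.
        by apply: (Rmult_le_reg_r N); [lra|rewrite Rmult_assoc Rinv_l; rewrite -/N in kN; lra].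
    have -> : av = vadd ac (vsub av ac) by rewrite vaddBK.
    rewrite Hmu1; apply: vecP => j; rewrite /vadd /ac /lincomb /vscale rsum_mulr -rsum_add.
    by apply: eq_bigr => i _; field; lra.
  have Bbb : unit_ball (vadd x0 bb) by apply: unit_ball_shift; case: Sbb; lra.
  have gap_av : gap u x0 p av <= t * t / 8.
    have [_ H] := gap_scale p Hu Bx0 Bbb (s := th) ltac:(lra); rewrite -avE in H.
    by apply: Rle_trans H _; have := gap_ge0 Hp Bbb; case: Sbb => _; nra.
  have norm_av : norm av <= r / 2.
    rewrite avE normZ Rabs_pos_eq; last lra.
    by rewrite -thE; apply: Rmult_le_compat_l; [lra|case: Sbb].
  have b'r l : (l < k)%N -> Rabs (b' l) <= r / 2.
    move=> lk; have ln := ltn_trans lk kn.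
    have := orthonormal_dot_le av Hg ln; rewrite gav // lk; lra.
  pose A (l : nat) := if (l < k)%N then / (2 * ep) else / 2.
  pose Bc (l : nat) := (if (l < k)%N then - b' l / ep else - b' l) - dot (g l) p.
  pose ga (l : nat) := if (l < k)%N then b' l else 0.
  have Dnorm z : frame_box g ga r z -> norm z <= 2 * N * r.
    move=> Dz; rewrite (_ : 2 * N * r = N * (2 * r)); last by ring.
    apply: (norm_le_orthonormal_coord Hg); first lra.
    move=> l ln; have := Dz l ln; rewrite /ga; case: ifP => lk; last by rewrite Rminus_0_r; lra.
    have := b'r l lk; have := Rabs_triang (dot (g l) z - b' l) (b' l).
    by rewrite (_ : _ - _ + _ = dot (g l) z); [lra|ring].
  have DB z : frame_box g ga r z -> unit_ball (vadd x0 z).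
    by move=> Dz; apply: unit_ball_shift; have := Dnorm z Dz; lra.
  have [z [Dz Hmin Hsub]] := @perturbed_minimum _ u x0 g A Bc ga r Hu Hg r0 DB.
  (* After completing squares in the flat directions and absorbing the slope [p], the energy is
     [gap] plus these terms, up to a constant. *)
  pose h (l : nat) cc := if (l < k)%N then (cc - b' l) * (cc - b' l) / (2 * ep) else cc * cc / 2 - b' l * cc.
  pose H w := gap u x0 p w + \rsum_(l < m.+1) h l (dot (g l) w).
  pose const := u x0 - \rsum_(l < m.+1) (if (l < k)%N then b' l * b' l / (2 * ep) else 0).
  have HE w : perturbed u x0 g A Bc w = H w + const.
    rewrite /perturbed /H /const /gap.
    have -> : dot p w = \rsum_(l < m.+1) (dot (g l) w * dot p (g l)).
      by rewrite {1}(orthonormal_expand w Hg) dot_lincomb.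
    have E : \rsum_(l < m.+1) (A l * (dot (g l) w * dot (g l) w) + Bc l * dot (g l) w) +
      (\rsum_(l < m.+1) (dot (g l) w * dot p (g l)) +
       \rsum_(l < m.+1) (if (l < k)%N then b' l * b' l / (2 * ep) else 0)) =
       \rsum_(l < m.+1) h l (dot (g l) w).
      rewrite -!rsum_add; apply: eq_bigr => l _; rewrite /A /Bc /h (dotC p).
      by case: ifP => _; field; lra.
    by lra.
  have Dav : frame_box g ga r av.
    by move=> l ln; rewrite gav // /ga; case: ifP => _; rewrite Rminus_diag Rabs_R0; lra.
  have Hz8 : H z <= t * t / 8.
    have := Hmin av Dav; rewrite !HE => HH.
    suff : H av <= t * t / 8 by lra.
    rewrite /H big1 ?Rplus_0_r // => l _; rewrite /h gav //.
    by case: ifP => lk; rewrite ?lk -[RHS]/(IZR 0); field; lra.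
  have zt : norm z <= t by have := Dnorm z Dz; lra.
  have Bz := DB z Dz.
  have gz0 := gap_ge0 Hp Bz.
  have tt0 : 0 < t * t by nra.
  pose Tz w := \rsum_(l < m.+1) (if (l < k)%N then 0 else Rabs (b' l * dot (g l) w)).
  have Tsec w : section u x0 p t w -> Tz w <= t * t / 4.
    move=> Sw; apply: Rle_trans (_ : N * (t * t / (4 * N)) <= _); last by apply: Req_le; field; lra.
    apply: rsum_ord_le => l; have ln := ltn_ord l; case: ifP => lk.
      by left; apply: Rdiv_lt_0_compat; lra.
    rewrite -(omE l ln) Rabs_mult; apply: Rmult_le_compat; try exact: Rabs_pos.
      by apply: Hb2; rewrite leqNgt lk.
    by apply: Hle => //; rewrite leqnn.
  (* Outside the section the point is contracted until its height is at most [t * t]: [Tz] is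
     homogeneous of degree one and [gap] contracts at least as fast. *)
  have Tgap : t * t < gap u x0 p z -> Tz z <= gap u x0 p z / 4.
    move=> Hgz; pose s := t * t / gap u x0 p z.
    have s01 : 0 < s <= 1.
      split; first by apply: Rdiv_lt_0_compat; lra.
      by apply: (Rmult_le_reg_r (gap u x0 p z)); [lra|rewrite /s /Rdiv Rmult_assoc Rinv_l; lra].
    have sE : s * gap u x0 p z = t * t by rewrite /s; field; lra.
    have := Tsec (vscale s z); have -> : Tz (vscale s z) = s * Tz z.
      rewrite /Tz rsum_mulr; apply: eq_bigr => l _; case: ifP => _; first by ring.
      by rewrite dotZr -{2}(Rabs_pos_eq s); [rewrite -Rabs_mult; congr Rabs; ring|lra].
    move=> HH; apply: (Rmult_le_reg_l s); first lra.
    have : s * (gap u x0 p z / 4) = t * t / 4 by rewrite -sE; field.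
    move=> ->; apply: HH; split.
      by rewrite normZ Rabs_pos_eq; [have := norm_ge0 z; nra|lra].
    by have [_] := gap_scale p Hu Bx0 Bz (s := s) ltac:(lra); rewrite sE.
  have hlow l : (l < m.+1)%N -> h l (dot (g l) z) >= - (if (l < k)%N then 0 else Rabs (b' l * dot (g l) z)) +
      (if (l < k)%N then (dot (g l) z - b' l) * (dot (g l) z - b' l) / (2 * ep) else 0).
    move=> ln; rewrite /h; case: ifP => _; first lra.
    by have := Rle_abs (b' l * dot (g l) z); have := Rle_0_sqr (dot (g l) z); rewrite /Rsqr; lra.
  have ip : 0 < / (2 * ep) by apply: Rinv_0_lt_compat; lra.
  have Hlow l0 : (l0 < m.+1)%N -> gap u x0 p z - Tz z +
      (if (l0 < k)%N then (dot (g l0) z - b' l0) * (dot (g l0) z - b' l0) / (2 * ep) else 0) <= H z.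
    move=> l0n; pose G (l : nat) := if (l < k)%N then (dot (g l) z - b' l) * (dot (g l) z - b' l) / (2 * ep) else 0.
    have G0 (l : 'I_m.+1) : 0 <= G l.
      rewrite /G; case: ifP => _; last lra.
      by apply: Rmult_le_pos; [apply: Rle_0_sqr|lra].
    have HG : G l0 <= \rsum_(l < m.+1) G l.
      exact: (@rsum_ge_term _ (fun l : 'I_m.+1 => G l) (Ordinal l0n) G0).
    have : - Tz z + \rsum_(l < m.+1) G l <= \rsum_(l < m.+1) h l (dot (g l) z).
      rewrite (_ : - Tz z = -1 * Tz z); last by ring.
      rewrite /Tz rsum_mulr -rsum_add; apply: rsum_le => l _.
      by have := hlow l (ltn_ord l); rewrite /G; lra.
    by rewrite -/(G l0) /H; lra.
  have Tz_le : gap u x0 p z - Tz z >= - (t * t / 4) /\ (t * t < gap u x0 p z -> gap u x0 p z - Tz z > t * t / 2).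
    have [gt|gt] := Rle_lt_dec (gap u x0 p z) (t * t).
      by have := Tsec z (conj zt gt); split => *; lra.
    by have := Tgap gt; split => *; lra.
  (* On a flat face the energy is at least [t * t / 2 - t * t / 4]; on a thin face the point is
     outside the section and the energy exceeds [t * t / 2]. Both contradict the competitor's
     [t * t / 8]. *)
  have Hin l : (l < m.+1)%N -> Rabs (dot (g l) z - ga l) < r.
    move=> ln; apply: Rnot_le_lt => Hge; have := Hlow l ln; rewrite /ga in Hge.
    case: ifP Hge => lk Hge.
      have : t * t / 2 <= (dot (g l) z - b' l) * (dot (g l) z - b' l) / (2 * ep).
        rewrite -epE; apply: Rmult_le_compat_r; first lra.
        by move: Hge; rewrite /Rabs; case: Rcase_abs => *; nra.
      by case: Tz_le; lra.
    have : t * t < gap u x0 p z.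
      apply: Rnot_le_lt => Hgz; have := Hle z k l (conj zt Hgz).
      by rewrite leqNgt lk ln => /(_ isT); move: Hge; rewrite Rminus_0_r /r; lra.
    by case: Tz_le => _ H1 H2; have := H1 H2; lra.
  pose s := vscale (-1) (lincomb m.+1 (fun l => 2 * A l * dot (g l) z + Bc l) g).
  exists (vadd s (vadd x0 z)); split.
    exists (vadd x0 z); split => //.
      rewrite dist_sym distE (_ : vsub _ _ = z); first exact: Dnorm.
      by apply: vecP => i; rewrite /vsub /vadd; ring.
    rewrite (_ : vsub _ _ = s); first exact: Hsub.
    by apply: vecP => i; rewrite /vsub /vadd; ring.
  exists z; split => //.
    rewrite (_ : vsub _ _ = s); first exact: Hsub.
    by apply: vecP => i; rewrite /vsub /vadd; ring.
  move=> l; have ln := ltn_ord l.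
  have E : dot (g l) (vsub (vsub (vadd s (vadd x0 z)) p) x0) = dot (g l) s + dot (g l) z - dot (g l) p.
    by rewrite !dotBr !dotDr; ring.
  rewrite E /s dotZr (dot_orthonormal_lincomb _ Hg) // ln -b'E /A /Bc.
  by case: ifP => lk; rewrite ?lk; field; lra.
have -> : \rprod_(l < m.+1) (if (l < k)%N then 2 * (cs * r) else t * t / (4 * N * a l)) = box_vol (lo, hi).
  apply: eq_bigr => l _; rewrite /= /lo /hi; case: ifP => _; rewrite /sig; first by ring.
  by rewrite /om; field; have := T1 l (ltn_ord l); lra.
apply: Rle_trans Hvol _; apply: Rmult_le_compat_l => //.
by apply: pow_le; lra.
Qed.

(** Multiplying the mass bound by the volume bound cancels every [a l] with [l >= k]. Counting
    powers leaves [t ^ j <= C * r ^ j] with [j = m - k > 0] and [r = 3 * a k]. *)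
Lemma flag_step k c : (0 < k < m)%N -> 0 < c -> exists C, 0 < C /\ forall t g y a,
  0 < t < 1 - norm x0 -> t <= len -> t < rho0 -> flag (section u x0 p t) t e g y a ->
  (forall i, (i < k)%N -> c * t <= a i) -> t <= C * a k.
Proof.
move=> /andP[k0 km] c0.
have P3 : 1 <= 3 ^ m.+1 by apply: pow_R1_Rle; lra.
pose cs := c / (4 * N * 3 ^ m.+1).
have cs0 : 0 < cs by apply: Rdiv_lt_0_compat => //; nra.
pose ka := Rmin (2 * cs * c) (/ (4 * N)).
have ka0 : 0 < ka by apply: Rmin_glb_lt; [nra|apply: Rinv_0_lt_compat; lra].
pose c1 := 2 * cs * len * ka ^ m.
have c10 : 0 < c1.
  by apply: Rmult_lt_0_compat; [nra|apply: pow_lt].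
pose C2 := (4 * 1 * N) ^ m.+1 * (M * (2 * N) ^ m) * CV.
have C20 : 0 < C2.
  apply: Rmult_lt_0_compat => //; apply: Rmult_lt_0_compat; first by apply: pow_lt; lra.
  by apply: Rmult_lt_0_compat => //; apply: pow_lt; lra.
pose C3 := 1 + C2 / c1.
have C3p : 0 < C2 / c1 by apply: Rdiv_lt_0_compat.
exists (6 * N + 3 * C3); split; first by rewrite /C3; lra.
move=> t g y a t0 tl trho Hflag Hc.
have [_ _ _ _ [T1 _ _ _] _] := Hflag.
have ak0 : 0 < a k by apply: T1; rewrite ltnS ltnW.
pose r := 3 * a k; have r0 : 0 < r by rewrite /r; lra.
(* If the ball of radius [2 * N * r] is larger than the section, [a k] is already comparable to
   [t]. *)
have [Hbig|Hsmall] := Rlt_le_dec t (2 * N * r).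
  by move: Hbig; rewrite /r /C3; nra.
suff : t <= C3 * r by rewrite /r; nra.
have H1 := @thin_box_volume k c t g y a _ c0 t0 tl trho Hflag Hc Hsmall.
have {}H1 := H1 ltac:(by rewrite k0 ltnW).
have H2 := flag_volume t0 tl Hflag.
rewrite -/cs -/r in H1.
(* The factor [len / t] at [l = 0] is the surplus from the contact segment; without it the powers of
   [t] would balance with one factor missing. *)
pose w (l : nat) := if l == 0%N then 2 * cs * len / t else ka.
have H3 : \rprod_(l < m.+1) (w l * (if (l < k)%N then r * t else t * t)) <=
    \rprod_(l < m.+1) ((if (l < k)%N then 2 * (cs * r) else t * t / (4 * N * a l)) * stretched a l).
  apply: rprod_le => l _; rewrite /w /stretched.
  have al := T1 l (ltn_ord l).
  have [l0|l0] := eqVneq (val l) 0%N; rewrite /= in l0.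
    rewrite l0 k0 /=; split.
      by apply: Rmult_le_pos; [left; apply: Rdiv_lt_0_compat; nra|nra].
    by apply: Req_le; field; lra.
  rewrite ?(negbTE l0); split; first by apply: Rmult_le_pos; [lra|case: ifP => _; nra].
  case: ifP => lk.
    have ka1 : ka <= 2 * cs * c by apply: Rmin_l.
    have := Hc l lk => H.
    apply: Rle_trans (_ : 2 * cs * c * (r * t) <= _); first by apply: Rmult_le_compat_r; nra.
    rewrite (_ : 2 * cs * c * (r * t) = 2 * (cs * r) * (c * t)); last by ring.
    by apply: Rmult_le_compat_l => //; nra.
  have ka1 : ka <= / (4 * N) by apply: Rmin_r.
  apply: Rle_trans (_ : / (4 * N) * (t * t) <= _); first by apply: Rmult_le_compat_r; nra.
  by apply: Req_le; field; lra.
have H4 : \rprod_(l < m.+1) ((if (l < k)%N then 2 * (cs * r) else t * t / (4 * N * a l)) * stretched a l)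
    <= (4 * 1 * N) ^ m.+1 * (M * (2 * N * r) ^ m) * (CV * t ^ m.+1).
  rewrite rprod_mul; apply: Rmult_le_compat => //; apply: rprod_ge0 => l _; have := T1 l (ltn_ord l) => al.
    case: ifP => _; first by nra.
    by apply: Rmult_le_pos; [nra|left; apply: Rinv_0_lt_compat; nra].
  by rewrite /stretched; case: ifP => _; lra.
clearbody r; have := Rle_trans _ _ _ H3 H4; rewrite rprod_mul rprod_two_values; last exact: ltnW (ltnW _).
have -> : \rprod_(l < m.+1) w l = 2 * cs * len / t * ka ^ m.
  by rewrite big_ord_recl -rprod_const.
have [j [Em j0]] : exists j, m = (k + j)%N /\ (0 < j)%N.
  by exists (m - k)%N; rewrite subnKC ?subn_gt0 // ltnW.
have -> : (m.+1 - k)%N = j.+1 by rewrite Em -addnS addKn.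
rewrite !Rpow_mult_distr; rewrite (_ : t ^ m.+1 = t ^ k * t ^ j * t); last first.
  by rewrite Em -addnS pow_add /=; ring.
rewrite (_ : r ^ m = r ^ k * r ^ j); last by rewrite Em pow_add.
have tk : 0 < t ^ k by apply: pow_lt; lra.
have tj : 0 < t ^ j by apply: pow_lt; lra.
have rk : 0 < r ^ k by apply: pow_lt.
have rj : 0 < r ^ j by apply: pow_lt.
move=> H5.
have {}H5 : c1 * t ^ j <= C2 * r ^ j.
  apply: (Rmult_le_reg_l (r ^ k * t ^ k * t ^ j * t)); first by do 3 (apply: Rmult_lt_0_compat; last lra).
  apply: Rle_trans (_ : 2 * cs * len / t * ka ^ m * (r ^ k * t ^ k * (t ^ j.+1 * t ^ j.+1)) <= _).
    by apply: Req_le; rewrite /c1 /=; field; lra.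
  apply: Rle_trans H5 _; apply: Req_le.
  by rewrite /C2 !Rpow_mult_distr; ring.
(* Since [C3 >= 1], the power [C3 ^ j] dominates [C3], which avoids taking a [j]-th root. *)
apply: Rnot_lt_le => Hlt.
have H6 : (C3 * r) ^ j < t ^ j.
  have C30 : 0 <= C3 * r by rewrite /C3; nra.
  case: (j) j0 => // j' _; elim: j' => [|j' IH]; first by rewrite !pow_1.
  rewrite -[(_ * _) ^ _]/((C3 * r) * (C3 * r) ^ j'.+1) -[t ^ _]/(t * t ^ j'.+1).
  by apply: Rmult_le_0_lt_compat => //; apply: pow_le.
have H7 : C3 * r ^ j <= (C3 * r) ^ j.
  rewrite Rpow_mult_distr; apply: Rmult_le_compat_r; first lra.
  case: (j) j0 => // j' _; rewrite -[X in X <= _]Rmult_1_r.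
  by apply: Rmult_le_compat_l; [rewrite /C3; lra|apply: pow_R1_Rle; rewrite /C3; lra].
have : c1 * (C3 * r ^ j) < c1 * t ^ j by apply: Rmult_lt_compat_l; lra.
rewrite (_ : c1 * (C3 * r ^ j) = (c1 + C2) * r ^ j); last by rewrite /C3; field; lra.
by nra.
Qed.

(** Induction on [k], starting from the exact value [a 0 = t]. Only the last direction [m] escapes,
    because [flag_step] requires [k < m]. *)
Lemma flat_directions k : (0 < k <= m)%N -> exists c, 0 < c /\ forall t g y a,
  0 < t < 1 - norm x0 -> t <= len -> t < rho0 -> flag (section u x0 p t) t e g y a ->
  forall i, (i < k)%N -> c * t <= a i.
Proof.
elim: k => // k IH /andP[_ km]; case: (posnP k) => [->|k0].
  by exists 1; split => [|t g y a t0 tl tr [_ _ a0 _ _ _] [|i] // _]; [lra|rewrite a0; lra].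
have [c [c0 Hc]] := IH ltac:(by rewrite k0 ltnW).
have [C [C0 HC]] := @flag_step k c ltac:(by rewrite k0) c0.
exists (Rmin c (/ C)); split; first by apply: Rmin_glb_lt => //; apply: Rinv_0_lt_compat.
move=> t g y a t0 tl tr Hf i; rewrite ltnS leq_eqVlt => /orP[/eqP ->|ik].
  have := HC t g y a t0 tl tr Hf (Hc t g y a t0 tl tr Hf) => H.
  apply: Rle_trans (_ : / C * t <= _); first by apply: Rmult_le_compat_r; [lra|apply: Rmin_r].
  by apply: (Rmult_le_reg_l C) => //; rewrite -Rmult_assoc Rinv_r; lra.
apply: Rle_trans (_ : c * t <= _); first by apply: Rmult_le_compat_r; [lra|apply: Rmin_l].
exact: Hc Hf _ ik.
Qed.

Lemma flat_product : (0 < m)%N -> exists c, 0 < c /\ forall t g y a,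
  0 < t < 1 - norm x0 -> t <= len -> t < rho0 -> flag (section u x0 p t) t e g y a ->
  (forall i, (i < m)%N -> c * t <= a i) /\ c * t ^ m <= t * \rprod_(i < m) stretched a i.
Proof.
move=> m0; have [c [c0 Hc]] := @flat_directions m ltac:(by rewrite m0 leqnn).
have c'0 : 0 < len * c ^ m.-1 by apply: Rmult_lt_0_compat => //; apply: pow_lt.
exists (Rmin c (len * c ^ m.-1)); split; first exact: Rmin_glb_lt.
move=> t g y a t0 tl tr Hf; have H := Hc t g y a t0 tl tr Hf; split.
  move=> i im; apply: Rle_trans (H i im).
  by apply: Rmult_le_compat_r; [lra|apply: Rmin_l].
have tm : 0 < t ^ m by apply: pow_lt; lra.
apply: Rle_trans (_ : len * c ^ m.-1 * t ^ m <= _); first by apply: Rmult_le_compat_r; [lra|apply: Rmin_r].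
have -> : \rprod_(i < m) stretched a i = len * \rprod_(i < m.-1) stretched a i.+1.
  by rewrite -[in LHS](prednK m0) (rprod_recl _ (stretched a)).
have -> : t ^ m = t * t ^ m.-1 by rewrite -[in LHS](prednK m0).
rewrite (_ : len * c ^ m.-1 * (t * t ^ m.-1) = t * (len * (c * t) ^ m.-1)); last first.
  by rewrite Rpow_mult_distr; ring.
apply: Rmult_le_compat_l; first lra.
apply: Rmult_le_compat_l; first lra.
rewrite -rprod_const; apply: rprod_le => i _; rewrite /stretched /=; split; first by nra.
by apply: H; rewrite -[X in (_ < X)%N](prednK m0) ltnS.
Qed.

End FlagVolume.

(** * Blow-up of the mass at singular points *)

(** Failure of strict convexity concerns every supporting plane, so a contact segment exists for
    whichever subgradient is chosen later, in particular for a midpoint of two. *)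
Lemma singular_contact n (u : Rn n -> R) x0 p : unit_ball x0 ->
  ~ strictly_convex_at unit_ball u x0 -> subgrad unit_ball u x0 p ->
  exists e len, [/\ norm e = 1, 0 < len, unit_ball (vadd x0 (vscale len e)) &
    gap u x0 p (vscale len e) <= 0].
Proof.
move=> Bx0 Hs Hp; apply: NNPP => H; apply: Hs; exists p; split => // y By Hy i.
apply: NNPP => Hi; apply: H.
pose w := vsub y x0.
have w0 : w <> vzero by move=> /(congr1 (fun f => f i)); rewrite /w /vsub /vzero; lra.
have nw := norm_gt0 w0.
exists (vscale (/ norm w) w), (norm w).
have E : vscale (norm w) (vscale (/ norm w) w) = w.
  by apply: vecP => j; rewrite /vscale; field; lra.
rewrite E vaddBK /gap vaddBK Hy -/w; split => //; last lra.
rewrite normZ Rabs_pos_eq; last by left; apply: Rinv_0_lt_compat.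
by rewrite Rinv_l; lra.
Qed.

Lemma min_pos_list (r : seq R) : (forall x, List.In x r -> 0 < x) ->
  exists t, 0 < t /\ forall x, List.In x r -> t <= x.
Proof.
elim: r => [|x r IH] H; first by exists 1; split => //; lra.
have [t [t0 Ht]] := IH ltac:(by move=> y Hy; apply: H; right).
exists (Rmin t x); split; first by apply: Rmin_glb_lt => //; apply: H; left.
by move=> y [<-|/Ht Hy]; [apply: Rmin_r|apply: Rle_trans (Rmin_l _ _) Hy].
Qed.

Section Blowup.
Variables (m : nat) (u : Rn m.+1 -> R) (x0 : Rn m.+1) (CV M rho0 : R).
Hypotheses (m0 : (0 < m)%N) (Hu : convex_on unit_ball u) (CV0 : 0 < CV).
Hypothesis HV : forall x0 p g y d tau, unit_ball x0 -> subgrad unit_ball u x0 p ->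
    orthonormal m.+1 g -> triangular m.+1 g y d 2 -> 0 < tau ->
    (forall i, (i < m.+1)%N -> unit_ball (vadd x0 (y i)) /\
       u (vadd x0 (y i)) <= u x0 + dot p (y i) + tau * tau) ->
    \rprod_(i < m.+1) d i <= CV * tau ^ m.+1.
Hypotheses (Bx0 : unit_ball x0) (Hsing : ~ strictly_convex_at unit_ball u x0).
Hypotheses (M0 : 0 < M) (r0 : 0 < rho0).
Hypothesis Hmass : forall rho, 0 < rho < rho0 -> exists B S,
  [/\ box_cover B (grad_image u x0 rho), infinite_sum (fun k => box_vol (B k)) S & S <= M * rho ^ m].

Let nx0 : norm x0 < 1. Proof. by apply/unit_ballE. Qed.

(** With all other widths comparable to [t], the volume bound gives [a m <= C3 * (t * t)]. A step of
    three times this length along [g m] leaves the section, so [gap] exceeds [t * t], which is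
    proportional to the step. *)
Lemma slope_gap_bounded p : subgrad unit_ball u x0 p -> exists C, 0 < C /\
  forall T, 0 < T -> exists z, [/\ 0 < norm z <= T, unit_ball (vadd x0 z) & norm z <= C * gap u x0 p z].
Proof.
move=> Hp; have [e [len [He len0 Be ge0]]] := singular_contact Bx0 Hsing Hp.
have [c [c0 Hc]] := flat_product Hu CV0 HV Bx0 Hp He len0 Be ge0 M0 Hmass m0.
pose C3 := CV / c; have C30 : 0 < C3 by apply: Rdiv_lt_0_compat.
exists (3 * C3); split; first lra.
move=> T T0.
have [|t [t0 Ht]] := @min_pos_list [:: (1 - norm x0) / 2; len; rho0 / 2; / (3 * C3); T].
  have i0 : 0 < / (3 * C3) by apply: Rinv_0_lt_compat; lra.
  by move=> x /= H; repeat case: H => H; lra.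
have t1 : t <= (1 - norm x0) / 2 by apply: Ht; left.
have t2 : t <= len by apply: Ht; right; left.
have t3 : t <= rho0 / 2 by apply: Ht; do 2 right; left.
have t4 : t <= / (3 * C3) by apply: Ht; do 3 right; left.
have t5 : t <= T by apply: Ht; do 4 right; left.
have [g [y [a Hf]]] := section_flag Hu Bx0 (ltn0Sn m) He len0 Be ge0 (t := t) ltac:(lra) t2.
have [Hflat Hprod] := Hc t g y a ltac:(lra) t2 ltac:(lra) Hf.
have [Hg _ _ _ [T1 _ _ _] Hle] := Hf.
have am : a m <= C3 * (t * t).
  have := flag_volume HV Bx0 Hp He len0 Be ge0 (t := t) ltac:(lra) t2 Hf.
  rewrite rprod_recr {2}/stretched (gtn_eqF m0) => H.
  have tm : 0 < t ^ m by apply: pow_lt.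
  have am0 := T1 m (ltnSn m).
  apply: (Rmult_le_reg_l (c * t ^ m)); first by nra.
  apply: Rle_trans (_ : t * \rprod_(i < m) stretched len a i * a m <= _).
    by apply: Rmult_le_compat_r; lra.
  apply: Rle_trans (_ : t * (CV * t ^ m.+1) <= _); first by rewrite Rmult_assoc; apply: Rmult_le_compat_l; lra.
  by apply: Req_le; rewrite /C3 /=; field; lra.
pose z := vscale (3 * C3 * (t * t)) (g m).
have nz : norm z = 3 * C3 * (t * t).
  by rewrite normZ (orthonormal_norm Hg (ltnSn m)) Rabs_pos_eq; nra.
have nzt : norm z <= t.
  rewrite nz -Rmult_assoc -[X in _ <= X]Rmult_1_l; apply: Rmult_le_compat_r; first lra.
  by apply: Rle_trans (_ : 3 * C3 * / (3 * C3) <= _); [apply: Rmult_le_compat_l; lra|rewrite Rinv_r; lra].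
exists z; split; [|by apply: unit_ball_shift; lra|].
  by split; [rewrite nz; apply: Rmult_lt_0_compat; nra|lra].
have gz : t * t < gap u x0 p z.
  apply: Rnot_le_lt => Hgz; have := Hle z m m (conj nzt Hgz); rewrite leqnn ltnSn => /(_ isT).
  rewrite dotZr Hg // eqxx Rmult_1_r Rabs_pos_eq; last by nra.
  by have : 0 < C3 * (t * t) by [apply: Rmult_lt_0_compat; nra]; lra.
rewrite nz; have := Rmult_le_compat_l (3 * C3) _ _ ltac:(lra) (Rlt_le _ _ gz); lra.
Qed.

(** At points [z] where [gap] is at least [|z| / C], subgradients differ from [p] by at least
    [1 / C]; a limit of them at [x0] is still different from [p]. *)
Lemma another_subgrad p : subgrad unit_ball u x0 p ->
  exists q, subgrad unit_ball u x0 q /\ 0 < norm (vsub q p).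
Proof.
move=> Hp; have [C [C0 HC]] := slope_gap_bounded Hp.
have ik (k : nat) : 0 < / (INR k + 1) by apply: Rinv_0_lt_compat; have := pos_INR k; lra.
have /choice_fun[zq Hzq] : forall k : nat, exists zq : Rn m.+1 * Rn m.+1,
    [/\ norm (fst zq) <= / (INR k + 1), subgrad unit_ball u (vadd x0 (fst zq)) (snd zq) &
     / C <= norm (vsub (snd zq) p)].
  move=> k; have [z [[z0 zk] Bz gz]] := HC _ (ik k).
  have [q Hq] := subgrad_exists Hu Bz; exists (z, q); split => //=.
  have := Hq x0 Bx0; rewrite (_ : vsub x0 (vadd x0 z) = vscale (-1) z); last first.
    by apply: vecP => i; rewrite /vsub /vadd /vscale; ring.
  rewrite dotZr => H.
  have := cauchy_schwarz (vsub q p) z => /Rabs_bounds[_]; rewrite dotBl => H2.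
  have H3 : gap u x0 p z <= norm (vsub q p) * norm z by rewrite /gap; lra.
  have H4 : norm z <= C * norm (vsub q p) * norm z.
    by apply: Rle_trans gz _; rewrite Rmult_assoc; apply: Rmult_le_compat_l; lra.
  apply: (Rmult_le_reg_l C) => //; rewrite Rinv_r; last lra.
  by apply: (Rmult_le_reg_r (norm z)) => //; lra.
have [||q [Hq Hcl]] := @subgrad_limit _ u Hu x0 (fun k => vadd x0 (fst (zq k))) (fun k => snd (zq k)) Bx0.
- by move=> k; case: (Hzq k).
- move=> e e0; have [K HK] := inv_succ_lt e0; exists K => k /HK H i.
  rewrite /vadd (_ : _ - _ = fst (zq k) i); last by ring.
  by apply: Rle_trans (norm_coord _ i) _; case: (Hzq k) => A _ _; lra.
exists q; split => //; apply: Rnot_le_lt => Hle0.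
have iC : 0 < / C by apply: Rinv_0_lt_compat.
have N0 : 0 < INR m.+1 by rewrite S_INR; have := pos_INR m; lra.
have [k [_ Hk]] := Hcl (/ C / (2 * INR m.+1)) ltac:(apply: Rdiv_lt_0_compat; lra) 0%N.
have [_ _] := Hzq k.
rewrite (_ : vsub (snd (zq k)) p = vadd (vsub (snd (zq k)) q) (vsub q p)); last first.
  by apply: vecP => i; rewrite /vadd /vsub; ring.
have := norm_triang (vsub (snd (zq k)) q) (vsub q p).
have := @norm_le_coord _ (vsub (snd (zq k)) q) _ _ Hk => /(_ ltac:(left; apply: Rdiv_lt_0_compat; lra)).
rewrite (_ : INR m.+1 * (/ C / (2 * INR m.+1)) = / C / 2); last by field; lra.
by lra.
Qed.

Lemma bounded_mass_absurd : False.
Proof.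
have [p Hp] := subgrad_exists Hu Bx0.
have [q [Hq nq]] := another_subgrad Hp; pose w := vsub q p.
have [p1 [Hp1 Hexp]] := subgrad_exposed Hu w Bx0.
have qw : dot q w <= dot p1 w.
  apply: le_epsilon => om om0; have [s0 [s00 Hs]] := Hexp om om0.
  have [Bs Us] := Hs s0 ltac:(lra).
  have := Hq _ Bs; rewrite (_ : vsub (vadd x0 _) x0 = vscale s0 w); last first.
    by apply: vecP => i; rewrite /vsub /vadd; ring.
  rewrite dotZr => H; apply: (Rmult_le_reg_l s0) => //; lra.
(* As [p1] dominates [q] in direction [w], [b] is at least [|w|^2]. *)
pose d := vsub p1 p; pose b := dot d w.
have b0 : 0 < b.
  have : dot w w <= b by rewrite /b /d dotBl {1}/w dotBl; lra.
  have : 0 < dot w w by rewrite -norm_sqr; have : 0 < norm w by []; nra.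
  lra.
(* The gap for [pm] is the mean of the nonnegative gaps for [p] and [p1]. It thus controls both of
   them, and also their difference [dot d z], which is therefore [O(t^2)] on the section. *)
pose pm : Rn m.+1 := vadd (vscale (1 / 2) p) (vscale (1 / 2) p1).
have Hpm : subgrad unit_ball u x0 pm.
  by move=> y By; rewrite dotDl !dotZl; have := Hp y By; have := Hp1 y By; lra.
have gapE z : gap u x0 pm z = (gap u x0 p z + gap u x0 p1 z) / 2.
  by rewrite /gap dotDl !dotZl; field.
have gapd z : dot d z = gap u x0 p z - gap u x0 p1 z by rewrite /gap /d dotBl; ring.
have [e [len [He len0 Be ge0]]] := singular_contact Bx0 Hsing Hpm.
have [c [c0 Hc]] := flat_product Hu CV0 HV Bx0 Hpm He len0 Be ge0 M0 Hmass m0.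
have nd0 := norm_ge0 d; have nw0 := norm_ge0 w.
have nd : 0 < norm d.
  apply: Rnot_le_lt => H; have := cauchy_schwarz d w => /Rabs_bounds[_]; rewrite -/b.
  by have -> : norm d = 0 by [lra]; lra.
pose C6 := CV * 2 ^ m.+1 / c.
have C60 : 0 < C6.
  by apply: Rdiv_lt_0_compat => //; apply: Rmult_lt_0_compat => //; apply: pow_lt; lra.
(* The new edge is [s w] with [s = K * (t * t)]. The volume bound will give
   [s * b <= 2 * norm d * C6 * (t * t)], and this [K] violates it. *)
pose K := 2 * norm d * C6 / b + 1.
have K0 : 0 < K.
  by have : 0 < 2 * norm d * C6 / b by [apply: Rdiv_lt_0_compat; nra]; rewrite /K; lra.
have [s0 [s00 Hs0]] := Hexp (/ K) (Rinv_0_lt_compat _ K0).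
have P3 : 0 < 3 ^ m by apply: pow_lt; lra.
(* The flat part of [s w] contributes at most [(C7 - 1) * (s * t)] to [dot d (s w) = s * b]; this is
   less than half once [C7 * t <= b / 2]. *)
pose C7 := INR m * (norm w / c * 3 ^ m * 2) + 1.
have C70 : 1 <= C7.
  suff : 0 <= INR m * (norm w / c * 3 ^ m * 2) by rewrite /C7; lra.
  apply: Rmult_le_pos; first exact: pos_INR.
  apply: Rmult_le_pos; last lra; apply: Rmult_le_pos; last lra.
  by apply: Rmult_le_pos => //; left; apply: Rinv_0_lt_compat.
pose nw1 := norm w + 1.
have [|t [t0 Ht]] := @min_pos_list [:: (1 - norm x0) / 2; len; rho0 / 2; 1; s0 / K; c / (K * nw1);
    len / (K * nw1); b / (2 * C7)].
  have A1 : 0 < s0 / K by apply: Rdiv_lt_0_compat.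
  have A2 : 0 < c / (K * nw1) by apply: Rdiv_lt_0_compat => //; rewrite /nw1; nra.
  have A3 : 0 < len / (K * nw1) by apply: Rdiv_lt_0_compat => //; rewrite /nw1; nra.
  have A4 : 0 < b / (2 * C7) by apply: Rdiv_lt_0_compat; lra.
  by move=> x /= H; repeat case: H => H; lra.
have t1 : t <= (1 - norm x0) / 2 by apply: Ht; left.
have t2 : t <= len by apply: Ht; right; left.
have t3 : t <= rho0 / 2 by apply: Ht; do 2 right; left.
have t4 : t <= 1 by apply: Ht; do 3 right; left.
have t5 : K * t <= s0.
  have := Ht (s0 / K) ltac:(by do 4 right; left).
  by move=> /(Rmult_le_compat_l K _ _ (Rlt_le _ _ K0)); rewrite (_ : K * (s0 / K) = s0) //; field; lra.
have Kn0 : 0 < K * nw1 by rewrite /nw1; nra.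
have t6 : K * nw1 * t <= c.
  have := Ht (c / (K * nw1)) ltac:(by do 5 right; left).
  move=> /(Rmult_le_compat_l (K * nw1) _ _ (Rlt_le _ _ Kn0)).
  by rewrite (_ : K * nw1 * (c / (K * nw1)) = c) //; field; rewrite /nw1; lra.
have t7 : K * nw1 * t <= len.
  have := Ht (len / (K * nw1)) ltac:(by do 6 right; left).
  move=> /(Rmult_le_compat_l (K * nw1) _ _ (Rlt_le _ _ Kn0)).
  by rewrite (_ : K * nw1 * (len / (K * nw1)) = len) //; field; rewrite /nw1; lra.
have t8 : C7 * t <= b / 2.
  have := Ht (b / (2 * C7)) ltac:(by do 7 right; left).
  move=> /(Rmult_le_compat_l C7 _ _ (Rlt_le _ _ (Rlt_le_trans _ _ _ Rlt_0_1 C70))).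
  by rewrite (_ : C7 * (b / (2 * C7)) = b / 2) //; field; lra.
have [g [y [a Hf]]] := section_flag Hu Bx0 (ltn0Sn m) He len0 Be ge0 (t := t) ltac:(lra) t2.
have [Hflat Hprod] := Hc t g y a ltac:(lra) t2 ltac:(lra) Hf.
have [Hg g0 a0 Sy T Hle] := Hf; have [T1 T2 T3 T4] := T.
pose s := K * (t * t).
have tt0 : 0 < t * t by nra.
have s_pos : 0 < s by apply: Rmult_lt_0_compat.
have sw_le : s * norm w <= c * t.
  rewrite /s; apply: Rle_trans (_ : K * nw1 * t * t <= _); last by apply: Rmult_le_compat_r; lra.
  have -> : K * nw1 * t * t = s * norm w + s by rewrite /s /nw1; ring.
  by rewrite -/s; lra.
have sw_len : s * norm w <= len.
  apply: Rle_trans t7; rewrite /s.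
  have A : K * (t * t) <= K * t by apply: Rmult_le_compat_l; [lra|nra].
  have : K * (t * t) * norm w <= K * t * norm w by apply: Rmult_le_compat_r.
  have : 0 < K * t by apply: Rmult_lt_0_compat.
  by rewrite /nw1; lra.
have s_le : s <= s0.
  apply: Rle_trans t5; rewrite /s; apply: Rmult_le_compat_l; [lra|nra].
have [Bs Us] := Hs0 s ltac:(lra).
have gap_s : gap u x0 p1 (vscale s w) <= t * t.
  have E : s * / K = t * t by rewrite /s; field; lra.
  by move: Us; rewrite /gap dotZr; lra.
have ballz z : norm z <= t -> unit_ball (vadd x0 z) by move=> ?; apply: unit_ball_shift; lra.
have gap1_le z : unit_ball (vadd x0 z) -> gap u x0 p1 z <= 2 * gap u x0 pm z.
  by move=> Bz; have := gap_ge0 Hp Bz; rewrite gapE; lra.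
have dz_le z : unit_ball (vadd x0 z) -> Rabs (dot d z) <= 2 * gap u x0 pm z.
  move=> Bz; have := gap_ge0 Hp Bz; have := gap_ge0 Hp1 Bz; rewrite gapE gapd => *.
  by apply: Rabs_le; lra.
pose dl := Rabs (dot (g m) (vscale s w)).
have gsw l : (l < m.+1)%N -> Rabs (dot (g l) (vscale s w)) <= s * norm w.
  move=> ln; apply: Rle_trans (orthonormal_dot_le _ Hg ln) _.
  by rewrite normZ Rabs_pos_eq; lra.
(* The last frame vector captures a fixed proportion of [s w]: the slope difference [d] is
   almost orthogonal to the flat directions but not to [w]. *)
have dl_ge : s * b / 2 <= dl * norm d.
  pose z := lincomb m (fun l => dot (g l) (vscale s w)) g.
  have zE : vscale s w = vadd z (vscale (dot (g m) (vscale s w)) (g m)).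
    by rewrite {1}(orthonormal_expand (vscale s w) Hg) lincombS.
  pose cc := s * norm w / (c * t).
  have ct : 0 < c * t by nra.
  have cc0 : 0 <= cc by apply: Rmult_le_pos; [nra|left; apply: Rinv_0_lt_compat].
  have ccE : cc * (c * t) = s * norm w by rewrite /cc; field; lra.
  have [||mu [muE Hmu]] := @triangular_solve _ m g y a 2 cc z Hg (leqnSn m)
    (triangularW (leqnSn m) T) ltac:(lra) cc0.
  - by move=> l /andP[ml ln]; rewrite (dot_orthonormal_lincomb _ Hg) // ltnNge ml.
  - move=> l lm; rewrite (dot_orthonormal_lincomb _ Hg) //; last exact: ltnW.
    rewrite lm; apply: Rle_trans (gsw l (ltnW lm)) _; rewrite -ccE.
    by apply: Rmult_le_compat_l => //; apply: Hflat.
  have dz : Rabs (dot d z) <= INR m * (cc * 3 ^ m * (2 * (t * t))).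
    rewrite muE dot_lincomb; apply: Rle_trans (rsum_abs _ _ _) _.
    apply: rsum_ord_le => i; have im := ltn_ord i; rewrite Rabs_mult.
    have [ny gy] := Sy i (ltnW im).
    apply: Rmult_le_compat; try exact: Rabs_pos.
      by have := Hmu i im; rewrite (_ : 1 + 2 = 3); [|lra].
    by apply: Rle_trans (dz_le _ (ballz _ ny)) _; lra.
  have E2 : INR m * (cc * 3 ^ m * (2 * (t * t))) = (C7 - 1) * (s * t).
    by rewrite /C7 /cc; field; lra.
  have E3 : dot d (vscale s w) = s * b by rewrite dotZr.
  have E4 : s * b <= Rabs (dot d z) + dl * norm d.
    rewrite -E3 {1}zE dotDr dotZr; apply: Rplus_le_compat; first exact: Rle_abs.
    apply: Rle_trans (Rle_abs _) _; rewrite Rabs_mult.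
    apply: Rmult_le_compat_l; first exact: Rabs_pos.
    by rewrite dotC; exact: orthonormal_dot_le Hg (ltnSn m).
  have E5 : s * (C7 * t) <= s * (b / 2) by apply: Rmult_le_compat_l; lra.
  have E6 : 0 < s * t by apply: Rmult_lt_0_compat.
  by rewrite E2 in dz; lra.
have dl0 : 0 < dl.
  apply: Rnot_le_lt => Hn; have sb : 0 < s * b by apply: Rmult_lt_0_compat.
  by have : dl * norm d <= 0 * norm d by [apply: Rmult_le_compat_r]; lra.
(* The last vertex is replaced by [s w], whose gap for [p1] is at most [t * t]. All vertices are
   measured with the slope [p1] at [tau = 2 * t], which covers the factor 2 lost in passing from
   [pm] to [p1]. *)
pose y' (i : nat) := if i == 0%N then vscale len e else if i == m then vscale s w else y i.
pose d' (i : nat) := if i == m then dl else stretched len a i.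
have Hvol : \rprod_(i < m.+1) d' i <= CV * (2 * t) ^ m.+1.
  apply: (@HV x0 p1 g y') => //; last 1 first.
  - move=> i im; have key z : unit_ball (vadd x0 z) -> gap u x0 p1 z <= 2 * t * (2 * t) ->
        unit_ball (vadd x0 z) /\ u (vadd x0 z) <= u x0 + dot p1 z + 2 * t * (2 * t).
      by move=> Bz; rewrite /gap; split => //; lra.
    rewrite /y'; case: eqP => _.
      by apply: key => //; apply: Rle_trans (gap1_le _ Be) _; nra.
    case: eqP => _; first by apply: key => //; nra.
    have [ny gy] := Sy i im; apply: key; first exact: ballz.
    by apply: Rle_trans (gap1_le _ (ballz _ ny)) _; nra.
  - split.
    + move=> i im; rewrite /d' /stretched; case: eqP => _ //; case: eqP => _ //; exact: T1.
    + move=> i im; rewrite /d' /y' /stretched; case: (i =P 0%N) => [->|_].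
        by rewrite (ltn_eqF m0) dotZr g0 -norm_sqr He !Rmult_1_r Rabs_pos_eq //; lra.
      by case: eqP => [->|_]; [|exact: T2].
    + move=> i l im /andP[il ln]; rewrite /y'; case: (i =P 0%N) => [i0|_].
        by rewrite dotZr -g0 Hg // (gtn_eqF (leq_ltn_trans (leq0n i) il)); ring.
      case: eqP => [E|_]; last by apply: T3; rewrite ?il.
      by move: il ln; rewrite E ltnS => A B; have := leq_trans A B; rewrite ltnn.
    + move=> i l im li; rewrite /y' /d' /stretched.
      have lm : (l < m)%N by apply: leq_trans li _.
      rewrite (ltn_eqF lm) (gtn_eqF (leq_ltn_trans (leq0n l) li)).
      case: eqP => [_|_].
        apply: Rle_trans (gsw l (ltnW lm)) _; case: eqP => _; first lra.
        by have := Hflat l lm; nra.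
      have [ny _] := Sy i im.
      case: eqP => [->|_]; last exact: T4.
      by have := orthonormal_dot_le (y i) Hg (ltn0Sn m); lra.
  - lra.
have E1 : \rprod_(i < m.+1) d' i = \rprod_(i < m) stretched len a i * dl.
  rewrite rprod_recr {2}/d' eqxx; congr (_ * _); apply: eq_bigr => i _.
  by rewrite /d' (ltn_eqF (ltn_ord i)).
rewrite E1 in Hvol.
have tm : 0 < t ^ m by apply: pow_lt.
have dl_le : dl <= C6 * (t * t).
  apply: (Rmult_le_reg_l (c * t ^ m)); first by nra.
  apply: Rle_trans (_ : t * \rprod_(i < m) stretched len a i * dl <= _).
    by apply: Rmult_le_compat_r; lra.
  apply: Rle_trans (_ : t * (CV * (2 * t) ^ m.+1) <= _); first by rewrite Rmult_assoc; apply: Rmult_le_compat_l; lra.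
  by apply: Req_le; rewrite /C6 Rpow_mult_distr /=; field; lra.
have F1 : s * b / 2 <= C6 * (t * t) * norm d.
  by apply: Rle_trans dl_ge _; apply: Rmult_le_compat_r.
have F2 : K * b = 2 * norm d * C6 + b by rewrite /K; field; lra.
have F3 : s * b = (2 * norm d * C6 + b) * (t * t) by rewrite -F2 /s; ring.
have : 0 < b * (t * t) by apply: Rmult_lt_0_compat; nra.
by nra.
Qed.

End Blowup.

Lemma singular_mass m (u : Rn m.+1 -> R) x0 M rho0 : (0 < m)%N ->
  convex_on unit_ball u -> alexandrov_det_ge1 unit_ball u ->
  unit_ball x0 -> ~ strictly_convex_at unit_ball u x0 -> 0 < M -> 0 < rho0 ->
  exists rho, 0 < rho < rho0 /\ mass_ge (grad_image u x0 rho) (M * rho ^ m).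
Proof.
move=> m0 Hu Ha Bx0 Hs M0 r0; apply: NNPP => H.
have [CV [CV0 HV]] := simplex_volume (ltn0Sn m) Hu Ha (Rlt_le _ _ Rlt_0_2).
apply: (bounded_mass_absurd m0 Hu CV0 HV Bx0 Hs M0 r0) => rho Hrho.
apply: NNPP => H1; apply: H; exists rho; split => // B S HB HS.
by apply: Rnot_lt_le => H2; apply: H1; exists B, S; split => //; lra.
Qed.

(** A contact segment is itself a simplex of height 0, so the volume bound [len <= CV * tau] holds
    for every positive [tau]. *)
Lemma no_singular_points_dim1 (u : Rn 1 -> R) x0 :
  convex_on unit_ball u -> alexandrov_det_ge1 unit_ball u ->
  unit_ball x0 -> strictly_convex_at unit_ball u x0.
Proof.
move=> Hu Ha Bx0; apply: NNPP => Hs.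
have [CV [CV0 HV]] := simplex_volume (ltn0Sn 0) Hu Ha (Rlt_le _ _ Rlt_0_2).
have [p Hp] := subgrad_exists Hu Bx0.
have [e [len [He len0 Be ge0]]] := singular_contact Bx0 Hs Hp.
pose tau := len / (2 * CV).
have tau0 : 0 < tau by apply: Rdiv_lt_0_compat; lra.
have := HV x0 p (fun=> e) (fun=> vscale len e) (fun=> len) tau Bx0 Hp.
have He2 : dot e e = 1 by rewrite -norm_sqr He; ring.
move=> H; have {}H : \rprod_(i < 1) len <= CV * tau ^ 1.
  apply: H => //.
  - by move=> [|i] [|j].
  - split => [//|[|i] // _|[|i] [|l]|[|i] [|l]] //.
    by rewrite dotZr He2 Rmult_1_r Rabs_pos_eq //; lra.
  - by move=> i _; split => //; move: ge0; rewrite /gap; nra.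
move: H; rewrite big_ord1 pow_1 (_ : CV * tau = len / 2); first lra.
by rewrite /tau; field; lra.
Qed.

(** * Covering argument *)

(** Compactness of the smaller closed ball: subgradients growing without bound would accumulate at a
    point with no local bound. *)
Lemma subgrad_bounded n (u : Rn n -> R) s : convex_on unit_ball u -> s < 1 ->
  exists C, forall y p, norm y <= s -> subgrad unit_ball u y p -> forall i, Rabs (p i) <= C.
Proof.
move=> Hu s1; apply: NNPP => H.
have /choice_fun[yp Hyp] : forall k : nat, exists yp : Rn n * Rn n,
    [/\ norm (fst yp) <= s, subgrad unit_ball u (fst yp) (snd yp) &
     ~ forall i, Rabs (snd yp i) <= INR k].
  move=> k; apply: NNPP => H'; apply: H; exists (INR k) => y p Hy Hp.
  by apply: NNPP => Hn; apply: H'; exists (y, p).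
have [|y Hy] := @bolzano_weierstrass n (fun k => fst (yp k)) s.
  by move=> k i; apply: Rle_trans (norm_coord _ i) _; case: (Hyp k).
have nn := pos_INR n.
have By : unit_ball y.
  apply/unit_ballE; pose e := (1 - s) / (2 * (INR n + 1)).
  have e0 : 0 < e by apply: Rdiv_lt_0_compat; lra.
  have [k [_ Hk]] := Hy e e0 0%N; have [A _ _] := Hyp k.
  have := norm_triang (fst (yp k)) (vsub y (fst (yp k))); rewrite vaddBK.
  have := @norm_le_coord _ (vsub y (fst (yp k))) e ltac:(lra) (near_sym Hk).
  have : (INR n + 1) * e = (1 - s) / 2 by rewrite /e; field; lra.
  by lra.
have [rho [C [r0 HC]]] := subgrad_locally_bounded Hu By.
have [N [_ HN]] := nat_floor (Rabs_pos C).
have [k [Nk Hk]] := Hy rho r0 N.+1; have [_ A B] := Hyp k; apply: B => i.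
apply: Rle_trans (HC _ _ Hk A i) _; apply: Rle_trans (Rle_abs _) _.
by have /le_INR := elimT leP Nk; rewrite S_INR; lra.
Qed.

Lemma separation_constant T (F : 'I_T -> 'I_T -> R) : (forall i j, i != j -> 0 < F i j) ->
  exists eta, 0 < eta /\ forall i j, i != j -> eta <= F i j.
Proof.
move=> HF.
have [K HK] : exists K, forall (i : 'I_T) k, (K <= k)%N -> forall j, i != j -> / (INR k + 1) <= F i j.
  apply: eventually_ord => i.
  have [K HK] := @eventually_ord T (fun j k => i != j -> / (INR k + 1) <= F i j) ltac:(
    by move=> j; have [->|ij] := eqVneq i j; [exists 0%N|
      have [N HN] := inv_succ_lt (HF i j ij); exists N => k /HN H _; lra]).
  by exists K => k Kk j; apply: HK.
exists (/ (INR K + 1)); split; last by move=> i j; apply: HK.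
by apply: Rinv_0_lt_compat; have := pos_INR K; lra.
Qed.

Lemma bounded_series (w : nat -> R) C : (forall k, 0 <= w k) ->
  (forall T, \rsum_(k < T) w k <= C) -> exists S, infinite_sum w S /\ S <= C.
Proof.
move=> w0 HC.
have E k : sum_f_R0 w k = \rsum_(i < k.+1) w i.
  by elim: k => [|k IH]; [rewrite big_ord1|rewrite /= IH [RHS]rsum_recr].
have [||S HS] := @growing_cv (fun k => sum_f_R0 w k).
- by move=> k /=; have := w0 k.+1; lra.
- by exists C => _ [k ->]; rewrite E.
exists S; split; first exact: HS.
apply: Rnot_lt_le => H; have [k Hk] := HS (S - C) ltac:(lra).
have := Hk k (le_n k); have := HC k.+1; rewrite /Rdist E => A /Rabs_def2; lra.
Qed.

Section Covering.
Variables (m : nat) (u : Rn m.+1 -> R) (E : Rn m.+1 -> Prop).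
Hypothesis HE : forall x, E x -> unit_ball x.
Hypothesis Hmass : forall x M rho0, E x -> 0 < M -> 0 < rho0 ->
  exists rho, 0 < rho < rho0 /\ mass_ge (grad_image u x rho) (M * rho ^ m).

Local Notation n := m.+1.

(* A ball carries its center, its radius and the index [k] of an annulus of the unit ball
   on which the gradients are bounded by [D k]. *)
Let ball := (Rn n * R * nat)%type.
Let ctr (b : ball) := b.1.1.
Let rad (b : ball) := b.1.2.
Let lvl (b : ball) := b.2.

Variables (eps delta : R) (D : nat -> R).
Hypotheses (eps0 : 0 < eps) (delta0 : 0 < delta) (D0 : forall k, 0 < D k).
Hypothesis HD : forall k x rho q, norm x <= 1 - / (INR k + 1) -> rho <= / (2 * (INR k + 1)) ->
  grad_image u x rho q -> forall i, Rabs (q i) <= D k.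

(** Packing at level [k] gives [ratio k] times the sum of [rad ^ m] at most [(2 * D k) ^ n]. The sum
    of [(10 * rad) ^ m] over this level is then at most [eps / 2] times [1 / 2 ^ (k + 1)]. *)
Let ratio k := (2 * D k) ^ n * 10 ^ m * (2 * 2 ^ k.+1) / eps.

Let good (b : ball) : Prop := [/\ E (ctr b), norm (ctr b) <= 1 - / (INR (lvl b) + 1),
  0 < rad b <= / (2 * (INR (lvl b) + 1)), rad b <= delta / 10 &
  mass_ge (grad_image u (ctr b) (rad b)) (ratio (lvl b) * rad b ^ m)].

Let disj (b b' : ball) : Prop := rad b + rad b' < dist (ctr b) (ctr b').

Lemma good_exists x : E x -> exists b, good b /\ ctr b = x.
Proof.
move=> Ex; have /unit_ballE nx := HE Ex.
have [k Hk] := @inv_succ_lt (1 - norm x) ltac:(lra).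
have Dk : 0 < ratio k.
  apply: Rdiv_lt_0_compat => //; apply: Rmult_lt_0_compat.
    by apply: Rmult_lt_0_compat; apply: pow_lt; [have := D0 k|]; lra.
  by apply: Rmult_lt_0_compat; [lra|apply: pow_lt; lra].
have i0 : 0 < / (2 * (INR k + 1)) by apply: Rinv_0_lt_compat; have := pos_INR k; lra.
have [rho [Hrho Hm]] := @Hmass x (ratio k) (Rmin (/ (2 * (INR k + 1))) (delta / 10)) Ex Dk
  ltac:(apply: Rmin_glb_lt; lra).
have H1 : norm x <= 1 - / (INR k + 1) by have := Hk k (leqnn k); lra.
exists (x, rho, k); split => //; split => //=.
- by rewrite /rad /lvl /=; have := Rmin_l (/ (2 * (INR k + 1))) (delta / 10); lra.
- by rewrite /rad /=; have := Rmin_r (/ (2 * (INR k + 1))) (delta / 10); lra.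
Qed.

(** Balls are sorted by level because the gradient bound, and with it the packing bound, degenerates
    towards the unit sphere; the geometric weights in [ratio] make the levels summable. *)
Lemma disjoint_sum T (b : nat -> option ball) :
  (forall t c, (t < T)%N -> b t = Some c -> good c) ->
  (forall s t c c', (s < T)%N -> (t < T)%N -> s <> t -> b s = Some c -> b t = Some c' -> disj c c') ->
  \rsum_(t < T) (if b t is Some c then (10 * rad c) ^ m else 0) <= eps / 2.
Proof.
move=> Hg Hd.
pose K := (\max_(t < T) (if b t is Some c then lvl c else 0%N)).+1.
have lvlK (t : 'I_T) c : b t = Some c -> (lvl c < K)%N.
  move=> bt; rewrite ltnS.
  by have := @leq_bigmax _ (fun t : 'I_T => if b t is Some c then lvl c else 0%N) t; rewrite bt.
pose part k t := if b t is Some c then if lvl c == k then (10 * rad c) ^ m else 0 else 0.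
have -> : \rsum_(t < T) (if b t is Some c then (10 * rad c) ^ m else 0) =
    \rsum_(t < T) \rsum_(k < K) part k t.
  apply: eq_bigr => t _; rewrite /part; case bt: (b t) => [c|]; last by rewrite big1.
  rewrite -[LHS](rsum_delta (Ordinal (lvlK t c bt)) (fun=> (10 * rad c) ^ m)).
  by apply: eq_bigr => k _; rewrite eq_sym.
rewrite rsum_exchange.
apply: Rle_trans (_ : \rsum_(k < K) (eps / 2 * / 2 ^ k.+1) <= _); last first.
  rewrite -rsum_mulr -[X in _ <= X]Rmult_1_r; apply: Rmult_le_compat_l; first lra.
  exact: rsum_geom_half.
apply: rsum_le => k _.
have P10 : 0 < 10 ^ m by apply: pow_lt; lra.
have D2 : 0 < (2 * D k) ^ n by apply: pow_lt; have := D0 k; lra.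
have P2 : 0 < 2 ^ k.+1 by apply: pow_lt; lra.
have ra0 : 0 < ratio k.
  by apply: Rdiv_lt_0_compat => //; apply: Rmult_lt_0_compat; [apply: Rmult_lt_0_compat|lra].
(* Finitely many separated balls have a common positive gap, which the 1-Lipschitz inverse gradient
   passes on to their gradient images. *)
pose G (s t : 'I_T) := if b s is Some c then
  if b t is Some c' then dist (ctr c) (ctr c') - rad c - rad c' else 1 else 1.
have [s t st|eta [eta0 Heta]] := @separation_constant T G.
  rewrite /G; case bs: (b s) => [c|]; last lra; case bt: (b t) => [c'|]; last lra.
  have := @Hd s t c c' (ltn_ord s) (ltn_ord t) _ bs bt; rewrite /disj.
  have ne : nat_of_ord s <> t by move=> /val_inj e; rewrite e eqxx in st.
  by move=> /(_ ne); lra.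
pose X (t : 'I_T) q := if b t is Some c then lvl c = k /\ grad_image u (ctr c) (rad c) q else False.
pose w (t : 'I_T) := if b t is Some c then if lvl c == k then ratio k * rad c ^ m else 0 else 0.
have Hpack : \rsum_(t < T) w t <= (2 * D k) ^ n.
  apply: (@packing n T X w (D k) eta (ltn0Sn m) (D0 k) eta0).
  - move=> t q; rewrite /X; case bt: (b t) => [c|] // [lc Hq].
    have [_ A [_ B] _ _] := Hg t c (ltn_ord t) bt.
    by rewrite lc in A B; apply: HD A B Hq.
  - move=> s t q q'; rewrite /X; case bs: (b s) => [c|] // [_ [y [By Hy Hq]]].
    case bt: (b t) => [c'|] // [_ [y' [By' Hy' Hq']]] Hqq.
    apply/eqP; apply: contraT => st; have := Heta s t st; rewrite /G bs bt.
    have := grad_inverse_lipschitz By By' Hq Hq'.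
    have := dist_triang (ctr c) y (ctr c'); have := dist_triang y y' (ctr c').
    by rewrite (dist_sym y' (ctr c')); lra.
  - move=> t; rewrite /X /w; case bt: (b t) => [c|]; last first.
      by move=> B S [HB _] HS; have := @infinite_sum_partial _ S 0 (fun k => box_vol_ge0 (HB k)) HS; rewrite big_ord0.
    case: eqP => [lc|lc].
      have [_ _ _ _ Hm] := Hg t c (ltn_ord t) bt; rewrite lc in Hm.
      by move=> B S [HB1 HB2] HS; apply: (Hm B S) => //; split => // q Hq; apply: HB2.
    by move=> B S [HB _] HS; have := @infinite_sum_partial _ S 0 (fun k => box_vol_ge0 (HB k)) HS; rewrite big_ord0.
apply: (Rmult_le_reg_l (ratio k)) => //.
have -> : ratio k * (eps / 2 * / 2 ^ k.+1) = 10 ^ m * (2 * D k) ^ n.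
  by rewrite /ratio; field; lra.
have -> : ratio k * (\rsum_(t < T) part k t) = 10 ^ m * (\rsum_(t < T) w t); last first.
  by apply: Rmult_le_compat_l; lra.
rewrite !rsum_mulr; apply: eq_bigr => t _; rewrite /part /w.
by case: (b t) => [c|]; [case: eqP => _; rewrite ?Rpow_mult_distr|]; ring.
Qed.

(** At each stage a ball disjoint from the earlier ones is taken, with radius at least half of any
    other available one. Every centre in [E] is caught by a fivefold enlargement. Stages without a
    ball contribute empty sets. *)
Lemma vitali_cover : exists (F : nat -> Rn n -> Prop) (d w : nat -> R) S,
      (forall x, E x -> exists k, F k x) /\
      (forall k, 0 <= d k <= delta) /\
      (forall k y z, F k y -> F k z -> dist y z <= d k) /\
      (forall k, 0 <= w k) /\
      (forall k, (exists x, F k x) -> d k ^ m <= w k) /\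
      infinite_sum w S /\ S < eps.
Proof.
pose avail (h : seq ball) c := good c /\ forall c', List.In c' h -> disj c c'.
have /choice_fun[nxt Hnxt] : forall h, exists o, match o with
    | Some c => avail h c /\ forall c', avail h c' -> rad c' <= 2 * rad c
    | None => forall c, ~ avail h c end.
  move=> h; have [[c Hc]|H] := classic (exists c, avail h c); last first.
    by exists None => c Hc; apply: H; exists c.
  have [||b [Hb _ Hb2]] := @nearly_maximal _ (avail h) rad (delta / 10) c Hc.
  - by case: Hc => [[_ _ []]].
  - by move=> z [[]].
  by exists (Some b).
pose H := fix H t := if t is t'.+1 then if nxt (H t') is Some c then c :: H t' else H t' else [::].
pose b t := nxt (H t).
have inH t c : List.In c (H t) <-> exists s, (s < t)%N /\ b s = Some c.
  elim: t => [|t IH]; first by split => // -[s []].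
  rewrite /=; case bt: (nxt (H t)) => [c1|]; split.
  - move=> [<-|/IH[s [st bs]]]; first by exists t; split.
    by exists s; split => //; apply: ltnW.
  - move=> [s []]; rewrite ltnS leq_eqVlt => /orP[/eqP ->|st] bs.
      by left; move: bs; rewrite /b bt => -[].
    by right; apply/IH; exists s.
  - by move=> /IH[s [st bs]]; exists s; split => //; apply: ltnW.
  - move=> [s []]; rewrite ltnS leq_eqVlt => /orP[/eqP ->|st] bs; first by move: bs; rewrite /b bt.
    by apply/IH; exists s.
have bgood t c : b t = Some c -> good c.
  by move=> bt; have := Hnxt (H t); rewrite -/(b t) bt => -[[]].
have bdisj s t c c' : (s < t)%N -> b s = Some c -> b t = Some c' -> disj c' c.
  move=> st bs bt; have := Hnxt (H t); rewrite -/(b t) bt => -[[_ Hd] _].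
  by apply: Hd; apply/inH; exists s.
pose w t := if b t is Some c then (10 * rad c) ^ m else 0.
have rad0 t c : b t = Some c -> 0 < rad c by move=> /bgood[_ _ []].
have w0 t : 0 <= w t.
  rewrite /w; case bt: (b t) => [c|]; last lra.
  by apply: pow_le; have := rad0 t c bt; lra.
have wsum T : \rsum_(t < T) w t <= eps / 2.
  apply: disjoint_sum => [t c _|s t c c' _ _ st bs bt]; first exact: bgood.
  have [lt|lt|//] := ltngtP s t; last exact: bdisj lt bt bs.
  by have := bdisj s t c c' lt bs bt; rewrite /disj dist_sym; lra.
have [S [HS Sle]] := bounded_series w0 wsum.
exists (fun t y => if b t is Some c then dist (ctr c) y <= 5 * rad c else False),
  (fun t => if b t is Some c then 10 * rad c else 0), w, S; do !split => //; last lra.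
- move=> x Ex; have [c [Gc cx]] := good_exists Ex.
  pose meets t := exists c', b t = Some c' /\ ~ disj c c'.
  have [t0 Ht0] : exists t, meets t.
    (* A ball that stays available forever forces all chosen radii to be at least half of its own,
       against the bound on the sums. *)
    apply: NNPP => Hno.
    have av t : avail (H t) c.
      split => // c' /inH[s [_ bs]]; apply: NNPP => Hn; apply: Hno; exists s, c'; split => //.
    have rc : 0 < rad c by case: Gc => _ _ [].
    pose om := (5 * rad c) ^ m; have om0 : 0 < om by apply: pow_lt; lra.
    have wom t : om <= w t.
      have := Hnxt (H t); rewrite -/(b t) /w; case: (b t) => [c'|] Hb; last by case: (Hb c).
      by case: Hb => _ /(_ c (av t)) Hr; apply: pow_incr; lra.
    have [|T [_ HT]] := @nat_floor (eps / 2 / om).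
      by apply: Rmult_le_pos; [lra|left; apply: Rinv_0_lt_compat].
    have := wsum T.+1; apply: Rlt_not_le.
    apply: Rlt_le_trans (_ : INR T.+1 * om <= _).
      rewrite S_INR (_ : eps / 2 = eps / 2 / om * om); last by field; lra.
      by apply: Rmult_lt_compat_r.
    by rewrite -rsum_const; apply: rsum_le.
  have [t [[c' [bt Hc']] Hmin]] : exists t, meets t /\ forall s, (s < t)%N -> ~ meets s.
    apply: NNPP => Hno; suff : forall t, ~ meets t by move=> /(_ t0).
    move=> t; have [k] := ubnP t; elim: k t => // k IH t; rewrite ltnS => tk Ht.
    apply: Hno; exists t; split => // s st; apply: IH; exact: leq_trans st tk.
  exists t; rewrite bt.
  (* At the first stage that meets it, [c] was still available, so [rad c <= 2 * rad c'], and the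
     centre of [c] is within [3 * rad c'] of that of [c']. *)
  have av : avail (H t) c.
    split => // c1 /inH[s [st bs]]; apply: NNPP => Hn; apply: (Hmin s st); exists c1; split => //.
  have := Hnxt (H t); rewrite -/(b t) bt => -[_ /(_ c av) Hr].
  have rc' := rad0 t c' bt.
  by move: Hc'; rewrite /disj cx dist_sym; lra.
- by case bt: (b k) => [c|]; [have := rad0 k c bt|]; lra.
- by case bt: (b k) => [c|]; [have [_ _ _ A _] := bgood k c bt; lra|lra].
- move=> k y z; case: (b k) => [c|] // Hy Hz.
  by have := dist_triang y (ctr c) z; rewrite (dist_sym y (ctr c)); lra.
- by move=> k [x]; rewrite /w; case: (b k) => [c|] // _; lra.
Qed.

End Covering.

Theorem theorem1p1 (n : nat) (u : Rn n -> R) :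
  (1 <= n)%nat ->
  convex_on unit_ball u ->
  alexandrov_det_ge1 unit_ball u ->
  hausdorff_null (n - 1)
    (fun x => unit_ball x /\ ~ strictly_convex_at unit_ball u x).
Proof.
case: n u => [|[|m]] // u _ Hu Ha eps delta eps0 delta0.
  (* For [n = 1] the measure is of dimension 0; the singular set is empty and is covered by empty
     sets. *)
  exists (fun _ _ => False), (fun=> 0), (fun=> 0), 0.
  split; first by move=> x [Bx []]; apply: no_singular_points_dim1.
  split; first by move=> k; lra.
  split; first by [].
  split; first by move=> k; lra.
  split; first by move=> k [].
  split => // e e0; exists 0%N => k _; rewrite /Rdist.
  rewrite (_ : sum_f_R0 (fun=> 0) k = 0); first by rewrite Rminus_diag Rabs_R0.
  by elim: k => [//|k /= ->]; lra.
(* Centres of level [k] have norm at most [1 - 1 / (k + 1)] and radii at most half of [1 / (k + 1)],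
   so the balls stay within [1 - 1 / (2 (k + 1))]. The [+ 1] added to the gradient bound later
   accounts for the term [y] in [q = p + y]. *)
have /choice_fun[C HC] : forall k : nat, exists C, forall y p, norm y <= 1 - / (2 * (INR k + 1)) ->
    subgrad unit_ball u y p -> forall i, Rabs (p i) <= C.
  move=> k; apply: subgrad_bounded => //.
  have : 0 < / (2 * (INR k + 1)) by apply: Rinv_0_lt_compat; have := pos_INR k; lra.
  lra.
rewrite subSS subn0.
apply: (@vitali_cover m.+1 u _ _ _ eps delta (fun k => Rabs (C k) + 1)) => //.
- by move=> x [].
- by move=> x M rho0 [Bx Hs] M0 r0; apply: singular_mass.
- by move=> k; have := Rabs_pos (C k); lra.
- move=> k x rho q nx Hrho [y [By xy Hq]] i.
  have kk := pos_INR k.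
  have E : / (2 * (INR k + 1)) = / (INR k + 1) / 2 by field; lra.
  have ny : norm y <= 1 - / (2 * (INR k + 1)).
    have := norm_triang x (vsub y x); rewrite vaddBK -distE dist_sym; lra.
  have := HC k y _ ny Hq i; rewrite /vsub => H.
  have := norm_coord y i; have /unit_ballE := By.
  have := Rabs_triang (q i - y i) (y i); rewrite (_ : q i - y i + y i = q i); last by ring.
  by have := Rle_abs (C k); lra.
Qed.
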